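(* Let $N\ge2$, $0<\theta<1$, let $\lambda_\theta$ be the lens map with parameter $\theta$, and let $\Phi\colon\mathbb{D}^N\to\mathbb{D}^N$ be $\Phi(z_1,\dots,z_N)=(\lambda_\theta(z_1),\lambda_\theta(z_1),\dots,\lambda_\theta(z_1))$. Then: (1) if $\theta>1/N$, $C_\Phi$ is not bounded on $H^2(\mathbb{D}^N)$; (2) if $\theta=1/N$, $C_\Phi$ is bounded but not compact on $H^2(\mathbb{D}^N)$; (3) if $\theta<1/N$, $C_\Phi$ is compact on $H^2(\mathbb{D}^N)$ and there are constants $d>0$ depending only on $\theta$ and $N$, and $K>0$, such that $a_n(C_\Phi)\le Ke^{-d\sqrt n}$ for all $n\ge1$.
   Context: The lens map of parameter $\theta\in(0,1)$ is $\lambda_\theta(z)=\dfrac{(1+z)^\theta-(1-z)^\theta}{(1+z)^\theta+(1-z)^\theta}$, $z\in\mathbb{D}$ (principal branches). $H^2(\mathbb{D}^N)$ is the Hardy space of the polydisk: analytic $f=\sum_\alpha a_\alpha z^\alpha$ with $\|f\|^2=\sum_\alpha|a_\alpha|^2<\infty$; $C_\Phi f=f\circ\Phi$. The approximation numbers are $a_n(T)=\inf\{\|T-R\|:\operatorname{rank}R<n\}$. *)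

(* Defs.v *)
From Stdlib Require Import Reals Lra Lia List.
Import ListNotations.
Open Scope R_scope.

Definition C : Type := (R * R)%type.
Definition RtoC (x : R) : C := (x, 0).
Definition C0 : C := (0, 0).
Definition C1 : C := (1, 0).
Definition Cadd (z w : C) : C := (fst z + fst w, snd z + snd w).
Definition Copp (z : C) : C := (- fst z, - snd z).
Definition Csub (z w : C) : C := Cadd z (Copp w).
Definition Cmul (z w : C) : C :=
  (fst z * fst w - snd z * snd w, fst z * snd w + snd z * fst w).
Definition Cnorm2 (z : C) : R := fst z * fst z + snd z * snd z.
Definition Cmod (z : C) : R := sqrt (Cnorm2 z).
Definition Cinv (z : C) : C := (fst z / Cnorm2 z, - snd z / Cnorm2 z).
Definition Cdiv (z w : C) : C := Cmul z (Cinv w).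
Fixpoint Cpow (z : C) (n : nat) : C :=
  match n with O => C1 | S k => Cmul z (Cpow z k) end.

Definition Arg (z : C) : R :=
  let x := fst z in let y := snd z in
  if Rlt_dec 0 x then atan (y / x)
  else if Rlt_dec x 0 then
         (if Rle_dec 0 y then atan (y / x) + PI else atan (y / x) - PI)
  else if Rlt_dec 0 y then PI / 2
  else if Rlt_dec y 0 then - (PI / 2) else 0.

(* principal branch of w^t = exp (t Log w), t real, w <> 0 (0 for w = 0) *)
Definition cpowR (w : C) (t : R) : C :=
  if Req_EM_T (Cmod w) 0 then C0
  else (Rpower (Cmod w) t * cos (t * Arg w), Rpower (Cmod w) t * sin (t * Arg w)).

Definition lens (theta : R) (z : C) : C :=
  let a := cpowR (Cadd C1 z) theta in
  let b := cpowR (Csub C1 z) theta in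
  Cdiv (Csub a b) (Cadd a b).

(* points of C^N : functions nat -> C (only coordinates 0..N-1 matter);
   multi-indices : lists of naturals of length N; coefficient families *)
Definition point := nat -> C.
Definition family := list nat -> C.

Definition inD (N : nat) (p : point) : Prop :=
  forall i, (i < N)%nat -> Cmod (p i) < 1.

Fixpoint mono_from (i : nat) (p : point) (alpha : list nat) : C :=
  match alpha with
  | [] => C1
  | k :: t => Cmul (Cpow (p i) k) (mono_from (S i) p t)
  end.
Definition mono (p : point) (alpha : list nat) : C := mono_from 0 p alpha.

Fixpoint box (n m : nat) : list (list nat) :=
  match n with
  | O => [ [] ]
  | S k => flat_map (fun j => map (cons j) (box k m)) (seq 0 m)
  end.

Definition Csum (l : list C) : C := fold_right Cadd C0 l.
Definition Rsum (l : list R) : R := fold_right Rplus 0 l.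

Definition Ccv (u : nat -> C) (l : C) : Prop :=
  Un_cv (fun m => Cmod (Csub (u m) l)) 0.

Definition sqsum (N : nat) (a : family) (s : R) : Prop :=
  Un_cv (fun m => Rsum (map (fun al => Cnorm2 (a al)) (box N m))) s.

(* a is the coefficient family of an element of H^2(D^N) *)
Definition l2 (N : nat) (a : family) : Prop := exists s, sqsum N a s.

Definition series_at (N : nat) (a : family) (p : point) (v : C) : Prop :=
  Ccv (fun m => Csum (map (fun al => Cmul (a al) (mono p al)) (box N m))) v.

Definition fsub (a b : family) : family := fun al => Csub (a al) (b al).

Definition norm_le (N : nat) (x y : family) (M : R) : Prop :=
  forall s t, sqsum N x s -> sqsum N y t -> s <= M * M * t.

(* b is the coefficient family of f o Phi, where f has coefficients a *)
Definition comp_rel (N : nat) (Phi : point -> point) (a b : family) : Prop :=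
  forall p, inD N p -> exists v, series_at N b p v /\ series_at N a (Phi p) v.

Definition CPhi_bounded (N : nat) (Phi : point -> point) : Prop :=
  (forall a, l2 N a -> exists b, l2 N b /\ comp_rel N Phi a b) /\
  exists M, 0 <= M /\
    forall a b, l2 N a -> l2 N b -> comp_rel N Phi a b -> norm_le N b a M.

Definition CPhi_compact (N : nat) (Phi : point -> point) : Prop :=
  CPhi_bounded N Phi /\
  forall (a b : nat -> family),
    (forall k, l2 N (a k) /\ (forall s, sqsum N (a k) s -> s <= 1) /\
               l2 N (b k) /\ comp_rel N Phi (a k) (b k)) ->
    exists phi : nat -> nat, (forall k, (phi k < phi (S k))%nat) /\
      exists c, l2 N c /\
        forall eps, 0 < eps -> exists K, forall k, (K <= k)%nat ->
          forall s, sqsum N (fsub (b (phi k)) c) s -> s <= eps.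

Definition lincomb (cs : list C) (vs : list family) : family :=
  fun al => Csum (map (fun cv => Cmul (fst cv) (snd cv al)) (combine cs vs)).

(* a_n(C_Phi) <= M, i.e. inf { ||C_Phi - R|| : rank R < n } <= M:
   for every eps > 0 there is a linear R on H^2 with range inside the span of
   fewer than n vectors of H^2 and ||C_Phi - R|| <= M + eps *)
Definition approx_num_le (N : nat) (Phi : point -> point) (n : nat) (M : R) : Prop :=
  forall eps, 0 < eps ->
    exists (Rop : family -> family) (vs : list family),
      (length vs < n)%nat /\ (forall v, In v vs -> l2 N v) /\
      (forall a a' c, l2 N a -> l2 N a' -> forall al,
          Rop (fun be => Cadd (a be) (Cmul c (a' be))) al
          = Cadd (Rop a al) (Cmul c (Rop a' al))) /\
      (forall a, l2 N a -> exists cs, length cs = length vs /\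
          forall al, Rop a al = lincomb cs vs al) /\
      (forall a b, l2 N a -> l2 N b -> comp_rel N Phi a b ->
          norm_le N (fsub b (Rop a)) a (M + eps)).

Definition Phi_lens (theta : R) : point -> point :=
  fun p => fun _ => lens theta (p 0%nat).

(* Main.v *)
(** On the diagonal [f o Phi] is the function [h(z) = sum_alpha a_alpha lambda(z)^|alpha|] of the
    first variable, and its norm is controlled by averages of [|h|^2] over circles (Parseval, with
    roots of unity in place of integrals).  Cauchy-Schwarz with the weights [1/(max(alpha_0, alpha_1)+1)]
    bounds [|h|^2] pointwise by
    [2 (1-|lambda|)^-(N-1) sum_alpha |a_alpha|^2 (|alpha|+1) |lambda|^|alpha|], and
    [1-|lambda(z)| >= c |1-z^2|^theta].  Summing over a circle gives
    [||f o Phi||^2 <= C sum_alpha |a_alpha|^2 (1+|alpha|)^-delta] with [delta = min(1, 1/theta - N)]: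
    boundedness when [theta <= 1/N], and compactness when [theta < 1/N].  Conversely, Szego
    kernels at [(r,...,r)], [r = lambda(x)], evaluated at [(x,0,...,0)] force [theta <= 1/N]
    for boundedness and [theta < 1/N] for compactness.

    For the approximation numbers, terms of degree at least [2^cI] are negligible by the gain
    [delta].  The exponents below are split into about [I] blocks of fixed relative length;
    since [1-|lambda|^2 >= kap |1-lambda^2|], the powers [lambda^k] in a block are, up to
    [2^-m], combinations of [2m] functions given by Taylor expansion in [1-lambda^2].
    With [m] of order [I] the rank is of order [I^2] and the error is exponentially small in [I]. *)
From Stdlib Require Import Reals Lra Lia List Permutation ClassicalEpsilon.
From Coquelicot Require Import Rcomplements Hierarchy Derive AutoDerive.
Require Import Defs.
Import ListNotations.
Open Scope R_scope.

(** * Complex numbers, finite sums and boxes of multi-indices *)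

(** The composite has to be exhibited as a coefficient family, so analyticity is encoded as uniform
    approximability by polynomials on every disc of radius r < 1. This class is closed under sums,
    products, inverses, exponentials and uniform limits, and it contains log(1+z), hence the lens
    map; discrete Parseval replaces Cauchy's estimates in recovering a power series.

    The lower bounds rest on a mismatch of reproducing kernels: evaluation at (x,0,...,0) has
    squared norm 1/(1-x^2), evaluation at its image (r,...,r) has (1-r^2)^(-N), of order at least
    (1-x)^(-theta N).

    In the upper bound, theta N + theta delta <= 1 keeps the singularity at 1 and -1 no worse than
    1/x, x being the distance along the circle. This critical power is still summable because the
    kernel of a fixed degree carries the factor y/(1+y)^2, with y proportional to x^theta, which
    makes the sum bounded independently of the degree.

    The Taylor order m = N I is dictated by a crude Cauchy-Schwarz bound over the at most (2 2^I)^N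
    multi-indices of low degree, a number that 4^(-m) must beat. *)

Lemma fun_choice {S T} (P : S -> T -> Prop) :
  (forall x, exists y, P x y) -> exists f, forall x, P x (f x).
Proof.
  intros H. exists (fun x => proj1_sig (constructive_indefinite_description _ (H x))).
  intros x; destruct constructive_indefinite_description; auto.
Qed.

Lemma inv_INR_small eps : 0 < eps -> exists K, forall k, (K <= k)%nat -> / INR (S k) <= eps.
Proof.
  intros He. destruct (INR_unbounded (/ eps)) as [K HK]. exists K; intros k Hk.
  apply Rinv_pos in He as He'. rewrite <- (Rinv_inv eps). apply Rinv_le_contravar; auto.
  apply le_INR in Hk. rewrite S_INR; lra.
Qed.

Lemma C_eq (z w : C) : fst z = fst w -> snd z = snd w -> z = w.
Proof. destruct z, w; simpl; congruence. Qed.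

Ltac Cdestr := intros; apply C_eq; unfold Csub, Cadd, Copp, Cmul, C0, C1, RtoC; simpl; try ring.

Lemma C_ring_theory : ring_theory C0 C1 Cadd Cmul Csub Copp (@eq C).
Proof. constructor; Cdestr. Qed.

Add Ring C_ring : C_ring_theory.

Lemma Cnorm2_nonneg z : 0 <= Cnorm2 z.
Proof. unfold Cnorm2; nra. Qed.

Lemma Cmod_nonneg z : 0 <= Cmod z.
Proof. apply sqrt_pos. Qed.

Lemma Cmod_sqr z : Cmod z * Cmod z = Cnorm2 z.
Proof. apply sqrt_sqrt, Cnorm2_nonneg. Qed.

Lemma Cnorm2_mul z w : Cnorm2 (Cmul z w) = Cnorm2 z * Cnorm2 w.
Proof. unfold Cnorm2, Cmul; simpl; ring. Qed.

Lemma Cmod_mul z w : Cmod (Cmul z w) = Cmod z * Cmod w.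
Proof. unfold Cmod; rewrite Cnorm2_mul; apply sqrt_mult; apply Cnorm2_nonneg. Qed.

Lemma Cmod_le_iff z x : 0 <= x -> (Cmod z <= x <-> Cnorm2 z <= x * x).
Proof.
  intros Hx; rewrite <- Cmod_sqr; pose proof (Cmod_nonneg z); split; intros; nra.
Qed.

Lemma Cmod_lt_iff z x : 0 <= x -> (Cmod z < x <-> Cnorm2 z < x * x).
Proof.
  intros Hx; rewrite <- Cmod_sqr; pose proof (Cmod_nonneg z); split; intros; nra.
Qed.

Lemma Cmod_fst z : Rabs (fst z) <= Cmod z.
Proof.
  apply Rsqr_incr_0_var; [|apply Cmod_nonneg].
  rewrite <- Rsqr_abs; unfold Rsqr; rewrite Cmod_sqr; unfold Cnorm2; nra.
Qed.

Lemma Cmod_snd z : Rabs (snd z) <= Cmod z.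
Proof.
  apply Rsqr_incr_0_var; [|apply Cmod_nonneg].
  rewrite <- Rsqr_abs; unfold Rsqr; rewrite Cmod_sqr; unfold Cnorm2; nra.
Qed.

Lemma Cmod_le_abs z : Cmod z <= Rabs (fst z) + Rabs (snd z).
Proof.
  pose proof (Rabs_pos (fst z)); pose proof (Rabs_pos (snd z)).
  apply Cmod_le_iff; [lra|]. unfold Cnorm2.
  pose proof (Rsqr_abs (fst z)); pose proof (Rsqr_abs (snd z)); unfold Rsqr in *; nra.
Qed.

Lemma Cmod_triangle z w : Cmod (Cadd z w) <= Cmod z + Cmod w.
Proof.
  pose proof (Cmod_nonneg z); pose proof (Cmod_nonneg w).
  apply Cmod_le_iff; [lra|].
  pose proof (Cmod_sqr z) as Ez; pose proof (Cmod_sqr w) as Ew.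
  assert (Hcs : fst z * fst w + snd z * snd w <= Cmod z * Cmod w).
  { apply Rsqr_incr_0_var; [|nra]. unfold Rsqr.
    replace (Cmod z * Cmod w * (Cmod z * Cmod w)) with (Cnorm2 z * Cnorm2 w)
      by (rewrite <- Ez, <- Ew; ring).
    unfold Cnorm2. pose proof (Rle_0_sqr (fst z * snd w - snd z * fst w)); unfold Rsqr in *; nra. }
  unfold Cnorm2 in *; simpl in *; nra.
Qed.

Lemma Cmod_opp z : Cmod (Copp z) = Cmod z.
Proof. unfold Cmod, Cnorm2, Copp; simpl; f_equal; ring. Qed.

Lemma Cmod_RtoC x : Cmod (RtoC x) = Rabs x.
Proof.
  unfold Cmod, Cnorm2, RtoC; simpl. rewrite Rmult_0_l, Rplus_0_r. apply sqrt_Rsqr_abs.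
Qed.

Lemma Cmod_C0 : Cmod C0 = 0.
Proof. change C0 with (RtoC 0); rewrite Cmod_RtoC; apply Rabs_R0. Qed.

Lemma Cmod_C1 : Cmod C1 = 1.
Proof. change C1 with (RtoC 1); rewrite Cmod_RtoC; apply Rabs_R1. Qed.

Lemma Cmod_sub_sym z w : Cmod (Csub z w) = Cmod (Csub w z).
Proof. rewrite <- Cmod_opp; f_equal; ring. Qed.

Lemma Cmod_sub_triangle z w : Cmod (Csub z w) <= Cmod z + Cmod w.
Proof. rewrite <- (Cmod_opp w); apply Cmod_triangle. Qed.

Lemma Cmod_triangle_rev z w : Cmod z <= Cmod w + Cmod (Csub z w).
Proof.
  replace z with (Cadd w (Csub z w)) at 1 by ring; apply Cmod_triangle.
Qed.

Lemma Cmod_via u z w : Cmod (Csub z w) <= Cmod (Csub z u) + Cmod (Csub u w).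
Proof.
  replace (Csub z w) with (Cadd (Csub z u) (Csub u w)) by ring; apply Cmod_triangle.
Qed.

Lemma Cmod_pow z n : Cmod (Cpow z n) = Cmod z ^ n.
Proof. induction n; simpl; [apply Cmod_C1|rewrite Cmod_mul, IHn; auto]. Qed.

Lemma Cnorm2_add_le z w : Cnorm2 (Cadd z w) <= 2 * Cnorm2 z + 2 * Cnorm2 w.
Proof.
  unfold Cnorm2, Cadd; simpl.
  pose proof (Rle_0_sqr (fst z - fst w)); pose proof (Rle_0_sqr (snd z - snd w)); unfold Rsqr in *; nra.
Qed.

Lemma Cnorm2_sub_le z w : Cnorm2 (Csub z w) <= 2 * Cnorm2 z + 2 * Cnorm2 w.
Proof.
  replace (Cnorm2 w) with (Cnorm2 (Copp w)) by (unfold Cnorm2, Copp; simpl; ring).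
  apply Cnorm2_add_le.
Qed.

Lemma Cnorm2_RtoC x : Cnorm2 (RtoC x) = x * x.
Proof. unfold Cnorm2, RtoC; simpl; ring. Qed.

Lemma Cnorm2_C0 : Cnorm2 C0 = 0.
Proof. unfold Cnorm2, C0; simpl; ring. Qed.

Lemma Cmod_eq_0 z : Cmod z = 0 -> z = C0.
Proof.
  intros H. pose proof (Cmod_sqr z) as E. rewrite H in E. unfold Cnorm2 in E.
  apply C_eq; simpl; nra.
Qed.

Lemma Cpow_add z m n : Cpow z (m + n) = Cmul (Cpow z m) (Cpow z n).
Proof. induction m; simpl; [|rewrite IHm]; ring. Qed.

Lemma Cpow_mul z w n : Cpow (Cmul z w) n = Cmul (Cpow z n) (Cpow w n).
Proof. induction n; simpl; [|rewrite IHn]; ring. Qed.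

Lemma Cpow_C1 n : Cpow C1 n = C1.
Proof. induction n; simpl; [|rewrite IHn]; ring. Qed.

Lemma Cpow_mult z m n : Cpow z (m * n) = Cpow (Cpow z m) n.
Proof.
  induction m; simpl; [symmetry; apply Cpow_C1|].
  rewrite Cpow_add, IHm, Cpow_mul; ring.
Qed.

Lemma Cpow_RtoC x n : Cpow (RtoC x) n = RtoC (x ^ n).
Proof. induction n; simpl; [reflexivity|rewrite IHn; Cdestr]. Qed.

(** * Finite sums over lists *)

Lemma Rsum_app l1 l2 : Rsum (l1 ++ l2) = Rsum l1 + Rsum l2.
Proof. induction l1; simpl; [|rewrite IHl1]; ring. Qed.

Lemma Csum_app l1 l2 : Csum (l1 ++ l2) = Cadd (Csum l1) (Csum l2).
Proof. induction l1; simpl; [|rewrite IHl1]; ring. Qed.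

Lemma Rsum_perm l1 l2 : Permutation l1 l2 -> Rsum l1 = Rsum l2.
Proof. induction 1; simpl; lra. Qed.

Lemma Csum_perm l1 l2 : Permutation l1 l2 -> Csum l1 = Csum l2.
Proof. induction 1; simpl; congruence || ring. Qed.

Section Sums.
Context {T : Type}.
Implicit Types (l : list T).

Lemma Rsum_ext (f g : T -> R) l :
  (forall x, In x l -> f x = g x) -> Rsum (map f l) = Rsum (map g l).
Proof. intros H; f_equal; apply map_ext_in, H. Qed.

Lemma Csum_ext (f g : T -> C) l :
  (forall x, In x l -> f x = g x) -> Csum (map f l) = Csum (map g l).
Proof. intros H; f_equal; apply map_ext_in, H. Qed.

Lemma Rsum_le (f g : T -> R) l :
  (forall x, In x l -> f x <= g x) -> Rsum (map f l) <= Rsum (map g l).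
Proof.
  induction l as [|x l IH]; simpl; intros H; [lra|].
  apply Rplus_le_compat; auto.
Qed.

Lemma Rsum_nonneg (f : T -> R) l :
  (forall x, In x l -> 0 <= f x) -> 0 <= Rsum (map f l).
Proof.
  induction l as [|x l IH]; simpl; intros H; [lra|].
  apply Rplus_le_le_0_compat; auto.
Qed.

Lemma Rsum_plus (f g : T -> R) l :
  Rsum (map (fun x => f x + g x) l) = Rsum (map f l) + Rsum (map g l).
Proof. induction l; simpl; [|rewrite IHl]; ring. Qed.

Lemma Rsum_scal c (f : T -> R) l :
  Rsum (map (fun x => c * f x) l) = c * Rsum (map f l).
Proof. induction l; simpl; [|rewrite IHl]; ring. Qed.

Lemma Rsum_const c l : Rsum (map (fun _ => c) l) = INR (length l) * c.
Proof.
  induction l as [|x l IH]; [simpl; ring|].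
  change (length (x :: l)) with (S (length l)); rewrite S_INR; simpl; rewrite IH; ring.
Qed.

Lemma Csum_add (f g : T -> C) l :
  Csum (map (fun x => Cadd (f x) (g x)) l) = Cadd (Csum (map f l)) (Csum (map g l)).
Proof. induction l; simpl; [|rewrite IHl]; ring. Qed.

Lemma Csum_sub (f g : T -> C) l :
  Csum (map (fun x => Csub (f x) (g x)) l) = Csub (Csum (map f l)) (Csum (map g l)).
Proof. induction l; simpl; [|rewrite IHl]; ring. Qed.

Lemma Csum_scal c (f : T -> C) l :
  Csum (map (fun x => Cmul c (f x)) l) = Cmul c (Csum (map f l)).
Proof. induction l; simpl; [|rewrite IHl]; ring. Qed.

Lemma Csum_zero (f : T -> C) l :
  (forall x, In x l -> f x = C0) -> Csum (map f l) = C0.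
Proof.
  induction l as [|x l IH]; simpl; intros H; [reflexivity|].
  rewrite H, IH; auto; ring.
Qed.

Lemma Csum_RtoC (f : T -> R) l :
  Csum (map (fun x => RtoC (f x)) l) = RtoC (Rsum (map f l)).
Proof. induction l; simpl; [reflexivity|rewrite IHl; Cdestr]. Qed.

Lemma Cmod_Csum_le (f : T -> C) l :
  Cmod (Csum (map f l)) <= Rsum (map (fun x => Cmod (f x)) l).
Proof.
  induction l; simpl; [rewrite Cmod_C0; lra|].
  eapply Rle_trans; [apply Cmod_triangle|lra].
Qed.

Lemma Rsum_cauchy_schwarz (f g : T -> R) l :
  Rsum (map (fun x => f x * g x) l) * Rsum (map (fun x => f x * g x) l)
  <= Rsum (map (fun x => f x * f x) l) * Rsum (map (fun x => g x * g x) l).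
Proof.
  induction l as [|x l IH]; simpl; [lra|].
  set (A := Rsum (map (fun x => f x * g x) l)) in *.
  set (F := Rsum (map (fun x => f x * f x) l)) in *.
  set (G := Rsum (map (fun x => g x * g x) l)) in *.
  assert (HF : 0 <= F) by (apply Rsum_nonneg; intros; nra).
  assert (HG : 0 <= G) by (apply Rsum_nonneg; intros; nra).
  set (u := f x); set (v := g x).
  (* The cross term of the enlarged sums: by induction its square is at most 4 F G u^2 v^2, and the
     inequality of arithmetic and geometric means bounds this by the square of the right-hand
     side. *)
  assert (H : 2 * A * u * v <= F * (v * v) + G * (u * u)).
  { apply Rle_trans with (Rabs (2 * A * u * v)); [apply Rle_abs|].
    apply Rsqr_incr_0_var; [|nra]. rewrite <- Rsqr_abs. unfold Rsqr.
    apply Rle_trans with (4 * (F * G) * ((u * v) * (u * v))).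
    - replace (2 * A * u * v * (2 * A * u * v)) with (4 * (A * A) * ((u * v) * (u * v))) by ring.
      apply Rmult_le_compat_r; [nra|lra].
    - pose proof (Rle_0_sqr (F * (v * v) - G * (u * u))); unfold Rsqr in *; nra. }
  nra.
Qed.

(** Plain Cauchy-Schwarz after writing a t as sqrt(x t) times a sqrt(t / x); the freedom lies in the
    choice of the weight [x]. *)
Lemma Rsum_cauchy_schwarz_weight (a x t : T -> R) l :
  (forall i, In i l -> 0 < x i) -> (forall i, In i l -> 0 <= t i) ->
  Rsum (map (fun i => a i * t i) l) * Rsum (map (fun i => a i * t i) l)
  <= Rsum (map (fun i => x i * t i) l) * Rsum (map (fun i => a i * a i * t i / x i) l).
Proof.
  intros Hx Ht.
  pose proof (Rsum_cauchy_schwarz (fun i => sqrt (x i * t i)) (fun i => a i * sqrt (t i / x i)) l) as H.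
  assert (Hs : forall i, In i l -> 0 <= x i * t i /\ 0 <= t i / x i).
  { intros i Hi; specialize (Hx i Hi); specialize (Ht i Hi); split; [nra|].
    apply Rmult_le_pos; [lra|]; left; apply Rinv_pos; lra. }
  rewrite (Rsum_ext _ (fun i => a i * t i)) in H.
  2:{ intros i Hi; destruct (Hs i Hi); specialize (Hx i Hi); specialize (Ht i Hi).
      replace (sqrt (x i * t i) * (a i * sqrt (t i / x i)))
        with (a i * (sqrt (x i * t i) * sqrt (t i / x i))) by ring.
      rewrite <- sqrt_mult by lra.
      replace (x i * t i * (t i / x i)) with (t i * t i) by (field; lra).
      rewrite sqrt_square by lra; reflexivity. }
  rewrite (Rsum_ext (fun i => sqrt (x i * t i) * sqrt (x i * t i)) (fun i => x i * t i)) in H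
    by (intros i Hi; destruct (Hs i Hi); apply sqrt_sqrt; lra).
  rewrite (Rsum_ext (fun i => a i * sqrt (t i / x i) * (a i * sqrt (t i / x i)))
            (fun i => a i * a i * t i / x i)) in H.
  2:{ intros i Hi; destruct (Hs i Hi); specialize (Hx i Hi).
      replace (a i * sqrt (t i / x i) * (a i * sqrt (t i / x i)))
        with (a i * a i * (sqrt (t i / x i) * sqrt (t i / x i))) by ring.
      rewrite sqrt_sqrt by lra; field; lra. }
  exact H.
Qed.

Lemma Cnorm2_Csum_mul_le (f g : T -> C) l :
  Cnorm2 (Csum (map (fun x => Cmul (f x) (g x)) l))
  <= Rsum (map (fun x => Cnorm2 (f x)) l) * Rsum (map (fun x => Cnorm2 (g x)) l).
Proof.
  rewrite <- Cmod_sqr.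
  pose proof (Cmod_Csum_le (fun x => Cmul (f x) (g x)) l) as H1.
  rewrite (Rsum_ext (fun x => Cmod (Cmul (f x) (g x))) (fun x => Cmod (f x) * Cmod (g x))) in H1
    by (intros; apply Cmod_mul).
  pose proof (Rsum_cauchy_schwarz (fun x => Cmod (f x)) (fun x => Cmod (g x)) l) as H2.
  rewrite (Rsum_ext (fun x => Cmod (f x) * Cmod (f x)) (fun x => Cnorm2 (f x))) in H2
    by (intros; apply Cmod_sqr).
  rewrite (Rsum_ext (fun x => Cmod (g x) * Cmod (g x)) (fun x => Cnorm2 (g x))) in H2
    by (intros; apply Cmod_sqr).
  pose proof (Cmod_nonneg (Csum (map (fun x => Cmul (f x) (g x)) l))); nra.
Qed.

Lemma Csum_single (f : T -> C) l x :
  NoDup l -> In x l -> (forall y, In y l -> y <> x -> f y = C0) ->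
  Csum (map f l) = f x.
Proof.
  intros ND Hin H0. destruct (in_split _ _ Hin) as (l1 & l2 & ->).
  rewrite map_app, Csum_app; simpl.
  apply NoDup_remove_2 in ND; rewrite in_app_iff in ND.
  rewrite (Csum_zero f l1), (Csum_zero f l2); [ring| |];
    intros y Hy; apply H0; try (rewrite in_app_iff; simpl; tauto);
    intros ->; tauto.
Qed.

(** Splits a sum over a large box into the sum over a smaller one and a remainder. A larger box need
    not extend the enumeration of the smaller one, hence a permutation. *)
Lemma incl_complement l l' :
  NoDup l -> NoDup l' -> incl l l' -> exists k, Permutation l' (l ++ k).
Proof.
  revert l'; induction l as [|x l IH]; intros l' N1 N2 Hi; [exists l'; reflexivity|].
  destruct (in_split x l' (Hi x (or_introl eq_refl))) as (u & v & ->).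
  inversion_clear N1.
  destruct (IH (u ++ v)) as [k Hk]; auto.
  - eapply NoDup_remove_1; eauto.
  - intros y Hy. assert (y <> x) by (intros ->; auto).
    specialize (Hi y (or_intror Hy)); rewrite in_app_iff in *; simpl in *.
    destruct Hi as [?|[?|?]]; auto; congruence.
  - exists k; simpl. rewrite <- Hk. symmetry; apply Permutation_middle.
Qed.

Lemma Rsum_incl (f : T -> R) l l' :
  NoDup l -> NoDup l' -> incl l l' -> (forall x, 0 <= f x) ->
  Rsum (map f l) <= Rsum (map f l').
Proof.
  intros N1 N2 Hi Hf. destruct (incl_complement l l' N1 N2 Hi) as [k Hk].
  rewrite (Rsum_perm _ _ (Permutation_map f Hk)), map_app, Rsum_app.
  pose proof (Rsum_nonneg f k (fun x _ => Hf x)); lra.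
Qed.

(** Only the terms outside [l] remain in the difference. Partial sums over boxes are thus Cauchy as
    soon as those of a majorant converge. *)
Lemma Csum_incl_diff (f : T -> C) (F : T -> R) l l' :
  NoDup l -> NoDup l' -> incl l l' -> (forall x, In x l' -> Cmod (f x) <= F x) ->
  Cmod (Csub (Csum (map f l')) (Csum (map f l)))
  <= Rsum (map F l') - Rsum (map F l).
Proof.
  intros N1 N2 Hi HF. destruct (incl_complement l l' N1 N2 Hi) as [k Hk].
  rewrite (Csum_perm _ _ (Permutation_map f Hk)), map_app, Csum_app.
  rewrite (Rsum_perm _ _ (Permutation_map F Hk)), map_app, Rsum_app.
  replace (Csub (Cadd (Csum (map f l)) (Csum (map f k))) (Csum (map f l)))
    with (Csum (map f k)) by ring.
  eapply Rle_trans; [apply Cmod_Csum_le|].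
  assert (Rsum (map (fun x => Cmod (f x)) k) <= Rsum (map F k)); [|lra].
  apply Rsum_le; intros x Hx; apply HF.
  apply (Permutation_in x (Permutation_sym Hk)), in_or_app; auto.
Qed.
End Sums.

Lemma Rsum_swap {S T : Type} (f : S -> T -> R) l k :
  Rsum (map (fun x => Rsum (map (f x) k)) l)
  = Rsum (map (fun y => Rsum (map (fun x => f x y) l)) k).
Proof.
  induction l as [|x l IH]; simpl.
  - rewrite Rsum_const; ring.
  - rewrite IH, <- Rsum_plus; reflexivity.
Qed.

Lemma Csum_swap {S T : Type} (f : S -> T -> C) l k :
  Csum (map (fun x => Csum (map (f x) k)) l)
  = Csum (map (fun y => Csum (map (fun x => f x y) l)) k).
Proof.
  induction l as [|x l IH]; simpl.
  - symmetry; apply Csum_zero; auto.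
  - rewrite IH, <- Csum_add; reflexivity.
Qed.

Lemma Rsum_flat_map {S T : Type} (f : T -> R) (g : S -> list T) l :
  Rsum (map f (flat_map g l)) = Rsum (map (fun x => Rsum (map f (g x))) l).
Proof. induction l; simpl; [auto|]. rewrite map_app, Rsum_app, IHl; auto. Qed.

Lemma Csum_flat_map {S T : Type} (f : T -> C) (g : S -> list T) l :
  Csum (map f (flat_map g l)) = Csum (map (fun x => Csum (map f (g x))) l).
Proof. induction l; simpl; [auto|]. rewrite map_app, Csum_app, IHl; auto. Qed.

Lemma Rsum_seq_S (f : nat -> R) n :
  Rsum (map f (seq 0 (S n))) = Rsum (map f (seq 0 n)) + f n.
Proof. rewrite seq_S, map_app, Rsum_app; simpl; ring. Qed.

Lemma Csum_seq_S (f : nat -> C) n :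
  Csum (map f (seq 0 (S n))) = Cadd (Csum (map f (seq 0 n))) (f n).
Proof. rewrite seq_S, map_app, Csum_app; simpl; ring. Qed.

Lemma Rsum_seq_shift (f : nat -> R) k n :
  Rsum (map f (seq k n)) = Rsum (map (fun i => f (k + i)%nat) (seq 0 n)).
Proof.
  induction n; [reflexivity|]. rewrite Rsum_seq_S, seq_S, map_app, Rsum_app, IHn; simpl; ring.
Qed.

Lemma geom_sum_le w m : 0 <= w < 1 -> Rsum (map (fun j => w ^ j) (seq 0 m)) <= / (1 - w).
Proof.
  intros Hw.
  assert (E : (1 - w) * Rsum (map (fun j => w ^ j) (seq 0 m)) = 1 - w ^ m).
  { induction m; [simpl; ring|]. rewrite Rsum_seq_S, Rmult_plus_distr_l, IHm; simpl; ring. }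
  apply Rmult_le_reg_l with (1 - w); [lra|]. rewrite E, Rinv_r by lra.
  pose proof (pow_le w m); lra.
Qed.

(** * Boxes of multi-indices *)

Lemma In_box n m al :
  In al (box n m) <-> length al = n /\ forall k, In k al -> (k < m)%nat.
Proof.
  revert al; induction n; intros al; simpl.
  - split.
    + intros [<-|[]]; split; [auto|intros k []].
    + intros [H _]; destruct al; [auto|discriminate].
  - rewrite in_flat_map; split.
    + intros (j & Hj & H). apply in_map_iff in H as (t & <- & Ht).
      apply IHn in Ht as [H1 H2]. apply in_seq in Hj. split; [simpl; auto|].
      intros k [<-|Hk]; [lia|auto].
    + intros [H1 H2]. destruct al as [|j t]; [discriminate|].
      exists j; split; [apply in_seq; specialize (H2 j (or_introl eq_refl)); lia|].
      apply in_map, IHn; split; [simpl in H1; lia|intros k Hk; apply H2; simpl; auto].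
Qed.

Lemma NoDup_box n m : NoDup (box n m).
Proof.
  induction n; simpl; [constructor; [intros []|constructor]|].
  assert (H : forall l, NoDup l -> NoDup (flat_map (fun j => map (cons j) (box n m)) l)).
  { induction l as [|j l IH]; simpl; intros N; [constructor|].
    inversion_clear N. apply NoDup_app; auto.
    - apply FinFun.Injective_map_NoDup; auto. intros x y; congruence.
    - intros al H1 H2. apply in_map_iff in H1 as (t & <- & _).
      apply in_flat_map in H2 as (i & Hi & H2). apply in_map_iff in H2 as (t' & E & _).
      injection E; intros; subst; auto. }
  apply H, seq_NoDup.
Qed.

Lemma incl_box n m m' : (m <= m')%nat -> incl (box n m) (box n m').
Proof.
  intros H al Hal; apply In_box in Hal as [H1 H2]; apply In_box; split; auto.
  intros k Hk; specialize (H2 k Hk); lia.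
Qed.

Lemma length_box n m : length (box n m) = (m ^ n)%nat.
Proof.
  induction n; simpl; [auto|].
  rewrite (flat_map_constant_length (c := (m ^ n)%nat)), length_seq; auto.
  intros; rewrite length_map; auto.
Qed.

Lemma Rsum_box_S (f : list nat -> R) n m :
  Rsum (map f (box (S n) m))
  = Rsum (map (fun j => Rsum (map (fun t => f (j :: t)) (box n m))) (seq 0 m)).
Proof.
  simpl. rewrite Rsum_flat_map. apply Rsum_ext; intros; rewrite map_map; auto.
Qed.

Lemma Csum_box_S (f : list nat -> C) n m :
  Csum (map f (box (S n) m))
  = Csum (map (fun j => Csum (map (fun t => f (j :: t)) (box n m))) (seq 0 m)).
Proof.
  simpl. rewrite Csum_flat_map. apply Csum_ext; intros; rewrite map_map; auto.
Qed.

Lemma list_sum_box n m al :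
  In al (box n m) -> (list_sum al <= n * m)%nat.
Proof.
  revert al; induction n; intros al H; apply In_box in H as [H1 H2].
  - destruct al; [simpl; lia|discriminate].
  - destruct al as [|j t]; [discriminate|].
    assert (In t (box n m)) by (apply In_box; split; [simpl in H1; lia|intros; apply H2; simpl; auto]).
    specialize (IHn t H). specialize (H2 j (or_introl eq_refl)). simpl; nia.
Qed.

(** Places the truncation by total degree inside a box, so that estimates by degree apply to sums
    over boxes. *)
Lemma In_box_of_deg n m al :
  length al = n -> (list_sum al < m)%nat -> In al (box n m).
Proof.
  intros H1 H2; apply In_box; split; auto.
  intros k Hk. assert (k <= list_sum al)%nat; [|lia].
  clear -Hk; induction al; simpl in *; [tauto|]. destruct Hk; [lia|specialize (IHal H); lia].
Qed.

Lemma geom_box_le w n m : 0 <= w < 1 ->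
  Rsum (map (fun al => w ^ list_sum al) (box n m)) <= (/ (1 - w)) ^ n.
Proof.
  intros Hw; assert (0 < / (1 - w)) by (apply Rinv_pos; lra).
  induction n; [simpl; lra|]. rewrite Rsum_box_S.
  rewrite (Rsum_ext _ (fun j => Rsum (map (fun al => w ^ list_sum al) (box n m)) * w ^ j)).
  2:{ intros j _. rewrite Rmult_comm, <- Rsum_scal. apply Rsum_ext; intros; simpl.
      apply pow_add. }
  rewrite Rsum_scal, Rmult_comm; simpl.
  apply Rmult_le_compat; auto using geom_sum_le.
  - apply Rsum_nonneg; intros; apply pow_le; lra.
  - apply Rsum_nonneg; intros; apply pow_le; lra.
Qed.

(** * Square-summable families and Parseval on grids *)

Lemma Ccv_eps (u : nat -> C) (l : C) :
  Ccv u l <-> forall eps, 0 < eps -> exists M, forall m, (M <= m)%nat -> Cmod (Csub (u m) l) <= eps.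
Proof.
  split; intros H eps Heps.
  - destruct (H eps Heps) as [M HM]; exists M; intros m Hm; specialize (HM m Hm).
    unfold R_dist in HM; rewrite Rminus_0_r, Rabs_pos_eq in HM by apply Cmod_nonneg; lra.
  - destruct (H (eps / 2) ltac:(lra)) as [M HM]; exists M; intros m Hm; specialize (HM m Hm).
    unfold R_dist; rewrite Rminus_0_r, Rabs_pos_eq by apply Cmod_nonneg; lra.
Qed.

Lemma Rle_eps_all x y : (forall eps, 0 < eps -> x <= y + eps) -> x <= y.
Proof. intros H; apply Rnot_lt_le; intros Hlt; specialize (H ((x - y) / 2) ltac:(lra)); lra. Qed.

Lemma Ccv_unique u l l' : Ccv u l -> Ccv u l' -> l = l'.
Proof.
  rewrite !Ccv_eps; intros H H'.
  assert (E : Cmod (Csub l l') <= 0).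
  { apply Rle_eps_all; intros eps Heps.
    destruct (H (eps / 2) ltac:(lra)) as [M HM], (H' (eps / 2) ltac:(lra)) as [M' HM'].
    specialize (HM (M + M')%nat ltac:(lia)); specialize (HM' (M + M')%nat ltac:(lia)).
    pose proof (Cmod_via (u (M + M')%nat) l l'). rewrite (Cmod_sub_sym l (u _)) in H0; lra. }
  pose proof (Cmod_nonneg (Csub l l')).
  assert (Z : Csub l l' = C0) by (apply Cmod_eq_0; lra).
  replace l with (Cadd l' (Csub l l')) by ring. rewrite Z; ring.
Qed.

Lemma Ccv_ext u u' l : (exists M, forall m, (M <= m)%nat -> u m = u' m) -> Ccv u l -> Ccv u' l.
Proof.
  rewrite !Ccv_eps; intros [M0 E] H eps Heps. destruct (H eps Heps) as [M HM].
  exists (M + M0)%nat; intros m Hm; rewrite <- E by lia; apply HM; lia.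
Qed.

Lemma Ccv_const l : Ccv (fun _ => l) l.
Proof.
  apply Ccv_eps; intros; exists 0%nat; intros.
  replace (Csub l l) with C0 by ring; rewrite Cmod_C0; lra.
Qed.

Lemma Ccv_add u v l l' : Ccv u l -> Ccv v l' -> Ccv (fun m => Cadd (u m) (v m)) (Cadd l l').
Proof.
  rewrite !Ccv_eps; intros H H' eps Heps.
  destruct (H (eps / 2) ltac:(lra)) as [M HM], (H' (eps / 2) ltac:(lra)) as [M' HM'].
  exists (M + M')%nat; intros m Hm; specialize (HM m ltac:(lia)); specialize (HM' m ltac:(lia)).
  replace (Csub (Cadd (u m) (v m)) (Cadd l l')) with (Cadd (Csub (u m) l) (Csub (v m) l')) by ring.
  eapply Rle_trans; [apply Cmod_triangle|lra].
Qed.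

Lemma Ccv_scal c u l : Ccv u l -> Ccv (fun m => Cmul c (u m)) (Cmul c l).
Proof.
  rewrite !Ccv_eps; intros H eps Heps. pose proof (Cmod_nonneg c).
  destruct (H (eps / (Cmod c + 1))) as [M HM]; [apply Rdiv_lt_0_compat; lra|].
  exists M; intros m Hm; specialize (HM m Hm).
  replace (Csub (Cmul c (u m)) (Cmul c l)) with (Cmul c (Csub (u m) l)) by ring.
  rewrite Cmod_mul. pose proof (Cmod_nonneg (Csub (u m) l)).
  apply Rle_trans with ((Cmod c + 1) * (eps / (Cmod c + 1))); [nra|].
  right; field; lra.
Qed.

Lemma Ccv_sub u v l l' : Ccv u l -> Ccv v l' -> Ccv (fun m => Csub (u m) (v m)) (Csub l l').
Proof.
  intros H H'. apply (Ccv_ext (fun m => Cadd (u m) (Cmul (Copp C1) (v m)))).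
  - exists 0%nat; intros; ring.
  - replace (Csub l l') with (Cadd l (Cmul (Copp C1) l')) by ring.
    apply Ccv_add; auto; apply Ccv_scal; auto.
Qed.

Lemma Ccv_Csum {T} (u : T -> nat -> C) (l : T -> C) (k : list T) :
  (forall x, In x k -> Ccv (u x) (l x)) ->
  Ccv (fun m => Csum (map (fun x => u x m) k)) (Csum (map l k)).
Proof.
  induction k as [|x k IH]; simpl; intros H; [apply Ccv_const|].
  apply Ccv_add; auto.
Qed.

Lemma Ccv_mod_le u l B : (exists M, forall m, (M <= m)%nat -> Cmod (u m) <= B) -> Ccv u l -> Cmod l <= B.
Proof.
  rewrite Ccv_eps; intros [M0 HB] H; apply Rle_eps_all; intros eps Heps.
  destruct (H eps Heps) as [M HM]. specialize (HM (M + M0)%nat ltac:(lia)); specialize (HB (M + M0)%nat ltac:(lia)).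
  pose proof (Cmod_triangle_rev l (u (M + M0)%nat)) as H0; rewrite (Cmod_sub_sym l) in H0; lra.
Qed.

Lemma Un_cv_growing_bounded (F : nat -> R) B :
  (forall m, F m <= F (S m)) -> (forall m, F m <= B) -> exists L, Un_cv F L.
Proof.
  intros G H. destruct (growing_cv F G) as [L HL]; [|eauto].
  exists B; intros x [m ->]; apply H.
Qed.

Lemma Un_cv_le (F : nat -> R) L B : (exists M, forall m, (M <= m)%nat -> F m <= B) -> Un_cv F L -> L <= B.
Proof.
  intros [M0 HB] H; apply Rle_eps_all; intros eps Heps.
  destruct (H eps Heps) as [M HM]. specialize (HM (M + M0)%nat ltac:(lia)); specialize (HB (M + M0)%nat ltac:(lia)).
  unfold R_dist in HM; apply Rabs_def2 in HM; lra.
Qed.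

Lemma Ccv_of_cauchy (u : nat -> C) :
  (forall eps, 0 < eps -> exists M, forall m m', (M <= m)%nat -> (m <= m')%nat ->
     Cmod (Csub (u m') (u m)) <= eps) -> exists l, Ccv u l.
Proof.
  intros CF.
  assert (Hc : forall g : C -> R, (forall z, Rabs (g z) <= Cmod z) ->
     (forall z w, g (Csub z w) = g z - g w) -> exists l, Un_cv (fun m => g (u m)) l).
  { intros g Hg Hs. destruct (Rcomplete.R_complete (fun m => g (u m))) as [l Hl]; [|eauto].
    intros eps Heps. destruct (CF (eps / 2) ltac:(lra)) as [M HM]. exists M; intros n m Hn Hm.
    assert (W : forall n m, (m <= n)%nat -> (M <= m)%nat -> R_dist (g (u n)) (g (u m)) < eps).
    { intros n' m' H1 H2. unfold R_dist. rewrite <- Hs.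
      eapply Rle_lt_trans; [apply Hg|]. specialize (HM m' n' H2 H1); lra. }
    destruct (Compare_dec.le_lt_dec m n); [apply W; auto|].
    rewrite R_dist_sym; apply W; auto; lia. }
  destruct (Hc fst Cmod_fst) as [x Hx]; [intros; simpl; ring|].
  destruct (Hc snd Cmod_snd) as [y Hy]; [intros; simpl; ring|].
  exists (x, y). apply Ccv_eps; intros eps Heps.
  destruct (Hx (eps / 2) ltac:(lra)) as [M HM], (Hy (eps / 2) ltac:(lra)) as [M' HM'].
  exists (M + M')%nat; intros m Hm.
  specialize (HM m ltac:(lia)); specialize (HM' m ltac:(lia)). unfold R_dist in *.
  eapply Rle_trans; [apply Cmod_le_abs|]. simpl. unfold Rminus in *; lra.
Qed.

Lemma Ccv_of_dominated (u : nat -> C) (F : nat -> R) L :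
  (forall m m', (m <= m')%nat -> Cmod (Csub (u m') (u m)) <= F m' - F m) ->
  Un_cv F L -> exists l, Ccv u l.
Proof.
  intros HF HL. apply Ccv_of_cauchy; intros eps Heps.
  destruct (CV_Cauchy F (exist _ L HL) eps Heps) as [M HM].
  exists M; intros m m' H1 H2. specialize (HM m' m ltac:(lia) ltac:(lia)). unfold R_dist in HM.
  eapply Rle_trans; [apply HF; auto|]. eapply Rle_trans; [apply Rle_abs|]; lra.
Qed.

Lemma Rsum_box_growing (f : list nat -> R) N m m' :
  (forall al, 0 <= f al) -> (m <= m')%nat ->
  Rsum (map f (box N m)) <= Rsum (map f (box N m')).
Proof. intros; apply Rsum_incl; auto using NoDup_box, incl_box. Qed.

Lemma l2_of_bound N a B :
  (forall m, Rsum (map (fun al => Cnorm2 (a al)) (box N m)) <= B) -> l2 N a.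
Proof.
  intros H. apply (Un_cv_growing_bounded _ B); auto.
  intros m; apply Rsum_box_growing; auto. intros; apply Cnorm2_nonneg.
Qed.

Lemma sqsum_ge N a s m : sqsum N a s -> Rsum (map (fun al => Cnorm2 (a al)) (box N m)) <= s.
Proof.
  intros H. apply (growing_ineq (fun m => Rsum (map (fun al => Cnorm2 (a al)) (box N m)))); auto.
  intros k; apply Rsum_box_growing; auto. intros; apply Cnorm2_nonneg.
Qed.

Lemma sqsum_le N a s B :
  sqsum N a s -> (forall m, Rsum (map (fun al => Cnorm2 (a al)) (box N m)) <= B) -> s <= B.
Proof. intros H HB; apply (Un_cv_le _ _ _ (ex_intro _ 0%nat (fun m _ => HB m)) H). Qed.

Lemma sqsum_nonneg N a s : sqsum N a s -> 0 <= s.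
Proof.
  intros H; eapply Rle_trans; [|apply (sqsum_ge N a s 0 H)].
  apply Rsum_nonneg; intros; apply Cnorm2_nonneg.
Qed.

Lemma l2_bound N a : l2 N a ->
  exists B, 0 <= B /\ forall m, Rsum (map (fun al => Cnorm2 (a al)) (box N m)) <= B.
Proof. intros [s Hs]; exists s; split; [eapply sqsum_nonneg; eauto|intros; eapply sqsum_ge; eauto]. Qed.

Lemma l2_sub N a b : l2 N a -> l2 N b -> l2 N (fsub a b).
Proof.
  intros Ha Hb. destruct (l2_bound N a Ha) as (A & _ & HA), (l2_bound N b Hb) as (B & _ & HB).
  apply (l2_of_bound N _ (2 * A + 2 * B)); intros m.
  eapply Rle_trans; [apply Rsum_le; intros al _; apply Cnorm2_sub_le|].
  rewrite Rsum_plus, !Rsum_scal. specialize (HA m); specialize (HB m); lra.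
Qed.

(** Absolute convergence on every smaller polydisk. This serves for families that represent a
    function but are not yet known to be square summable, such as the power series of a
    composite. *)
Definition asum (N : nat) (a : family) : Prop := forall r, 0 < r < 1 ->
  exists B, forall m, Rsum (map (fun al => Cmod (a al) * r ^ list_sum al) (box N m)) <= B.

Definition asum_at (N : nat) (a : family) (r L : R) : Prop :=
  Un_cv (fun m => Rsum (map (fun al => Cmod (a al) * r ^ list_sum al) (box N m))) L.

Lemma asum_lim N a r : asum N a -> 0 < r < 1 -> exists L, asum_at N a r L.
Proof.
  intros H Hr; destruct (H r Hr) as [B HB]. apply (Un_cv_growing_bounded _ B); auto.
  intros m; apply Rsum_box_growing; auto. intros.
  apply Rmult_le_pos; [apply Cmod_nonneg|apply pow_le; lra].
Qed.

(** Termwise |a| r^k <= |a|^2 + r^(2k), and the second family is a product of geometric series. *)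
Lemma l2_asum N a : l2 N a -> asum N a.
Proof.
  intros Ha r Hr. destruct (l2_bound N a Ha) as (B & HB0 & HB).
  set (G := (/ (1 - r * r)) ^ N).
  exists (B + G); intros m.
  pose proof (geom_box_le (r * r) N m ltac:(nra)) as HG. fold G in HG.
  eapply Rle_trans; [|apply Rplus_le_compat; [apply (HB m)|apply HG]].
  rewrite <- Rsum_plus. apply Rsum_le; intros al _.
  rewrite Rpow_mult_distr, <- Cmod_sqr.
  pose proof (pow_le r (list_sum al) ltac:(lra)); pose proof (Cmod_nonneg (a al)). nra.
Qed.

Lemma mono_from_le i p al r : 0 <= r ->
  (forall j, (i <= j < i + length al)%nat -> Cmod (p j) <= r) ->
  Cmod (mono_from i p al) <= r ^ list_sum al.
Proof.
  intros Hr; revert i; induction al as [|k t IH]; intros i H; simpl; [rewrite Cmod_C1; lra|].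
  rewrite Cmod_mul, Cmod_pow, pow_add. apply Rmult_le_compat.
  - apply pow_le, Cmod_nonneg.
  - apply Cmod_nonneg.
  - apply pow_incr; split; [apply Cmod_nonneg|apply H; simpl; lia].
  - apply IH; intros j Hj; apply H; simpl; lia.
Qed.

Lemma series_diff N a p r m m' : 0 <= r -> (forall i, (i < N)%nat -> Cmod (p i) <= r) ->
  (m <= m')%nat ->
  Cmod (Csub (Csum (map (fun al => Cmul (a al) (mono p al)) (box N m')))
             (Csum (map (fun al => Cmul (a al) (mono p al)) (box N m))))
  <= Rsum (map (fun al => Cmod (a al) * r ^ list_sum al) (box N m'))
     - Rsum (map (fun al => Cmod (a al) * r ^ list_sum al) (box N m)).
Proof.
  intros Hr Hp Hm. apply Csum_incl_diff; auto using NoDup_box, incl_box.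
  intros al Hal; apply In_box in Hal as [HL _]. rewrite Cmod_mul.
  apply Rmult_le_compat_l; [apply Cmod_nonneg|]. apply mono_from_le; auto.
  intros j Hj; apply Hp; lia.
Qed.

Lemma inD_radius N p : inD N p -> exists r, 0 < r < 1 /\ forall i, (i < N)%nat -> Cmod (p i) <= r.
Proof.
  intros H; induction N as [|N IH]; [exists (/2); split; [lra|intros; lia]|].
  destruct IH as (r & Hr & Hi); [intros i Hi; apply H; lia|].
  exists (Rmax r (Cmod (p N))). pose proof (H N ltac:(lia)).
  split; [split; [eapply Rlt_le_trans; [|apply Rmax_l]; lra|apply Rmax_lub_lt; lra]|].
  intros i Hi'. destruct (Nat.eq_dec i N) as [->|]; [apply Rmax_r|].
  eapply Rle_trans; [apply Hi; lia|apply Rmax_l].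
Qed.

Lemma asum_series N a p : asum N a -> inD N p -> exists v, series_at N a p v.
Proof.
  intros Ha Hp. destruct (inD_radius N p Hp) as (r & Hr & Hi).
  destruct (asum_lim N a r Ha Hr) as [L HL].
  apply (Ccv_of_dominated _ _ L) with (2 := HL). intros m m' Hm.
  apply series_diff; auto; lra.
Qed.

(** The bound does not involve the point, so truncations converge uniformly on the polydisk of
    radius [r]. *)
Lemma series_tail N a p r L v m : 0 <= r -> asum_at N a r L ->
  (forall i, (i < N)%nat -> Cmod (p i) <= r) -> series_at N a p v ->
  Cmod (Csub v (Csum (map (fun al => Cmul (a al) (mono p al)) (box N m))))
  <= L - Rsum (map (fun al => Cmod (a al) * r ^ list_sum al) (box N m)).
Proof.
  intros Hr HL Hp Hv.
  assert (G : forall k, Rsum (map (fun al => Cmod (a al) * r ^ list_sum al) (box N k)) <= L).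
  { intros k. apply (growing_ineq (fun k => Rsum (map (fun al => Cmod (a al) * r ^ list_sum al) (box N k)))); auto.
    intros j; apply Rsum_box_growing; auto. intros.
    apply Rmult_le_pos; [apply Cmod_nonneg|apply pow_le; lra]. }
  eapply Ccv_mod_le; [|apply Ccv_sub; [exact Hv|apply Ccv_const]].
  exists m; intros m' Hm'. eapply Rle_trans; [apply (series_diff N a p r); auto|].
  specialize (G m'); lra.
Qed.

Lemma series_sub N a b p v w : series_at N a p v -> series_at N b p w ->
  series_at N (fsub a b) p (Csub v w).
Proof.
  intros Hv Hw. eapply Ccv_ext; [|apply (Ccv_sub _ _ _ _ Hv Hw)].
  exists 0%nat; intros m _. rewrite <- Csum_sub. apply Csum_ext; intros; unfold fsub; ring.
Qed.

(** * Rotated roots of unity and Parseval's identity *)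

Definition cis (t : R) : C := (cos t, sin t).

Lemma cis_add s t : Cmul (cis s) (cis t) = cis (s + t).
Proof. unfold cis, Cmul; simpl. rewrite cos_plus, sin_plus. apply C_eq; simpl; ring. Qed.

Lemma Cnorm2_cis t : Cnorm2 (cis t) = 1.
Proof. unfold Cnorm2, cis; simpl. pose proof (sin2_cos2 t); unfold Rsqr in *; lra. Qed.

Lemma Cmod_cis t : Cmod (cis t) = 1.
Proof. unfold Cmod; rewrite Cnorm2_cis; apply sqrt_1. Qed.

Lemma Cpow_cis t n : Cpow (cis t) n = cis (INR n * t).
Proof.
  induction n; [simpl; unfold cis; rewrite Rmult_0_l, cos_0, sin_0; reflexivity|].
  simpl Cpow; rewrite IHn, cis_add, S_INR; f_equal; ring.
Qed.

(* The grid is rotated by half a step: its points stay away from the singular points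
   [1] and [-1] of the lens map, and the orthogonality sums below telescope. *)
Definition gang (M l : nat) : R := PI * (2 * INR l + 1) / INR M.
Definition gpt (r : R) (M l : nat) : C := Cmul (RtoC r) (cis (gang M l)).

Lemma Cmod_gpt r M l : 0 <= r -> Cmod (gpt r M l) = r.
Proof. intros; unfold gpt; rewrite Cmod_mul, Cmod_RtoC, Cmod_cis, Rabs_pos_eq; lra. Qed.

(** The angles are (2l+1)x with x = d pi / M, and 2 sin x cos((2l+1)x) = sin((2l+2)x) - sin(2lx),
    similarly for the sine. The ends of the telescope differ by 2 d pi, and 0 < d < M gives sin x >
    0. *)
Lemma grid_orthogonal (M d : nat) : (0 < d < M)%nat ->
  Rsum (map (fun l => cos (INR d * gang M l)) (seq 0 M)) = 0 /\
  Rsum (map (fun l => sin (INR d * gang M l)) (seq 0 M)) = 0.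
Proof.
  intros Hd. set (x := INR d * PI / INR M).
  assert (HM : 0 < INR M) by (apply lt_0_INR; lia).
  assert (Hx : 0 < sin x).
  { pose proof PI_RGT_0. assert (0 < INR d) by (apply lt_0_INR; lia).
    assert (INR d < INR M) by (apply lt_INR; lia).
    apply sin_gt_0; unfold x.
    - apply Rdiv_lt_0_compat; nra.
    - apply Rlt_div_l; nra. }
  assert (E : forall l, INR d * gang M l = 2 * INR l * x + x)
    by (intros; unfold gang, x; field; lra).
  assert (Hend : 2 * INR M * x = 2 * INR d * PI) by (unfold x; field; lra).
  assert (Hc : forall n, 2 * sin x * Rsum (map (fun l => cos (INR d * gang M l)) (seq 0 n))
                         = sin (2 * INR n * x)).
  { induction n; [simpl; rewrite !Rmult_0_r, Rmult_0_l, sin_0; auto|].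
    rewrite Rsum_seq_S, Rmult_plus_distr_l, IHn, E, S_INR.
    replace (2 * (INR n + 1) * x) with ((2 * INR n * x + x) + x) by ring.
    set (y := 2 * INR n * x + x). replace (2 * INR n * x) with (y - x) by (unfold y; ring).
    rewrite sin_minus, sin_plus; ring. }
  assert (Hs : forall n, 2 * sin x * Rsum (map (fun l => sin (INR d * gang M l)) (seq 0 n))
                         = 1 - cos (2 * INR n * x)).
  { induction n; [simpl; rewrite !Rmult_0_r, Rmult_0_l, cos_0; ring|].
    rewrite Rsum_seq_S, Rmult_plus_distr_l, IHn, E, S_INR.
    replace (2 * (INR n + 1) * x) with ((2 * INR n * x + x) + x) by ring.
    set (y := 2 * INR n * x + x). replace (2 * INR n * x) with (y - x) by (unfold y; ring).
    rewrite cos_minus, cos_plus; ring. }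
  specialize (Hc M); specialize (Hs M). rewrite Hend in Hc, Hs.
  rewrite <- (Rplus_0_l (2 * INR d * PI)), sin_period, sin_0 in Hc.
  rewrite <- (Rplus_0_l (2 * INR d * PI)), cos_period, cos_0 in Hs.
  split; apply Rmult_eq_reg_l with (2 * sin x); lra.
Qed.

Definition avg (M : nat) (f : nat -> R) : R := / INR M * Rsum (map f (seq 0 M)).

Lemma avg_le M f g : (forall l, (l < M)%nat -> f l <= g l) -> avg M f <= avg M g.
Proof.
  intros H. unfold avg. destruct M; [simpl; lra|].
  apply Rmult_le_compat_l; [left; apply Rinv_pos, lt_0_INR; lia|].
  apply Rsum_le; intros l Hl; apply in_seq in Hl; apply H; lia.
Qed.

Lemma avg_const M c : (0 < M)%nat -> avg M (fun _ => c) = c.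
Proof.
  intros; unfold avg. rewrite Rsum_const, length_seq. field. apply not_0_INR; lia.
Qed.

Lemma avg_plus M f g : avg M (fun l => f l + g l) = avg M f + avg M g.
Proof. unfold avg; rewrite Rsum_plus; ring. Qed.

Lemma avg_scal M c f : avg M (fun l => c * f l) = c * avg M f.
Proof. unfold avg; rewrite Rsum_scal; ring. Qed.

Lemma avg_Rsum {T} M (f : T -> nat -> R) k :
  avg M (fun l => Rsum (map (fun x => f x l) k)) = Rsum (map (fun x => avg M (f x)) k).
Proof. unfold avg. rewrite <- Rsum_swap, Rsum_scal; reflexivity. Qed.

(* Induction on the number of terms: each new monomial is orthogonal to the previous ones. *)
Lemma parseval_1d r M n (X : nat -> C) : (n <= M)%nat -> (0 < M)%nat ->
  avg M (fun l => Cnorm2 (Csum (map (fun j => Cmul (X j) (Cpow (gpt r M l) j)) (seq 0 n))))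
  = Rsum (map (fun j => Cnorm2 (X j) * (r * r) ^ j) (seq 0 n)).
Proof.
  intros Hn HM. induction n as [|n IH]; [simpl; rewrite avg_const by auto; apply Cnorm2_C0|].
  rewrite Rsum_seq_S, <- IH by lia.
  pose (re := fun z w : C => fst z * fst w + snd z * snd w).
  assert (Hre : forall z w, Cnorm2 (Cadd z w) = Cnorm2 z + (Cnorm2 w + 2 * re w z))
    by (intros; unfold Cnorm2, Cadd, re; simpl; ring).
  assert (Hrs : forall w k (f : nat -> C), re w (Csum (map f k)) = Rsum (map (fun j => re w (f j)) k)).
  { intros w k f; induction k; simpl; [unfold re; simpl; ring|].
    rewrite <- IHk; unfold re, Cadd; simpl; ring. }
  transitivity (avg M (fun l => Cnorm2 (Csum (map (fun j => Cmul (X j) (Cpow (gpt r M l) j)) (seq 0 n)))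
     + (Cnorm2 (X n) * (r * r) ^ n + 2 * Rsum (map (fun j => re (Cmul (X n) (Cpow (gpt r M l) n))
           (Cmul (X j) (Cpow (gpt r M l) j))) (seq 0 n))))).
  { unfold avg; f_equal; apply Rsum_ext; intros l _. rewrite Csum_seq_S, Hre, Hrs. f_equal. f_equal.
      rewrite Cnorm2_mul. f_equal. rewrite <- Cmod_sqr, Cmod_pow.
      rewrite <- Rpow_mult_distr, Cmod_sqr. f_equal. unfold gpt.
      rewrite Cnorm2_mul, Cnorm2_cis, Cnorm2_RtoC; ring. }
  rewrite avg_plus; f_equal. rewrite avg_plus, avg_const, avg_scal by auto.
  unfold avg; rewrite Rsum_swap, (Rsum_ext _ (fun _ : nat => 0)).
  - rewrite Rsum_const. ring.
  - intros j Hj; apply in_seq in Hj.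
    destruct (grid_orthogonal M (n - j) ltac:(lia)) as [Oc Os].
    (* [K] and [- J] are the real and imaginary parts of [X n] times the conjugate of [X j]; the
       inner product of the two monomials then depends on the angle only through [n - j]. *)
    pose (K := Rplus (fst (X n) * fst (X j)) (snd (X n) * snd (X j))).
    pose (J := fst (X n) * snd (X j) - snd (X n) * fst (X j)).
    rewrite (Rsum_ext _ (fun l => r ^ n * r ^ j * (K * cos (INR (n - j) * gang M l) + J * sin (INR (n - j) * gang M l)))).
    + rewrite Rsum_scal, Rsum_plus, !Rsum_scal, Oc, Os; ring.
    + intros l _. unfold gpt. rewrite !Cpow_mul, !Cpow_RtoC, !Cpow_cis.
      replace (INR n * gang M l) with (INR (n - j) * gang M l + INR j * gang M l)
        by (rewrite minus_INR by lia; ring).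
      rewrite <- cis_add. set (c := cis (INR (n - j) * gang M l)).
      pose proof (Cnorm2_cis (INR j * gang M l)) as E. unfold Cnorm2 in E.
      set (e := cis (INR j * gang M l)) in *.
      change (cos (INR (n - j) * gang M l)) with (fst c).
      change (sin (INR (n - j) * gang M l)) with (snd c).
      rewrite <- (Rmult_1_r (r ^ n * r ^ j * _)), <- E.
      unfold re, K, J, Cmul, RtoC; simpl; ring.
Qed.

Definition pcons (z : C) (p : point) : point := fun i => match i with O => z | S j => p j end.

(** Mean over a product grid on the torus of radius [r]. The first coordinate is averaged innermost,
    in step with the recursion of [box]; coordinates from [n] on are [C0]. *)
Fixpoint gavg (r : R) (n M : nat) (F : point -> R) : R :=
  match n with
  | O => F (fun _ => C0)
  | S k => gavg r k M (fun p => avg M (fun l => F (pcons (gpt r M l) p)))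
  end.

Lemma gavg_le r n M F G : 0 <= r -> (forall p, (forall i, Cmod (p i) <= r) -> F p <= G p) ->
  gavg r n M F <= gavg r n M G.
Proof.
  intros Hr; revert F G; induction n; intros F G H; simpl.
  - apply H; intros; rewrite Cmod_C0; auto.
  - apply IHn; intros p Hp. apply avg_le; intros l _. apply H.
    intros [|i]; simpl; [rewrite Cmod_gpt; lra|apply Hp].
Qed.

Lemma gavg_ext r n M F G : (forall p, F p = G p) -> gavg r n M F = gavg r n M G.
Proof.
  revert F G; induction n; intros F G H; simpl; [apply H|].
  apply IHn; intros p. unfold avg; f_equal. apply Rsum_ext; auto.
Qed.

Lemma gavg_plus r n M F G : gavg r n M (fun p => F p + G p) = gavg r n M F + gavg r n M G.
Proof.
  revert F G; induction n; intros F G; simpl; [auto|].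
  rewrite <- IHn. apply gavg_ext; intros; apply avg_plus.
Qed.

Lemma gavg_scal r n M c F : gavg r n M (fun p => c * F p) = c * gavg r n M F.
Proof.
  revert F; induction n; intros F; simpl; [auto|].
  rewrite <- IHn. apply gavg_ext; intros; apply avg_scal.
Qed.

Lemma gavg_const r n M c : (0 < M)%nat -> gavg r n M (fun _ => c) = c.
Proof.
  intros; induction n; simpl; [auto|].
  transitivity (gavg r n M (fun _ => c)); auto.
  apply gavg_ext; intros; apply avg_const; auto.
Qed.

Lemma gavg_Rsum {T} r n M (F : T -> point -> R) k :
  (0 < M)%nat ->
  gavg r n M (fun p => Rsum (map (fun x => F x p) k)) = Rsum (map (fun x => gavg r n M (F x)) k).
Proof.
  intros; induction k; simpl; [apply gavg_const; auto|].
  rewrite <- IHk, <- gavg_plus; auto.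
Qed.

Lemma gavg_first r n M (f : C -> R) : (0 < M)%nat ->
  gavg r (S n) M (fun p => f (p 0%nat)) = avg M (fun l => f (gpt r M l)).
Proof. intros; simpl; apply gavg_const; auto. Qed.

Lemma mono_from_pcons i z p al : mono_from (S i) (pcons z p) al = mono_from i p al.
Proof. revert i; induction al; intros; simpl; [auto|rewrite IHal; auto]. Qed.

(** With the other variables frozen, the sum is a polynomial in the first one whose coefficients are
    polynomials in the rest. The one-variable identity applies, then induction to each
    coefficient. *)
Lemma parseval_nd r n M m (b : family) : (m <= M)%nat -> (0 < M)%nat ->
  gavg r n M (fun p => Cnorm2 (Csum (map (fun al => Cmul (b al) (mono p al)) (box n m))))
  = Rsum (map (fun al => Cnorm2 (b al) * (r * r) ^ list_sum al) (box n m)).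
Proof.
  intros Hm HM. revert b; induction n; intros b.
  - simpl. unfold mono; simpl. rewrite !Rplus_0_r, Rmult_1_r. f_equal; ring.
  - rewrite Rsum_box_S.
    transitivity (gavg r n M (fun p => Rsum (map (fun j => (r * r) ^ j *
      Cnorm2 (Csum (map (fun t => Cmul (b (j :: t)) (mono p t)) (box n m)))) (seq 0 m)))).
    + cbn [gavg]. apply gavg_ext; intros p.
      rewrite (Rsum_ext _ (fun j => Cnorm2 (Csum (map (fun t => Cmul (b (j :: t)) (mono p t)) (box n m)))
        * (r * r) ^ j)) by (intros; ring).
      rewrite <- (parseval_1d r M m (fun j => Csum (map (fun t => Cmul (b (j :: t)) (mono p t)) (box n m))))
        by auto.
      unfold avg; f_equal. apply Rsum_ext; intros l _. f_equal.
      rewrite Csum_box_S. apply Csum_ext; intros j _.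
      replace (Cmul (Csum (map (fun t => Cmul (b (j :: t)) (mono p t)) (box n m))) (Cpow (gpt r M l) j))
        with (Cmul (Cpow (gpt r M l) j) (Csum (map (fun t => Cmul (b (j :: t)) (mono p t)) (box n m)))) by ring.
      rewrite <- Csum_scal. apply Csum_ext; intros t _.
      unfold mono; cbn [mono_from]. rewrite mono_from_pcons. simpl pcons. ring.
    + rewrite gavg_Rsum by auto. apply Rsum_ext; intros j _.
      rewrite gavg_scal, IHn, <- Rsum_scal. apply Rsum_ext; intros t _.
      change (list_sum (j :: t)) with (j + list_sum t)%nat. rewrite pow_add; ring.
Qed.

Lemma pow_le_anti x m n : 0 <= x <= 1 -> (m <= n)%nat -> x ^ n <= x ^ m.
Proof.
  intros Hx; induction 1; [lra|]. simpl. pose proof (pow_le x m0 ltac:(lra)); nra.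
Qed.

(* Parseval for truncations on finer and finer grids, then [r -> 1]. *)
Lemma sqsum_of_averages N b (h : point -> C) S :
  asum N b -> (forall p, inD N p -> series_at N b p (h p)) ->
  (forall r m, 0 < r < 1 -> (0 < m)%nat -> gavg r N (4 * m) (fun p => Cnorm2 (h p)) <= S) ->
  forall m, Rsum (map (fun al => Cnorm2 (b al)) (box N m)) <= 2 * S.
Proof.
  intros Hb Hh HS m.
  assert (HS0 : 0 <= S).
  { eapply Rle_trans; [|apply (HS (/2) 1%nat); [lra|lia]].
    rewrite <- (gavg_const (/2) N (4 * 1) 0) by lia.
    apply gavg_le; [lra|intros; apply Cnorm2_nonneg]. }
  assert (W : forall r, 0 < r < 1 ->
     Rsum (map (fun al => Cnorm2 (b al) * (r * r) ^ list_sum al) (box N m)) <= 2 * S).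
  { intros r Hr. destruct (asum_lim N b r Hb Hr) as [L HL].
    apply Rle_eps_all; intros eps Heps.
    destruct (HL (Rmin 1 (eps / 2))) as [k Hk]; [apply Rmin_glb_lt; lra|].
    (* A multiple of 4 as [HS] requires, at least [m], and past the index [k] from which the tail of
       the majorant is small. *)
    set (M := (4 * (k + m + 1))%nat).
    specialize (Hk M ltac:(unfold M; lia)). unfold R_dist in Hk.
    set (tau := L - Rsum (map (fun al => Cmod (b al) * r ^ list_sum al) (box N M))).
    assert (Ht : Rabs tau < Rmin 1 (eps / 2)) by (unfold tau; rewrite Rabs_minus_sym; exact Hk).
    assert (Ht2 : 2 * (tau * tau) <= eps).
    { pose proof (Rmin_l 1 (eps / 2)); pose proof (Rmin_r 1 (eps / 2)).
      apply Rabs_def2 in Ht. nra. }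
    eapply Rle_trans; [apply (Rsum_box_growing _ N m M)|].
    { intros; apply Rmult_le_pos; [apply Cnorm2_nonneg|apply pow_le; nra]. }
    { unfold M; lia. }
    rewrite <- (parseval_nd r N M M) by (unfold M; lia).
    (* Passing from the truncation to [h] by |s|^2 <= 2 |h|^2 + 2 |h - s|^2 is the origin of the
       factor 2 in the conclusion. *)
    eapply Rle_trans; [apply (gavg_le r N M _ (fun p => 2 * Cnorm2 (h p) + 2 * (tau * tau))); [lra|]|].
    - intros p Hp.
      set (s := Csum (map (fun al => Cmul (b al) (mono p al)) (box N M))).
      replace s with (Csub (h p) (Csub (h p) s)) by ring.
      eapply Rle_trans; [apply Cnorm2_sub_le|]. apply Rplus_le_compat_l, Rmult_le_compat_l; [lra|].
      assert (T : Cmod (Csub (h p) s) <= tau).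
      { apply series_tail; auto; [lra|]. apply Hh. intros i _; specialize (Hp i); lra. }
      rewrite <- Cmod_sqr. pose proof (Cmod_nonneg (Csub (h p) s)); nra.
    - rewrite gavg_plus, gavg_scal, gavg_const by (unfold M; lia).
      specialize (HS r (k + m + 1)%nat Hr ltac:(lia)). fold M in HS. lra. }
  apply Rnot_lt_le; intros Hlt.
  set (A := Rsum (map (fun al => Cnorm2 (b al)) (box N m))) in *.
  assert (Hr : forall r, 0 < r < 1 -> A * (r * r) ^ (N * m) <= 2 * S).
  { intros r Hr. eapply Rle_trans; [|apply (W r Hr)]. unfold A. rewrite Rmult_comm, <- Rsum_scal.
    apply Rsum_le; intros al Hal. rewrite Rmult_comm. apply Rmult_le_compat_l; [apply Cnorm2_nonneg|].
    apply list_sum_box in Hal. apply pow_le_anti; [nra|auto]. }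
  set (q := (N * m)%nat) in *.
  (* Bernoulli: (1 - x)^q >= 1 - q x with x = 1 - r^2 small *)
  assert (Bern : forall x k, 0 <= x <= 1 -> 1 - INR k * x <= (1 - x) ^ k).
  { intros x k Hx; induction k; [simpl; lra|]. rewrite S_INR; simpl.
    pose proof (pow_le (1 - x) k ltac:(lra)). pose proof (pos_INR k).
    apply Rle_trans with ((1 - x) * (1 - INR k * x)); [nra|]. apply Rmult_le_compat_l; lra. }
  (* Chosen so that A (q+1) x is half of the excess A - 2S; then A (1 - q x) still exceeds 2S, which
     contradicts [Hr] at the radius with r^2 = 1 - x. *)
  set (x := (A - 2 * S) / (2 * A * (INR q + 1))).
  assert (Hq := pos_INR q).
  assert (HA : 0 < A) by lra.
  assert (Hx : 0 < x < 1).
  { unfold x; split; [apply Rdiv_lt_0_compat; nra|].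
    apply Rlt_div_l; nra. }
  specialize (Hr (sqrt (1 - x))). specialize (Bern x q ltac:(lra)).
  rewrite sqrt_sqrt in Hr by lra.
  assert (Hs : 0 < sqrt (1 - x) < 1).
  { split; [apply sqrt_lt_R0; lra|]. rewrite <- sqrt_1 at 2. apply sqrt_lt_1; lra. }
  specialize (Hr Hs).
  assert (E : A * (INR q + 1) * x = (A - 2 * S) / 2) by (unfold x; field; lra).
  assert (A * (1 - INR q * x) <= A * (1 - x) ^ q) by (apply Rmult_le_compat_l; lra).
  nra.
Qed.

(** * Functions locally uniformly approximable by polynomials *)

Definition polyf (n : nat) (c : nat -> C) (z : C) : C :=
  Csum (map (fun j => Cmul (c j) (Cpow z j)) (seq 0 n)).
Definition is_poly (f : C -> C) : Prop := exists n c, forall z, f z = polyf n c z.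

Lemma is_poly_add f g : is_poly f -> is_poly g -> is_poly (fun z => Cadd (f z) (g z)).
Proof.
  intros (n & c & Hf) (m & d & Hg).
  exists (n + m)%nat, (fun j => Cadd (if Nat.ltb j n then c j else C0) (if Nat.ltb j m then d j else C0)).
  assert (P : forall k k' e z, (k <= k')%nat -> polyf k e z
    = Csum (map (fun j => Cmul (if Nat.ltb j k then e j else C0) (Cpow z j)) (seq 0 k'))).
  { intros k k' e z Hk. replace k' with (k + (k' - k))%nat by lia.
    rewrite seq_app, map_app, Csum_app. rewrite (Csum_zero _ (seq (0 + k) _)).
    - unfold polyf. rewrite (Csum_ext _ (fun j => Cmul (if Nat.ltb j k then e j else C0) (Cpow z j))); [ring|].
      intros j Hj; apply in_seq in Hj. destruct (Nat.ltb_spec j k); [auto|lia].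
    - intros j Hj; apply in_seq in Hj. destruct (Nat.ltb_spec j k); [lia|ring]. }
  intros z. rewrite Hf, Hg, (P n (n + m)%nat), (P m (n + m)%nat) by lia.
  unfold polyf. rewrite <- Csum_add. apply Csum_ext; intros; ring.
Qed.

Lemma is_poly_ext f g : (forall z, f z = g z) -> is_poly f -> is_poly g.
Proof. intros E (n & c & H); exists n, c; intros; rewrite <- E; auto. Qed.

Lemma is_poly_monomial a k : is_poly (fun z => Cmul a (Cpow z k)).
Proof.
  exists (S k), (fun j => if Nat.eqb j k then a else C0). intros z. unfold polyf.
  rewrite (Csum_single _ _ k).
  - rewrite Nat.eqb_refl; auto.
  - apply seq_NoDup.
  - apply in_seq; lia.
  - intros j _ Hj. destruct (Nat.eqb_spec j k); [congruence|ring].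
Qed.

Lemma is_poly_const a : is_poly (fun _ => a).
Proof. apply is_poly_ext with (2 := is_poly_monomial a 0); intros; simpl; ring. Qed.

Lemma is_poly_Csum {T} (f : T -> C -> C) (l : list T) :
  (forall x, In x l -> is_poly (f x)) -> is_poly (fun z => Csum (map (fun x => f x z) l)).
Proof.
  induction l as [|x l IH]; simpl; intros H; [apply is_poly_const|].
  apply (is_poly_add (f x)); auto.
Qed.

Lemma is_poly_mul f g : is_poly f -> is_poly g -> is_poly (fun z => Cmul (f z) (g z)).
Proof.
  intros (n & c & Hf) (m & d & Hg).
  apply is_poly_ext with (f := fun z => Csum (map (fun i => Csum (map (fun j =>
     Cmul (Cmul (c i) (d j)) (Cpow z (i + j))) (seq 0 m))) (seq 0 n))).
  - intros z. rewrite Hf, Hg. unfold polyf.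
    set (G := Csum (map (fun j => Cmul (d j) (Cpow z j)) (seq 0 m))).
    replace (Cmul (Csum (map (fun j => Cmul (c j) (Cpow z j)) (seq 0 n))) G)
      with (Cmul G (Csum (map (fun j => Cmul (c j) (Cpow z j)) (seq 0 n)))) by ring.
    rewrite <- Csum_scal. apply Csum_ext; intros i _.
    replace (Cmul G (Cmul (c i) (Cpow z i))) with (Cmul (Cmul (c i) (Cpow z i)) G) by ring.
    unfold G; rewrite <- Csum_scal. apply Csum_ext; intros j _. rewrite Cpow_add; ring.
  - apply (is_poly_Csum (fun i z => Csum (map (fun j =>
     Cmul (Cmul (c i) (d j)) (Cpow z (i + j))) (seq 0 m)))). intros i _.
    apply (is_poly_Csum (fun j z => Cmul (Cmul (c i) (d j)) (Cpow z (i + j)))). intros j _.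
    apply is_poly_monomial.
Qed.

Lemma is_poly_opp_arg f : is_poly f -> is_poly (fun z => f (Copp z)).
Proof.
  intros (n & c & Hf).
  apply is_poly_ext with (f := fun z => Csum (map (fun j =>
     Cmul (Cmul (c j) (Cpow (Copp C1) j)) (Cpow z j)) (seq 0 n))).
  - intros z; rewrite Hf. apply Csum_ext; intros j _.
    replace (Copp z) with (Cmul (Copp C1) z) by ring. rewrite Cpow_mul; ring.
  - apply (is_poly_Csum (fun j z => Cmul (Cmul (c j) (Cpow (Copp C1) j)) (Cpow z j))).
    intros; apply is_poly_monomial.
Qed.

Lemma is_poly_bounded f r : 0 <= r -> is_poly f -> exists B, 0 <= B /\ forall z, Cmod z <= r -> Cmod (f z) <= B.
Proof.
  intros Hr (n & c & Hf). exists (Rsum (map (fun j => Cmod (c j) * r ^ j) (seq 0 n))). split.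
  - apply Rsum_nonneg; intros; apply Rmult_le_pos; [apply Cmod_nonneg|apply pow_le; auto].
  - intros z Hz. rewrite Hf. eapply Rle_trans; [apply Cmod_Csum_le|].
    apply Rsum_le; intros j _. rewrite Cmod_mul, Cmod_pow.
    apply Rmult_le_compat_l; [apply Cmod_nonneg|].
    apply pow_incr; split; [apply Cmod_nonneg|auto].
Qed.

(** Uniform limits of polynomials on the closed disc of radius [r]. Required for all r < 1, this
    stands for analyticity in the unit disc. *)
Definition inA (r : R) (f : C -> C) : Prop := forall eps, 0 < eps ->
  exists p, is_poly p /\ forall z, Cmod z <= r -> Cmod (Csub (f z) (p z)) <= eps.

Lemma inA_poly r p : is_poly p -> inA r p.
Proof.
  intros H eps He; exists p; split; auto; intros z _.
  replace (Csub (p z) (p z)) with C0 by ring; rewrite Cmod_C0; lra.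
Qed.

Lemma inA_const r a : inA r (fun _ => a).
Proof. apply inA_poly, is_poly_const. Qed.

Lemma inA_limit r f : (forall eps, 0 < eps -> exists g, inA r g /\
  forall z, Cmod z <= r -> Cmod (Csub (f z) (g z)) <= eps) -> inA r f.
Proof.
  intros H eps He. destruct (H (eps / 2) ltac:(lra)) as (g & Hg & Hfg).
  destruct (Hg (eps / 2) ltac:(lra)) as (p & Hp & Hgp). exists p; split; auto.
  intros z Hz; specialize (Hfg z Hz); specialize (Hgp z Hz).
  pose proof (Cmod_via (g z) (f z) (p z)); lra.
Qed.

Lemma inA_ext r f g : (forall z, Cmod z <= r -> f z = g z) -> inA r f -> inA r g.
Proof.
  intros E Hf eps He; destruct (Hf eps He) as (p & Hp & H); exists p; split; auto.
  intros z Hz; rewrite <- E; auto.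
Qed.

Lemma inA_bounded r f : 0 <= r -> inA r f -> exists B, 0 <= B /\ forall z, Cmod z <= r -> Cmod (f z) <= B.
Proof.
  intros Hr Hf; destruct (Hf 1 ltac:(lra)) as (p & Hp & H).
  destruct (is_poly_bounded p r Hr Hp) as (B & HB0 & HB). exists (B + 1); split; [lra|].
  intros z Hz; specialize (HB z Hz); specialize (H z Hz).
  pose proof (Cmod_triangle_rev (f z) (p z)); lra.
Qed.

Lemma inA_add r f g : inA r f -> inA r g -> inA r (fun z => Cadd (f z) (g z)).
Proof.
  intros Hf Hg eps He. destruct (Hf (eps / 2) ltac:(lra)) as (p & Hp & H).
  destruct (Hg (eps / 2) ltac:(lra)) as (q & Hq & H').
  exists (fun z => Cadd (p z) (q z)); split; [apply is_poly_add; auto|].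
  intros z Hz; specialize (H z Hz); specialize (H' z Hz).
  replace (Csub (Cadd (f z) (g z)) (Cadd (p z) (q z)))
    with (Cadd (Csub (f z) (p z)) (Csub (g z) (q z))) by ring.
  eapply Rle_trans; [apply Cmod_triangle|lra].
Qed.

Lemma inA_mul r f g : 0 <= r -> inA r f -> inA r g -> inA r (fun z => Cmul (f z) (g z)).
Proof.
  intros Hr Hf Hg eps He.
  destruct (inA_bounded r f Hr Hf) as (F & HF0 & HF).
  (* The accuracy asked of [p] depends on a bound for [q], so [q] is chosen first; the [+ 1]
     excludes a zero denominator. *)
  destruct (Hg (eps / (2 * (F + 1)))) as (q & Hq & H'); [apply Rdiv_lt_0_compat; lra|].
  destruct (is_poly_bounded q r Hr Hq) as (Q & HQ0 & HQ).
  destruct (Hf (eps / (2 * (Q + 1)))) as (p & Hp & H); [apply Rdiv_lt_0_compat; lra|].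
  exists (fun z => Cmul (p z) (q z)); split; [apply is_poly_mul; auto|].
  intros z Hz; specialize (H z Hz); specialize (H' z Hz); specialize (HF z Hz); specialize (HQ z Hz).
  replace (Csub (Cmul (f z) (g z)) (Cmul (p z) (q z)))
    with (Cadd (Cmul (f z) (Csub (g z) (q z))) (Cmul (q z) (Csub (f z) (p z)))) by ring.
  eapply Rle_trans; [apply Cmod_triangle|]. rewrite !Cmod_mul.
  assert (F * (eps / (2 * (F + 1))) <= eps / 2).
  { apply Rmult_le_reg_r with (2 * (F + 1)); [lra|]. unfold Rdiv. rewrite !Rmult_assoc, Rinv_l by lra. nra. }
  assert (Q * (eps / (2 * (Q + 1))) <= eps / 2).
  { apply Rmult_le_reg_r with (2 * (Q + 1)); [lra|]. unfold Rdiv. rewrite !Rmult_assoc, Rinv_l by lra. nra. }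
  assert (Cmod (f z) * Cmod (Csub (g z) (q z)) <= F * (eps / (2 * (F + 1))))
    by (apply Rmult_le_compat; auto using Cmod_nonneg).
  assert (Cmod (q z) * Cmod (Csub (f z) (p z)) <= Q * (eps / (2 * (Q + 1))))
    by (apply Rmult_le_compat; auto using Cmod_nonneg).
  lra.
Qed.

Lemma inA_pow r f n : 0 <= r -> inA r f -> inA r (fun z => Cpow (f z) n).
Proof. intros; induction n; simpl; [apply inA_const|apply inA_mul; auto]. Qed.

Lemma inA_scal r a f : 0 <= r -> inA r f -> inA r (fun z => Cmul a (f z)).
Proof. intros; apply (inA_mul r (fun _ => a)); auto using inA_const. Qed.

Lemma inA_sub r f g : 0 <= r -> inA r f -> inA r g -> inA r (fun z => Csub (f z) (g z)).
Proof.
  intros; apply inA_ext with (f := fun z => Cadd (f z) (Cmul (Copp C1) (g z))); [intros; ring|].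
  apply inA_add, inA_scal; auto.
Qed.

Lemma inA_Csum {T} r (f : T -> C -> C) (l : list T) :
  (forall x, In x l -> inA r (f x)) -> inA r (fun z => Csum (map (fun x => f x z) l)).
Proof.
  induction l as [|x l IH]; simpl; intros H; [apply inA_const|].
  apply (inA_add r (f x)); auto.
Qed.

Lemma inA_opp_arg r f : inA r f -> inA r (fun z => f (Copp z)).
Proof.
  intros Hf eps He; destruct (Hf eps He) as (p & Hp & H).
  exists (fun z => p (Copp z)); split; [apply is_poly_opp_arg; auto|].
  intros z Hz; apply H; rewrite Cmod_opp; auto.
Qed.

Lemma pow_small x eps : 0 <= x < 1 -> 0 < eps -> exists n, x ^ n <= eps.
Proof.
  intros Hx He. destruct (pow_lt_1_zero x) with (y := eps) as [n Hn]; auto.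
  - rewrite Rabs_pos_eq; lra.
  - exists n; specialize (Hn n ltac:(lia)). eapply Rle_trans; [apply Rle_abs|lra].
Qed.

(** * Inverse, logarithm and exponential of approximable functions *)

Lemma Cinv_r z : 0 < Cnorm2 z -> Cmul z (Cinv z) = C1.
Proof.
  intros H; unfold Cmul, Cinv, C1; apply C_eq; simpl; unfold Cnorm2 in *; field; lra.
Qed.

Lemma Cnorm2_inv z : 0 < Cnorm2 z -> Cnorm2 (Cinv z) = / Cnorm2 z.
Proof.
  intros H. apply Rmult_eq_reg_l with (Cnorm2 z); [|lra].
  rewrite <- Cnorm2_mul, Cinv_r, Rinv_r by lra. unfold Cnorm2, C1; simpl; ring.
Qed.

Lemma Cmod_inv z : 0 < Cnorm2 z -> Cmod (Cinv z) = / Cmod z.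
Proof. intros H; unfold Cmod; rewrite Cnorm2_inv, sqrt_inv; auto. Qed.

(* Neumann series for [1 - t f] with a small real [t > 0]. *)
Lemma inA_inv r f c : 0 <= r -> 0 < c -> inA r f ->
  (forall z, Cmod z <= r -> c <= fst (f z)) -> inA r (fun z => Cinv (f z)).
Proof.
  intros Hr Hc Hf Hre. destruct (inA_bounded r f Hr Hf) as (B0 & HB0 & HB).
  set (B := B0 + c). assert (HBp : 0 < B) by (unfold B; lra).
  (* The minimiser of 1 - 2 t c + t^2 B^2, which bounds |1 - t f|^2; the minimum is 1 - c t. Adding
     [c] to the bound of f makes c <= B, so that this is nonnegative. *)
  set (t := c / (B * B)). assert (Ht : 0 < t) by (unfold t; apply Rdiv_lt_0_compat; nra).
  set (g := fun z => Csub C1 (Cmul (RtoC t) (f z))).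
  assert (Hg : inA r g).
  { apply (inA_sub r (fun _ => C1)); auto using inA_const, inA_scal. }
  set (q := sqrt (1 - c * t)).
  assert (Hct : 0 < c * t < 1 \/ c * t = 1).
  { assert (c * t <= 1); [|nra]. unfold t.
    apply Rmult_le_reg_r with (B * B); [nra|].
    replace (c * (c / (B * B)) * (B * B)) with (c * c) by (field; lra).
    unfold B; nra. }
  assert (Hq : 0 <= q < 1).
  { unfold q; split; [apply sqrt_pos|]. rewrite <- sqrt_1 at 2. apply sqrt_lt_1; lra. }
  assert (Hgq : forall z, Cmod z <= r -> Cmod (g z) <= q).
  { intros z Hz. apply Cmod_le_iff; [lra|]. unfold q; rewrite sqrt_sqrt by lra.
    assert (E : Cnorm2 (g z) = 1 - 2 * t * fst (f z) + t * t * Cnorm2 (f z))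
      by (unfold g, Cnorm2, Csub, Cadd, Copp, Cmul, RtoC, C1; simpl; ring).
    rewrite E. specialize (Hre z Hz). specialize (HB z Hz).
    assert (Cnorm2 (f z) <= B * B).
    { rewrite <- Cmod_sqr. pose proof (Cmod_nonneg (f z)). unfold B; nra. }
    assert (t * t * Cnorm2 (f z) <= t * t * (B * B)) by (apply Rmult_le_compat_l; nra).
    assert (t * t * (B * B) = c * t) by (unfold t; field; lra).
    assert (t * c <= t * fst (f z)) by (apply Rmult_le_compat_l; lra). lra. }
  apply inA_limit; intros eps He.
  destruct (pow_small q (eps * c)) as [K HK]; [auto|nra|].
  exists (fun z => Cmul (RtoC t) (Csum (map (fun n => Cpow (g z) n) (seq 0 K)))).
  split; [apply inA_scal; auto; apply (inA_Csum r (fun n z => Cpow (g z) n)); auto using inA_pow|].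
  intros z Hz.
  assert (Hn : 0 < Cnorm2 (f z)) by (specialize (Hre z Hz); unfold Cnorm2; nra).
  (* Since t f = 1 - g the geometric sum telescopes; dividing by f leaves the error g^K / f, at most
     q^K / c. *)
  assert (E : Csub C1 (Cmul (f z) (Cmul (RtoC t) (Csum (map (fun n => Cpow (g z) n) (seq 0 K))))) = Cpow (g z) K).
  { clear HK; induction K; [simpl; ring|]. rewrite Csum_seq_S. simpl Cpow.
    set (S := Csum _) in *. transitivity (Csub (Csub C1 (Cmul (f z) (Cmul (RtoC t) S)))
      (Cmul (f z) (Cmul (RtoC t) (Cpow (g z) K)))); [ring|].
    rewrite IHK. set (G := Cpow (g z) K). unfold g; ring. }
  replace (Csub (Cinv (f z)) _) with (Cmul (Cinv (f z)) (Cpow (g z) K)).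
  2:{ rewrite <- E. set (S := Cmul (RtoC t) _).
      replace (Cmul (Cinv (f z)) (Csub C1 (Cmul (f z) S)))
        with (Csub (Cinv (f z)) (Cmul (Cmul (f z) (Cinv (f z))) S)) by ring.
      rewrite Cinv_r by auto; ring. }
  rewrite Cmod_mul, Cmod_inv, Cmod_pow by auto.
  specialize (Hre z Hz). pose proof (Cmod_fst (f z)). pose proof (Rle_abs (fst (f z))).
  assert (Cmod (g z) ^ K <= q ^ K) by (apply pow_incr; split; auto using Cmod_nonneg).
  apply Rmult_le_reg_l with (Cmod (f z)); [lra|].
  rewrite <- Rmult_assoc, Rinv_r by lra. nra.
Qed.

Definition Clog1p (z : C) : C := (ln (Cmod (Cadd C1 z)), Arg (Cadd C1 z)).

Lemma fst_1p_pos z : Cmod z < 1 -> 0 < fst (Cadd C1 z).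
Proof.
  intros H; pose proof (Cmod_fst z) as H1. simpl.
  pose proof (Rle_abs (- fst z)) as H2; rewrite Rabs_Ropp in H2. lra.
Qed.

(** Taylor polynomial of log(1 + t z) as a function of the real parameter t on the segment from 0 to
    z. Its t-derivative [dlogpoly] is a truncated geometric series for z / (1 + t z). *)
Definition logpoly (n : nat) (z : C) (t : R) : C :=
  Csum (map (fun j => Cmul (RtoC ((-1) ^ j * / INR (S j) * t ^ (S j))) (Cpow z (S j))) (seq 0 n)).
Definition dlogpoly (n : nat) (z : C) (t : R) : C :=
  Csum (map (fun j => Cmul (RtoC ((-1) ^ j * t ^ j)) (Cpow z (S j))) (seq 0 n)).

Lemma is_derive_logpoly n z (t : R) :
  is_derive (fun t => fst (logpoly n z t)) t (fst (dlogpoly n z t)) /\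
  is_derive (fun t => snd (logpoly n z t)) t (snd (dlogpoly n z t)).
Proof.
  assert (T : forall k u, is_derive (fun t => (-1) ^ k * / INR (S k) * t ^ (S k) * u) t ((-1) ^ k * t ^ k * u)).
  { intros k u. assert (INR (S k) <> 0) by (apply not_0_INR; lia).
    auto_derive; [auto|]. rewrite S_INR in *. destruct k; simpl in *; field; auto. }
  induction n as [|n [I1 I2]]; [split; exact (is_derive_const 0 t)|].
  assert (E1 : forall t, fst (logpoly (S n) z t) = fst (logpoly n z t)
     + (-1) ^ n * / INR (S n) * t ^ (S n) * fst (Cpow z (S n))).
  { intros s; unfold logpoly; rewrite Csum_seq_S. unfold Cadd, Cmul, RtoC; cbn [fst snd]; ring. }
  assert (E2 : forall t, snd (logpoly (S n) z t) = snd (logpoly n z t)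
     + (-1) ^ n * / INR (S n) * t ^ (S n) * snd (Cpow z (S n))).
  { intros s; unfold logpoly; rewrite Csum_seq_S. unfold Cadd, Cmul, RtoC; cbn [fst snd]; ring. }
  split; eapply is_derive_ext; try (intros s; symmetry; apply E1 || apply E2).
  - replace (fst (dlogpoly (S n) z t)) with (fst (dlogpoly n z t) + (-1) ^ n * t ^ n * fst (Cpow z (S n)))
      by (unfold dlogpoly; rewrite Csum_seq_S; unfold Cadd, Cmul, RtoC; cbn [fst snd]; ring).
    apply (is_derive_plus (K := R_AbsRing) (V := R_NormedModule)); auto.
  - replace (snd (dlogpoly (S n) z t)) with (snd (dlogpoly n z t) + (-1) ^ n * t ^ n * snd (Cpow z (S n)))
      by (unfold dlogpoly; rewrite Csum_seq_S; unfold Cadd, Cmul, RtoC; cbn [fst snd]; ring).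
    apply (is_derive_plus (K := R_AbsRing) (V := R_NormedModule)); auto.
Qed.

Lemma ln_sqrt x : 0 < x -> ln (sqrt x) = / 2 * ln x.
Proof.
  intros H. pose proof (sqrt_lt_R0 x H). rewrite <- (sqrt_sqrt x) at 2 by lra.
  rewrite ln_mult by auto. field.
Qed.

Lemma exp_pow x n : exp x ^ n = exp (INR n * x).
Proof.
  induction n; [simpl; rewrite Rmult_0_l, exp_0; auto|].
  rewrite S_INR; simpl; rewrite IHn, <- exp_plus; f_equal; ring.
Qed.

Lemma exp_le x y : x <= y -> exp x <= exp y.
Proof. intros [H| ->]; [left; apply exp_increasing; auto|lra]. Qed.

Lemma mvt_interval (f df : R -> R) a b : a <= b ->
  (forall t, a <= t <= b -> is_derive f t (df t)) ->
  exists c, a <= c <= b /\ f b - f a = df c * (b - a).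
Proof.
  intros Hab H. destruct (MVT_gen f a b df) as (c & Hc & E).
  - intros t Ht. rewrite Rmin_left, Rmax_right in Ht by lra. apply H; lra.
  - intros t Ht. rewrite Rmin_left, Rmax_right in Ht by lra.
    apply derivable_continuous_pt. exists (df t). apply is_derive_Reals, H; lra.
  - rewrite Rmin_left, Rmax_right in Hc by lra. eauto.
Qed.

Lemma dlogpoly_remainder n z t :
  let w := Cadd C1 (Cmul (RtoC t) z) in 0 < Cnorm2 w ->
  Csub (Cmul z (Cinv w)) (dlogpoly n z t)
  = Cmul (Cmul z (Cinv w)) (Cpow (Copp (Cmul (RtoC t) z)) n).
Proof.
  intros w Hw.
  assert (E : Cmul w (dlogpoly n z t) = Cmul z (Csub C1 (Cpow (Copp (Cmul (RtoC t) z)) n))).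
  { induction n; [simpl; unfold dlogpoly; simpl; ring|].
    unfold dlogpoly in *. rewrite Csum_seq_S.
    set (S := Csum _) in *. transitivity (Cadd (Cmul w S) (Cmul w (Cmul (RtoC ((-1) ^ n * t ^ n)) (Cpow z (Datatypes.S n))))); [ring|].
    rewrite IHn.
    assert (E : Cpow (Copp (Cmul (RtoC t) z)) n = Cmul (RtoC ((-1) ^ n * t ^ n)) (Cpow z n)).
    { replace (Copp (Cmul (RtoC t) z)) with (Cmul (RtoC (-1 * t)) z) by (Cdestr).
      rewrite Cpow_mul, Cpow_RtoC, Rpow_mult_distr; auto. }
    simpl Cpow. rewrite E. unfold w. ring. }
  replace (dlogpoly n z t) with (Cmul (Cmul w (Cinv w)) (dlogpoly n z t)) by (rewrite Cinv_r by auto; ring).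
  replace (Cmul (Cmul w (Cinv w)) (dlogpoly n z t)) with (Cmul (Cinv w) (Cmul w (dlogpoly n z t))) by ring.
  rewrite E; ring.
Qed.

(** Real and imaginary parts of the error are functions of t on [0,1] that vanish at 0 and whose
    derivatives are parts of the geometric remainder. The mean value theorem is applied to each
    separately, whence the factor 2. *)
Lemma Clog1p_approx z r n : 0 <= r < 1 -> Cmod z <= r ->
  Cmod (Csub (Clog1p z) (logpoly n z 1)) <= 2 * (r ^ n / (1 - r)).
Proof.
  intros Hr Hz. destruct z as [x y].
  set (z := (x, y)) in *.
  assert (Hx : Rabs x <= r) by (eapply Rle_trans; [apply (Cmod_fst z)|auto]).
  assert (Hx' : -r <= x <= r) by (apply Rabs_le_between; auto).
  set (w := fun t => Cadd C1 (Cmul (RtoC t) z)).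
  assert (Hw : forall t, 0 <= t <= 1 -> 1 - r <= fst (w t) /\ 0 < Cnorm2 (w t)).
  { intros t Ht. assert (1 - r <= fst (w t)); [unfold w; simpl; nra|].
    split; auto. unfold Cnorm2; nra. }
  set (d := fun t => Csub (Cmul z (Cinv (w t))) (dlogpoly n z t)).
  assert (Hd : forall t, 0 <= t <= 1 -> Cmod (d t) <= r ^ n / (1 - r)).
  { intros t Ht. destruct (Hw t Ht) as [W1 W2]. unfold d, w. rewrite dlogpoly_remainder by apply W2.
    fold (w t). rewrite !Cmod_mul, Cmod_pow, Cmod_opp, Cmod_mul, Cmod_inv, Cmod_RtoC, (Rabs_pos_eq t) by (auto; lra).
    assert (1 - r <= Cmod (w t)) by (eapply Rle_trans; [|apply Cmod_fst]; rewrite Rabs_pos_eq; lra).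
    pose proof (Cmod_nonneg z).
    assert (/ Cmod (w t) <= / (1 - r)) by (apply Rinv_le_contravar; lra).
    assert (0 < / Cmod (w t)) by (apply Rinv_pos; lra).
    assert ((t * Cmod z) ^ n <= r ^ n) by (apply pow_incr; nra).
    assert (0 <= (t * Cmod z) ^ n) by (apply pow_le; nra).
    rewrite Rmult_comm. unfold Rdiv. apply Rmult_le_compat; auto; nra. }
  set (D1 := fun t => / 2 * ln ((1 + t * x) * (1 + t * x) + (t * y) * (t * y)) - fst (logpoly n z t)).
  set (D2 := fun t => atan ((t * y) / (1 + t * x)) - snd (logpoly n z t)).
  assert (HN : forall t, 0 <= t <= 1 -> 0 < 1 + t * x) by (intros t Ht; nra).
  assert (HD1 : forall t, 0 <= t <= 1 -> is_derive D1 t (fst (d t))).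
  { intros t Ht. apply (is_derive_minus (K := R_AbsRing) (V := R_NormedModule));
      [|apply is_derive_logpoly].
    specialize (HN t Ht).
    assert (0 < (1 + t * x) * (1 + t * x) + t * y * (t * y)) by nra.
    auto_derive; [auto|]. unfold Cmul, Cinv, w, z, Cadd, Cmul, C1, RtoC, Cnorm2; simpl.
    field; nra. }
  assert (HD2 : forall t, 0 <= t <= 1 -> is_derive D2 t (snd (d t))).
  { intros t Ht. apply (is_derive_minus (K := R_AbsRing) (V := R_NormedModule));
      [|apply is_derive_logpoly].
    specialize (HN t Ht).
    assert (0 < (1 + t * x) * (1 + t * x) + t * y * (t * y)) by nra.
    auto_derive; [lra|]. unfold Cmul, Cinv, w, z, Cadd, Cmul, C1, RtoC, Cnorm2; simpl.
    field; repeat split; nra. }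
  assert (Z : forall t, Rabs (fst (d t)) <= Cmod (d t) /\ Rabs (snd (d t)) <= Cmod (d t))
    by (intros; split; [apply Cmod_fst|apply Cmod_snd]).
  assert (L0 : logpoly n z 0 = C0).
  { apply Csum_zero; intros j _. simpl (0 ^ S j). rewrite Rmult_0_l, Rmult_0_r. fold C0.
    change (RtoC 0) with C0; ring. }
  destruct (mvt_interval D1 (fun t => fst (d t)) 0 1 ltac:(lra) HD1) as (c1 & Hc1 & E1).
  destruct (mvt_interval D2 (fun t => snd (d t)) 0 1 ltac:(lra) HD2) as (c2 & Hc2 & E2).
  assert (F1 : D1 0 = 0).
  { unfold D1. rewrite L0. replace ((1 + 0 * x) * (1 + 0 * x) + 0 * y * (0 * y)) with 1 by ring.
    rewrite ln_1; simpl; ring. }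
  assert (F2 : D2 0 = 0).
  { unfold D2. rewrite L0. replace (0 * y / (1 + 0 * x)) with 0 by (field; lra).
    rewrite atan_0; simpl; ring. }
  eapply Rle_trans; [apply Cmod_le_abs|].
  specialize (HN 1 ltac:(lra)).
  replace (fst (Csub (Clog1p z) (logpoly n z 1))) with (D1 1).
  2:{ unfold D1, Clog1p; simpl. unfold Cmod. rewrite ln_sqrt by (specialize (Hw 1 ltac:(lra)); unfold w in Hw; replace (Cadd C1 z) with (Cadd C1 (Cmul (RtoC 1) z)) by (change (RtoC 1) with C1; ring); apply Hw). unfold Cnorm2, z; simpl.
      rewrite !Rmult_1_l, Rplus_0_l. ring. }
  replace (snd (Csub (Clog1p z) (logpoly n z 1))) with (D2 1).
  2:{ unfold D2, Clog1p, Arg; simpl. destruct (Rlt_dec 0 (1 + x)); [|lra].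
      rewrite !Rmult_1_l, Rplus_0_l. ring. }
  replace (D1 1) with (fst (d c1)) by lra. replace (D2 1) with (snd (d c2)) by lra.
  pose proof (Hd c1 Hc1); pose proof (Hd c2 Hc2). pose proof (Z c1); pose proof (Z c2). lra.
Qed.

Lemma inA_Clog1p r : 0 <= r < 1 -> inA r Clog1p.
Proof.
  intros Hr eps He. destruct (pow_small r (eps * (1 - r) / 2)) as [n Hn]; [auto|nra|].
  exists (fun z => logpoly n z 1). split.
  - apply (is_poly_Csum (fun j z => Cmul (RtoC ((-1) ^ j * / INR (S j) * 1 ^ (S j))) (Cpow z (S j)))).
    intros; apply is_poly_monomial.
  - intros z Hz. eapply Rle_trans; [apply (Clog1p_approx z r n); auto|].
    assert (r ^ n / (1 - r) <= eps / 2) by (apply Rle_div_l; lra). lra.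
Qed.

Definition Cexp (w : C) : C := Cmul (RtoC (exp (fst w))) (cis (snd w)).

Lemma Cexp_add z w : Cexp (Cadd z w) = Cmul (Cexp z) (Cexp w).
Proof.
  unfold Cexp. simpl fst; simpl snd. rewrite exp_plus, <- cis_add. Cdestr.
Qed.

Lemma Cmod_Cexp w : Cmod (Cexp w) = exp (fst w).
Proof.
  unfold Cexp; rewrite Cmod_mul, Cmod_RtoC, Cmod_cis, Rabs_pos_eq; [ring|left; apply exp_pos].
Qed.

Lemma Cexp_nat n w : Cexp (Cmul (RtoC (INR n)) w) = Cpow (Cexp w) n.
Proof.
  induction n.
  - simpl. unfold Cexp, Cmul, RtoC, cis, C1; apply C_eq; simpl;
      rewrite !Rmult_0_l, ?Rminus_0_r, ?Rplus_0_r, ?exp_0, ?cos_0, ?sin_0; ring.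
  - rewrite S_INR. simpl Cpow. rewrite <- IHn, <- Cexp_add. f_equal. Cdestr.
Qed.

Lemma exp_second_order x : Rabs x <= / 2 -> Rabs (exp x - 1) <= 2 * Rabs x /\ Rabs (exp x - 1 - x) <= 2 * (x * x).
Proof.
  intros Hx. apply Rabs_le_between in Hx.
  assert (L : 1 + x <= exp x) by apply exp_ineq1_le.
  assert (U : exp x * (1 - x) <= 1).
  { pose proof (exp_ineq1_le (- x)). rewrite exp_Ropp in H. pose proof (exp_pos x).
    apply Rmult_le_reg_l with (/ exp x); [apply Rinv_pos; auto|].
    rewrite <- Rmult_assoc, Rinv_l by lra. lra. }
  pose proof (exp_pos x).
  destruct (Rle_dec 0 x).
  - rewrite (Rabs_pos_eq x) by auto. split; apply Rabs_le_between; split; nra.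
  - rewrite (Rabs_left x) by lra. split; apply Rabs_le_between; split; nra.
Qed.

Lemma sin_cos_second_order y : Rabs y <= 1 ->
  Rabs (sin y) <= Rabs y /\ Rabs (sin y - y) <= y * y /\ Rabs (cos y - 1) <= y * y.
Proof.
  assert (P : forall y, 0 <= y <= 1 -> 0 <= sin y <= y /\ y - y * y <= sin y).
  { intros t Ht. destruct (pre_sin_bound t 0) as [Hl _]; [lra|lra|].
    simpl in Hl. unfold sin_approx, sum_f_R0, sin_term in Hl. simpl in Hl.
    assert (t - t * t * t / 6 <= sin t) by lra.
    assert (sin t <= t) by (destruct (Req_dec t 0) as [->|]; [rewrite sin_0; lra|left; apply sin_lt_x; lra]).
    assert (0 <= t * t) by nra. repeat split; nra. }
  intros Hy. assert (Hs : Rabs (sin y) <= Rabs y /\ Rabs (sin y - y) <= y * y).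
  { apply Rabs_le_between in Hy. destruct (Rle_dec 0 y).
    - destruct (P y) as [P1 P2]; [lra|]. rewrite (Rabs_pos_eq y), (Rabs_pos_eq (sin y)) by lra.
      split; [lra|]. apply Rabs_le_between; lra.
    - destruct (P (- y)) as [P1 P2]; [lra|]. rewrite sin_neg in *.
      rewrite (Rabs_left y) by lra. rewrite (Rabs_left1 (sin y)) by lra.
      split; [lra|]. apply Rabs_le_between; lra. }
  split; [apply Hs|split; [apply Hs|]].
  set (h := y / 2). assert (Ey : y = 2 * h) by (unfold h; field).
  assert (Hh : Rabs (sin h) <= Rabs h).
  { assert (Rabs h <= 1) by (rewrite Ey, Rabs_mult, (Rabs_pos_eq 2) in Hy by lra; lra).
    apply Rabs_le_between in H. destruct (Rle_dec 0 h).
    - destruct (P h) as [P1 P2]; [lra|]. rewrite (Rabs_pos_eq h), (Rabs_pos_eq (sin h)) by lra; lra.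
    - destruct (P (- h)) as [P1 P2]; [lra|]. rewrite sin_neg in *.
      rewrite (Rabs_left h), (Rabs_left1 (sin h)) by lra; lra. }
  rewrite Ey, cos_2a_sin.
  assert (sin h * sin h <= h * h).
  { pose proof (Rsqr_le_abs_1 _ _ Hh) as H; exact H. }
  replace (1 - 2 * sin h * sin h - 1) with (- (2 * (sin h * sin h))) by ring.
  rewrite Rabs_Ropp, Rabs_pos_eq; nra.
Qed.

Lemma Cexp_second_order v : Cmod v <= / 2 ->
  Cmod (Csub (Cexp v) (Cadd C1 v)) <= 8 * (Cmod v * Cmod v).
Proof.
  intros Hv. destruct v as [x y]. set (v := (x, y)) in *.
  pose proof (Cmod_fst v) as Hx; pose proof (Cmod_snd v) as Hy. simpl in Hx, Hy.
  destruct (exp_second_order x) as [E1 E2]; [lra|].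
  destruct (sin_cos_second_order y) as (S1 & S2 & S3); [lra|].
  set (q := Cmod v) in *. assert (Hq : 0 <= q) by apply Cmod_nonneg.
  assert (Qx : x * x <= q * q) by (apply Rsqr_le_abs_1; rewrite (Rabs_pos_eq q); auto).
  assert (Qy : y * y <= q * q) by (apply Rsqr_le_abs_1; rewrite (Rabs_pos_eq q); auto).
  eapply Rle_trans; [apply Cmod_le_abs|].
  unfold Cexp, cis, Csub, Cadd, Copp, Cmul, RtoC, C1, v; simpl.
  replace (exp x * cos y - 0 * sin y + - (1 + x))
    with ((exp x - 1 - x) + (exp x - 1) * (cos y - 1) + (cos y - 1)) by ring.
  replace (exp x * sin y + 0 * cos y + - (0 + y)) with ((exp x - 1) * sin y + (sin y - y)) by ring.
  pose proof (Rabs_triang ((exp x - 1 - x) + (exp x - 1) * (cos y - 1)) (cos y - 1)) as T1.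
  pose proof (Rabs_triang (exp x - 1 - x) ((exp x - 1) * (cos y - 1))) as T2.
  pose proof (Rabs_triang ((exp x - 1) * sin y) (sin y - y)) as T3.
  rewrite Rabs_mult in T2, T3.
  assert (Rabs (exp x - 1) * Rabs (cos y - 1) <= 1 * (q * q))
    by (apply Rmult_le_compat; auto using Rabs_pos; lra).
  assert (Rabs (exp x - 1) * Rabs (sin y) <= (2 * q) * q)
    by (apply Rmult_le_compat; auto using Rabs_pos; lra).
  assert (0 <= q * q) by nra. lra.
Qed.

Lemma Cpow_diff_le a b n K : Cmod a <= K -> Cmod b <= K ->
  Cmod (Csub (Cpow a (S n)) (Cpow b (S n))) <= INR (S n) * K ^ n * Cmod (Csub a b).
Proof.
  intros Ha Hb. assert (HK : 0 <= K) by (eapply Rle_trans; [apply Cmod_nonneg|apply Ha]).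
  induction n.
  - simpl. rewrite !Rmult_1_l. right; f_equal; ring.
  - change (Cpow a (S (S n))) with (Cmul a (Cpow a (S n))).
    change (Cpow b (S (S n))) with (Cmul b (Cpow b (S n))).
    replace (Csub (Cmul a (Cpow a (S n))) (Cmul b (Cpow b (S n))))
      with (Cadd (Cmul a (Csub (Cpow a (S n)) (Cpow b (S n)))) (Cmul (Cpow b (S n)) (Csub a b))) by ring.
    eapply Rle_trans; [apply Cmod_triangle|]. rewrite !Cmod_mul.
    pose proof (Cmod_nonneg (Csub a b)).
    assert (Cmod (Cpow b (S n)) <= K ^ (S n))
      by (rewrite Cmod_pow; apply pow_incr; split; auto using Cmod_nonneg).
    rewrite (S_INR (S n)). simpl (K ^ S n) in *.
    assert (Cmod a * Cmod (Csub (Cpow a (S n)) (Cpow b (S n)))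
            <= K * (INR (S n) * K ^ n * Cmod (Csub a b)))
      by (apply Rmult_le_compat; auto using Cmod_nonneg).
    nra.
Qed.

(** Uses exp f = lim (1 + f/k)^k. With v = f/k the bases exp v and 1 + v differ by O(1/k^2) and are
    bounded by exp(B/k), so their k-th powers differ by O(1/k), uniformly on the disc. *)
Lemma inA_Cexp r f : 0 <= r -> inA r f -> inA r (fun z => Cexp (f z)).
Proof.
  intros Hr Hf. destruct (inA_bounded r f Hr Hf) as (B & HB0 & HB).
  apply inA_limit; intros eps He.
  (* The final error is Q eps / k, so k >= Q suffices; k >= 2 B gives |f/k| <= 1/2, as the
     second-order bound for the exponential requires. *)
  set (Q := 8 * exp B * (B * B) / eps).
  assert (HQ : 0 <= Q).
  { unfold Q. pose proof (exp_pos B). apply Rmult_le_pos; [nra|left; apply Rinv_pos; auto]. }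
  destruct (INR_unbounded (2 * B + Q + 1)) as [n Hn].
  destruct n as [|n]; [simpl in Hn; lra|].
  set (k := INR (S n)) in *. assert (Hk : 0 < k) by lra.
  exists (fun z => Cpow (Cadd C1 (Cmul (RtoC (/ k)) (f z))) (S n)). split.
  - apply inA_pow; auto. apply (inA_add r (fun _ => C1)); auto using inA_const, inA_scal.
  - intros z Hz. specialize (HB z Hz).
    set (v := Cmul (RtoC (/ k)) (f z)).
    replace (f z) with (Cmul (RtoC k) v) at 1.
    2:{ unfold v. replace (Cmul (RtoC k) (Cmul (RtoC (/ k)) (f z)))
          with (Cmul (Cmul (RtoC k) (RtoC (/ k))) (f z)) by ring.
        replace (Cmul (RtoC k) (RtoC (/ k))) with C1; [ring|].
        apply C_eq; unfold Cmul, RtoC, C1; simpl; field; lra. }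
    unfold k at 1. rewrite Cexp_nat.
    assert (Hik : 0 < / k) by (apply Rinv_pos; auto).
    assert (Hv : Cmod v <= B / k).
    { unfold v; rewrite Cmod_mul, Cmod_RtoC, Rabs_pos_eq by lra. unfold Rdiv; nra. }
    assert (Hv2 : B / k <= / 2).
    { apply Rle_div_l; lra. }
    set (K := exp (B / k)).
    assert (K1 : Cmod (Cexp v) <= K).
    { rewrite Cmod_Cexp. pose proof (Cmod_fst v). pose proof (Rle_abs (fst v)).
      apply exp_le; lra. }
    assert (K2 : Cmod (Cadd C1 v) <= K).
    { eapply Rle_trans; [apply Cmod_triangle|]. rewrite Cmod_C1.
      pose proof (exp_ineq1_le (B / k)). unfold K; lra. }
    eapply Rle_trans; [apply (Cpow_diff_le _ _ n K K1 K2)|]. fold k.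
    assert (KB : K ^ n <= exp B).
    { assert (E : K ^ (S n) = exp B).
      { unfold K. rewrite exp_pow. f_equal. fold k. field; lra. }
      rewrite <- E. simpl. assert (1 <= K).
      { unfold K. rewrite <- exp_0. pose proof (Rdiv_le_0_compat B k HB0 Hk).
        apply exp_le; auto. }
      pose proof (pow_le K n ltac:(lra)). nra. }
    pose proof (Cexp_second_order v ltac:(lra)) as S2.
    assert (Cmod v * Cmod v <= B / k * (B / k)) by (pose proof (Cmod_nonneg v); nra).
    apply Rle_trans with (k * exp B * (8 * (B / k * (B / k)))).
    + apply Rmult_le_compat; [|apply Cmod_nonneg| |lra].
      * apply Rmult_le_pos; [lra|apply pow_le; unfold K; left; apply exp_pos].
      * apply Rmult_le_compat_l; lra.
    + replace (k * exp B * (8 * (B / k * (B / k)))) with (Q * (eps * / k)) by (unfold Q; field; lra).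
      apply Rmult_le_reg_r with k; auto.
      replace (Q * (eps * / k) * k) with (Q * eps) by (field; lra). nra.
Qed.

(** * Power series *)

(** One term of Parseval's sum is at most the mean of the squared polynomial over the grid, hence at
    most S^2. *)
Lemma cauchy_estimate M c rho S j :
  0 <= rho -> (forall z, Cmod z <= rho -> Cmod (polyf M c z) <= S) -> (j < M)%nat ->
  Cmod (c j) * rho ^ j <= S.
Proof.
  intros Hr H Hj.
  assert (HS : 0 <= S) by (eapply Rle_trans; [apply Cmod_nonneg|apply (H C0); rewrite Cmod_C0; auto]).
  apply Rsqr_incr_0_var; auto. unfold Rsqr.
  replace (Cmod (c j) * rho ^ j * (Cmod (c j) * rho ^ j)) with (Cnorm2 (c j) * (rho * rho) ^ j)
    by (rewrite Rpow_mult_distr, <- Cmod_sqr; ring).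
  apply Rle_trans with (Rsum (map (fun j => Cnorm2 (c j) * (rho * rho) ^ j) (seq 0 M))).
  - rewrite <- (Rplus_0_r (Cnorm2 (c j) * _)).
    change (Cnorm2 (c j) * (rho * rho) ^ j + 0)
      with (Rsum (map (fun j => Cnorm2 (c j) * (rho * rho) ^ j) [j])).
    apply Rsum_incl; [repeat constructor; auto|apply seq_NoDup| |].
    + intros x [<-|[]]. apply in_seq; lia.
    + intros x. apply Rmult_le_pos; [apply Cnorm2_nonneg|apply pow_le; nra].
  - rewrite <- (parseval_1d rho M M) by lia.
    rewrite <- (avg_const M (S * S)) by lia. apply avg_le; intros l _.
    rewrite <- Cmod_sqr. fold (polyf M c (gpt rho M l)).
    assert (Cmod (polyf M c (gpt rho M l)) <= S) by (apply H; rewrite Cmod_gpt; lra).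
    pose proof (Cmod_nonneg (polyf M c (gpt rho M l))); nra.
Qed.

Lemma Rsum_seq_le_support (f : nat -> R) m d :
  (forall j, 0 <= f j) -> (forall j, (d <= j)%nat -> f j = 0) ->
  Rsum (map f (seq 0 m)) <= Rsum (map f (seq 0 d)).
Proof.
  intros H0 Hz. destruct (Compare_dec.le_lt_dec m d).
  - apply Rsum_incl; auto using seq_NoDup. intros x Hx; apply in_seq in Hx; apply in_seq; lia.
  - replace m with (d + (m - d))%nat by lia. rewrite seq_app, map_app, Rsum_app.
    rewrite (Rsum_ext f (fun _ => 0) (seq (0 + d) _)), Rsum_const; [lra|].
    intros j Hj; apply in_seq in Hj; apply Hz; lia.
Qed.

Lemma polyf_sub m c d z : polyf m (fun j => Csub (c j) (d j)) z = Csub (polyf m c z) (polyf m d z).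
Proof. unfold polyf. rewrite <- Csum_sub. apply Csum_ext; intros; ring. Qed.

Lemma polyf_trunc d m c z : (forall j, (d <= j)%nat -> c j = C0) -> (d <= m)%nat -> polyf m c z = polyf d c z.
Proof.
  intros Hc Hm. replace m with (d + (m - d))%nat by lia. unfold polyf.
  rewrite seq_app, map_app, Csum_app, (Csum_zero _ (seq (0 + d) _)); [ring|].
  intros j Hj; apply in_seq in Hj; rewrite Hc by lia; ring.
Qed.

(** Coefficients set to zero from the length on: approximants of different degrees can then be
    subtracted coefficient by coefficient. *)
Lemma is_poly_normal p : is_poly p ->
  exists dc : nat * (nat -> C), (forall j, (fst dc <= j)%nat -> snd dc j = C0) /\
    forall z, p z = polyf (fst dc) (snd dc) z.
Proof.
  intros (d & c & H). exists (d, fun j => if Nat.ltb j d then c j else C0); simpl; split.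
  - intros j Hj; destruct (Nat.ltb_spec j d); [lia|auto].
  - intros z; rewrite H. apply Csum_ext; intros j Hj; apply in_seq in Hj.
    destruct (Nat.ltb_spec j d); [auto|lia].
Qed.

Lemma Rsum_geom_ratio x y m : 0 <= x < y ->
  Rsum (map (fun j => (/ y) ^ j * x ^ j) (seq 0 m)) <= / (1 - x / y).
Proof.
  intros H. rewrite (Rsum_ext _ (fun j => (x / y) ^ j)).
  - apply geom_sum_le. split; [apply Rdiv_le_0_compat; lra|].
    apply Rlt_div_l; lra.
  - intros j _. rewrite <- Rpow_mult_distr. f_equal. unfold Rdiv; ring.
Qed.

(* The coefficients of approximating polynomials converge by the Cauchy estimates. *)
Lemma inA_power_series f : (forall r, 0 < r < 1 -> inA r f) ->
  exists be : nat -> C,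
    (forall r, 0 < r < 1 -> exists B, forall m, Rsum (map (fun j => Cmod (be j) * r ^ j) (seq 0 m)) <= B) /\
    (forall z, Cmod z < 1 -> Ccv (fun m => polyf m be z) (f z)).
Proof.
  intros Hf.
  (* Radii increase to 1 from 1/2 while accuracies tend to 0. The common lower bound 1/2 is what
     controls each fixed coefficient along the whole sequence. *)
  set (rad := fun n => 1 - / INR (n + 2)). set (eps := fun n => / INR (n + 1)).
  assert (Hrad : forall n, / 2 <= rad n < 1).
  { intros n; unfold rad. rewrite plus_INR; simpl (INR 2). pose proof (pos_INR n).
    assert (0 < / (INR n + 2)) by (apply Rinv_pos; lra).
    assert (/ (INR n + 2) <= / 2) by (apply Rinv_le_contravar; lra). replace (1 + 1) with 2 by ring. lra. }
  assert (Heps : forall n, 0 < eps n).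
  { intros n; unfold eps. apply Rinv_pos, lt_0_INR; lia. }
  assert (Hmono : forall n n', (n <= n')%nat -> rad n <= rad n' /\ eps n' <= eps n).
  { intros n n' H; unfold rad, eps; split.
    - apply Rplus_le_compat_l, Ropp_le_contravar, Rinv_le_contravar;
        [apply lt_0_INR; lia|apply le_INR; lia].
    - apply Rinv_le_contravar; [apply lt_0_INR; lia|apply le_INR; lia]. }
  assert (Hsmall : forall e, 0 < e -> exists n, eps n <= e /\ 1 - e <= rad n).
  { intros e He. destruct (inv_INR_small e He) as [n Hn]. exists n.
    pose proof (Hn n ltac:(lia)); pose proof (Hn (S n) ltac:(lia)).
    unfold eps, rad. rewrite !(Nat.add_comm n). simpl Nat.add. split; lra. }
  assert (Hp : forall n, exists dc : nat * (nat -> C),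
     (forall j, (fst dc <= j)%nat -> snd dc j = C0) /\
     forall z, Cmod z <= rad n -> Cmod (Csub (f z) (polyf (fst dc) (snd dc) z)) <= eps n).
  { intros n. destruct (Hf (rad n) ltac:(specialize (Hrad n); lra) (eps n) (Heps n)) as (p & Hp & Hfp).
    destruct (is_poly_normal p Hp) as (dc & H1 & H2). exists dc; split; auto.
    intros z Hz; rewrite <- H2; auto. }
  destruct (fun_choice _ Hp) as [dc Hdc]; clear Hp.
  set (co := fun n => snd (dc n)). set (de := fun n => fst (dc n)).
  (* On the smaller of the two discs both approximants are close to f, so the Cauchy estimate
     applies to their difference. *)
  assert (Hco : forall n n' j, (n <= n')%nat -> Cmod (Csub (co n' j) (co n j)) * rad n ^ j <= 2 * eps n).
  { intros n n' j Hn. destruct (Hdc n) as [Z1 A1], (Hdc n') as [Z2 A2]. destruct (Hmono n n' Hn) as [M1 M2].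
    fold (co n) (de n) (co n') (de n') in *.
    apply (cauchy_estimate (S (j + de n + de n')) (fun j => Csub (co n' j) (co n j))); [specialize (Hrad n); lra| |lia].
    intros z Hz. rewrite polyf_sub, (polyf_trunc (de n') _ (co n')), (polyf_trunc (de n) _ (co n)) by (auto; lia).
    eapply Rle_trans; [apply (Cmod_via (f z))|]. rewrite (Cmod_sub_sym _ (f z)).
    specialize (A1 z Hz). specialize (A2 z ltac:(lra)). lra. }
  assert (Hbe : forall j, exists b, Ccv (fun n => co n j) b).
  { intros j. apply Ccv_of_cauchy; intros e He.
    destruct (Hsmall (e * (/ 2) ^ j / 2)) as (n & Hn & _); [pose proof (pow_lt (/2) j ltac:(lra)); nra|].
    exists n; intros m m' H1 H2. specialize (Hco m m' j H2). destruct (Hmono n m H1) as [_ M2].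
    assert (P : (/ 2) ^ j <= rad m ^ j) by (apply pow_incr; specialize (Hrad m); lra).
    pose proof (pow_lt (/ 2) j ltac:(lra)).
    pose proof (Cmod_nonneg (Csub (co m' j) (co m j))).
    apply Rmult_le_reg_r with ((/ 2) ^ j); auto. nra. }
  destruct (fun_choice _ Hbe) as [be Hb].
  assert (Hd : forall n j, Cmod (Csub (be j) (co n j)) <= 2 * eps n * (/ rad n) ^ j).
  { intros n j. pose proof (pow_lt (rad n) j ltac:(specialize (Hrad n); lra)) as P.
    eapply Ccv_mod_le; [|apply (Ccv_sub _ _ _ _ (Hb j) (Ccv_const (co n j)))].
    exists n; intros m Hm. specialize (Hco n m j Hm).
    apply Rmult_le_reg_r with (rad n ^ j); auto.
    rewrite Rmult_assoc, <- Rpow_mult_distr, Rinv_l, pow1 by (specialize (Hrad n); lra). lra. }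
  assert (Hdiff : forall n m rho, 0 <= rho < rad n ->
    Rsum (map (fun j => Cmod (Csub (be j) (co n j)) * rho ^ j) (seq 0 m)) <= 2 * eps n * / (1 - rho / rad n)).
  { intros n m rho Hr. specialize (Heps n).
    eapply Rle_trans; [|apply Rmult_le_compat_l; [|apply (Rsum_geom_ratio rho (rad n) m)]; lra].
    rewrite <- Rsum_scal. apply Rsum_le; intros j _. rewrite <- Rmult_assoc.
    apply Rmult_le_compat_r; [apply pow_le; lra|apply Hd]. }
  exists be; split.
  - intros r Hr. destruct (Hsmall ((1 - r) / 2)) as (n & _ & Hn); [lra|].
    exists (2 * eps n * / (1 - r / rad n) + Rsum (map (fun j => Cmod (co n j) * r ^ j) (seq 0 (de n)))).
    intros m.
    assert (E : Rsum (map (fun j => Cmod (co n j) * r ^ j) (seq 0 m))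
       <= Rsum (map (fun j => Cmod (co n j) * r ^ j) (seq 0 (de n)))).
    { apply Rsum_seq_le_support.
      - intros; apply Rmult_le_pos; [apply Cmod_nonneg|apply pow_le; lra].
      - intros j Hj. destruct (Hdc n) as [Z1 _]. unfold co. rewrite Z1 by auto. rewrite Cmod_C0; ring. }
    eapply Rle_trans; [|apply Rplus_le_compat; [apply (Hdiff n m r); lra|exact E]].
    rewrite <- Rsum_plus. apply Rsum_le; intros j _. rewrite <- Rmult_plus_distr_r.
    apply Rmult_le_compat_r; [apply pow_le; lra|].
    pose proof (Cmod_triangle_rev (be j) (co n j)); lra.
  - intros z Hz. pose proof (Cmod_nonneg z) as Hz0. apply Ccv_eps; intros e He.
    set (K := 2 * / (1 - Cmod z / ((1 + Cmod z) / 2)) + 1).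
    assert (Hq : 0 < 1 - Cmod z / ((1 + Cmod z) / 2)).
    { assert (Cmod z / ((1 + Cmod z) / 2) < 1); [|lra].
      apply Rlt_div_l; lra. }
    assert (HK : 0 < K) by (unfold K; apply Rinv_pos in Hq; lra).
    (* The second term of the minimum forces rad n >= (1 + |z|)/2, so the geometric factor collected
       in [K] depends on z alone. *)
    destruct (Hsmall (Rmin (e / K) ((1 - Cmod z) / 2))) as (n & Hn1 & Hn2).
    { apply Rmin_glb_lt; [apply Rdiv_lt_0_compat; auto|lra]. }
    pose proof (Rmin_l (e / K) ((1 - Cmod z) / 2)); pose proof (Rmin_r (e / K) ((1 - Cmod z) / 2)).
    exists (de n); intros m Hm. destruct (Hdc n) as [Z1 A1]. fold (co n) (de n) in *.
    eapply Rle_trans; [apply (Cmod_via (polyf m (co n) z))|].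
    rewrite <- polyf_sub. rewrite (polyf_trunc (de n) m (co n)), (Cmod_sub_sym _ (f z)) by auto.
    specialize (A1 z ltac:(lra)).
    assert (T : Cmod (polyf m (fun j => Csub (be j) (co n j)) z) <= 2 * eps n * / (1 - Cmod z / ((1 + Cmod z) / 2))).
    { eapply Rle_trans; [apply Cmod_Csum_le|].
      rewrite (Rsum_ext _ (fun j => Cmod (Csub (be j) (co n j)) * Cmod z ^ j))
        by (intros; rewrite Cmod_mul, Cmod_pow; auto).
      eapply Rle_trans; [apply Hdiff; lra|]. specialize (Heps n).
      apply Rmult_le_compat_l; [lra|]. apply Rinv_le_contravar; auto.
      apply Rplus_le_compat_l, Ropp_le_contravar, Rmult_le_compat_l; auto.
      apply Rinv_le_contravar; lra. }
    apply Rle_trans with (K * eps n); [unfold K; lra|].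
    apply Rle_trans with (K * (e / K)); [apply Rmult_le_compat_l; lra|right; field; lra].
Qed.

Lemma RtoC_inj x y : RtoC x = RtoC y -> x = y.
Proof. intros E; injection E; auto. Qed.

(** A one-variable power series read as a function of the first coordinate: only the indices
    (j,0,...,0) carry a coefficient. *)
Definition embed (be : nat -> C) : family := fun al =>
  match al with [] => C0 | j :: t => if Nat.eqb (list_sum t) 0 then be j else C0 end.

Lemma list_sum_0_repeat t : list_sum t = 0%nat -> t = repeat 0%nat (length t).
Proof.
  induction t as [|k t IH]; simpl; intros H; [auto|].
  assert (k = 0%nat) by lia. subst. f_equal; auto.
Qed.

Lemma list_sum_repeat_0 n : list_sum (repeat 0%nat n) = 0%nat.
Proof. induction n; simpl; auto. Qed.

Lemma mono_from_repeat_0 i p n : mono_from i p (repeat 0%nat n) = C1.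
Proof. revert i; induction n; intros; simpl; [auto|rewrite IHn; ring]. Qed.

Lemma Csum_box_embed (F : list nat -> C) n m : (0 < m)%nat ->
  (forall j t, list_sum t <> 0%nat -> F (j :: t) = C0) ->
  Csum (map F (box (S n) m)) = Csum (map (fun j => F (j :: repeat 0%nat n)) (seq 0 m)).
Proof.
  intros Hm HF. rewrite Csum_box_S. apply Csum_ext; intros j _.
  apply (Csum_single (fun t => F (j :: t))); [apply NoDup_box| |].
  - apply In_box_of_deg; [apply repeat_length|rewrite list_sum_repeat_0; auto].
  - intros t Ht Hne; apply HF; intros H0; apply Hne. apply In_box in Ht as [<- _].
    apply list_sum_0_repeat; auto.
Qed.

Lemma embed_series N f : (1 <= N)%nat -> (forall r, 0 < r < 1 -> inA r f) ->
  exists v, asum N v /\ forall p, inD N p -> series_at N v p (f (p 0%nat)).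
Proof.
  intros HN Hf. destruct N as [|n]; [lia|].
  destruct (inA_power_series f Hf) as (be & Hb & Hs). exists (embed be); split.
  - intros r Hr. destruct (Hb r Hr) as [B HB]. exists B; intros m.
    destruct m as [|m].
    { rewrite Rsum_box_S. simpl. eapply Rle_trans; [|apply (HB 0%nat)]. simpl; lra. }
    (* The real sum is moved to the complex numbers so that the collapse of box sums proved there
       applies to it as well. *)
    assert (E : RtoC (Rsum (map (fun al => Cmod (embed be al) * r ^ list_sum al) (box (S n) (S m))))
       = RtoC (Rsum (map (fun j => Cmod (be j) * r ^ j) (seq 0 (S m))))).
    { rewrite <- !Csum_RtoC.
      rewrite (Csum_box_embed (fun al => RtoC (Cmod (embed be al) * r ^ list_sum al))) by
        (lia || (intros j t H; simpl; apply Nat.eqb_neq in H; rewrite H, Cmod_C0, Rmult_0_l; auto)).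
      apply Csum_ext; intros j _.
      change (list_sum (j :: repeat 0%nat n)) with (j + list_sum (repeat 0%nat n))%nat.
      cbn [embed]. rewrite list_sum_repeat_0, Nat.add_0_r; auto. }
    rewrite (RtoC_inj _ _ E); apply HB.
  - intros p Hp. eapply Ccv_ext; [|apply (Hs (p 0%nat)); apply Hp; lia].
    exists 1%nat; intros m Hm. symmetry.
    rewrite (Csum_box_embed (fun al => Cmul (embed be al) (mono p al))).
    + apply Csum_ext; intros j _. unfold mono; cbn [embed mono_from].
      rewrite list_sum_repeat_0, mono_from_repeat_0; simpl; ring.
    + lia.
    + intros j t H; cbn [embed]. apply Nat.eqb_neq in H; rewrite H; ring.
Qed.

(** * The lens map *)

Lemma Arg_polar w : 0 < fst w ->
  w = Cmul (RtoC (Cmod w)) (cis (Arg w)) /\ - (PI / 2) < Arg w < PI / 2.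
Proof.
  destruct w as [x y]; simpl; intros Hx.
  assert (EA : Arg (x, y) = atan (y / x)) by (unfold Arg; simpl; destruct (Rlt_dec 0 x); [auto|lra]).
  rewrite EA. split; [|pose proof (atan_bound (y / x)); lra].
  assert (Hs : Cmod (x, y) = x * sqrt (1 + Rsqr (y / x))).
  { unfold Cmod, Cnorm2; simpl.
    replace (x * sqrt (1 + Rsqr (y / x))) with (sqrt (x * x) * sqrt (1 + Rsqr (y / x)))
      by (rewrite sqrt_square by lra; auto).
    rewrite <- sqrt_mult; [|nra|pose proof (Rle_0_sqr (y / x)); lra].
    f_equal. unfold Rsqr; field; lra. }
  assert (Hp : 0 < sqrt (1 + Rsqr (y / x))) by (apply sqrt_lt_R0; pose proof (Rle_0_sqr (y / x)); lra).
  unfold cis. rewrite Hs, cos_atan, sin_atan.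
  apply C_eq; unfold Cmul, RtoC; simpl; field; lra.
Qed.

Lemma Cmod_pos_fst w : 0 < fst w -> 0 < Cmod w.
Proof.
  intros H; eapply Rlt_le_trans; [exact H|]. eapply Rle_trans; [apply Rle_abs|apply Cmod_fst].
Qed.

Lemma cpowR_polar w t : 0 < fst w ->
  cpowR w t = Cmul (RtoC (Rpower (Cmod w) t)) (cis (t * Arg w)).
Proof.
  intros H. pose proof (Cmod_pos_fst w H). unfold cpowR.
  destruct (Req_EM_T (Cmod w) 0); [lra|]. apply C_eq; unfold Cmul, RtoC, cis; simpl; ring.
Qed.

Lemma cpowR_exp_log z t : Cmod z < 1 ->
  cpowR (Cadd C1 z) t = Cexp (Cmul (RtoC t) (Clog1p z)).
Proof.
  intros H. rewrite cpowR_polar by (apply fst_1p_pos; auto).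
  unfold Cexp, Clog1p, Rpower, Cmul, RtoC, cis; simpl.
  apply C_eq; simpl; rewrite !Rmult_0_l, ?Rminus_0_r, ?Rplus_0_r; auto.
Qed.

Lemma Csub_1_opp z : Csub C1 z = Cadd C1 (Copp z).
Proof. reflexivity. Qed.

Lemma Rpower_pos x t : 0 < Rpower x t.
Proof. apply exp_pos. Qed.

Lemma cos_lower u v : 0 <= v <= PI / 2 -> - v <= u <= v -> cos v <= cos u.
Proof.
  intros Hv Hu. pose proof PI_RGT_0.
  destruct (Rle_dec 0 u).
  - apply cos_decr_1; lra.
  - rewrite <- (cos_neg u). apply cos_decr_1; lra.
Qed.

Lemma rpower_1_base t : Rpower 1 t = 1.
Proof. unfold Rpower; rewrite ln_1, Rmult_0_r; apply exp_0. Qed.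

Section Lens.
Context (theta : R) (Hth : 0 < theta < 1).

(** The arguments of 1+z and 1-z differ by at most pi/2, so those of their theta-th powers by at
    most theta pi/2. Since theta < 1, the cosine of that angle is positive. *)
Let kap : R := cos (theta * (PI / 2)).

Lemma kap_bounds : 0 < kap <= 1.
Proof.
  unfold kap; pose proof PI_RGT_0. split; [apply cos_gt_0; nra|apply COS_bound].
Qed.

(** Keeps the denominator of the lens map in a right half-plane bounded away from 0, as inversion by
    a Neumann series requires. *)
Lemma re_cpowR_ge z rho : 0 <= rho < 1 -> Cmod z <= rho ->
  Rpower (1 - rho) theta * kap <= fst (cpowR (Cadd C1 z) theta).
Proof.
  intros Hr Hz. assert (H1 : Cmod z < 1) by lra. pose proof (fst_1p_pos z H1) as Hp.
  rewrite cpowR_polar by auto. destruct (Arg_polar _ Hp) as [_ HA].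
  unfold Cmul, RtoC, cis; cbn [fst snd]. rewrite Rmult_0_l, Rminus_0_r.
  pose proof kap_bounds. pose proof PI_RGT_0.
  apply Rmult_le_compat; [left; apply Rpower_pos|lra| |].
  - apply Rle_Rpower_l; [lra|]. split; [lra|].
    pose proof (Cmod_triangle_rev C1 (Cadd C1 z)). rewrite Cmod_C1 in H2.
    replace (Csub C1 (Cadd C1 z)) with (Copp z) in H2 by ring. rewrite Cmod_opp in H2; lra.
  - apply cos_lower; split; nra.
Qed.

Lemma inA_lens r : 0 < r < 1 -> inA r (lens theta).
Proof.
  intros Hr.
  assert (Ha : inA r (fun z => cpowR (Cadd C1 z) theta)).
  { apply inA_ext with (f := fun z => Cexp (Cmul (RtoC theta) (Clog1p z))).
    - intros z Hz; symmetry; apply cpowR_exp_log; lra.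
    - apply inA_Cexp, inA_scal, inA_Clog1p; lra. }
  assert (Hb : inA r (fun z => cpowR (Csub C1 z) theta)) by apply (inA_opp_arg r _ Ha).
  unfold lens, Cdiv. apply inA_mul; [lra|apply inA_sub; auto; lra|].
  pose proof kap_bounds. pose proof (Rpower_pos (1 - r) theta).
  apply (inA_inv r) with (c := Rpower (1 - r) theta * kap); [lra|nra|apply inA_add; auto|].
  intros z Hz. pose proof (re_cpowR_ge z r ltac:(lra) Hz) as P.
  pose proof (re_cpowR_ge (Copp z) r ltac:(lra) ltac:(rewrite Cmod_opp; auto)) as Q.
  rewrite Csub_1_opp. assert (A : forall u v, fst (Cadd u v) = fst u + fst v) by reflexivity.
  rewrite A. nra.
Qed.

(* With [a = (1+z)^theta], [b = (1-z)^theta] the identities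
   [1 - |lens|^2 = 4 Re (a conj b) / |a+b|^2] and [1 - lens^2 = 4 a b / (a+b)^2] hold, and
   [|arg a - arg b| <= theta PI / 2]. *)
Lemma lens_bounds z : Cmod z < 1 ->
  kap * Cmod (Csub C1 (Cmul (lens theta z) (lens theta z))) <= 1 - Cnorm2 (lens theta z) /\
  kap * Rpower (Cmod (Csub C1 (Cmul z z))) theta <= 4 * (1 - Cnorm2 (lens theta z)).
Proof.
  intros Hz. pose proof kap_bounds as Hk. pose proof PI_RGT_0 as HPI.
  pose proof (fst_1p_pos z Hz) as P1.
  assert (Hz' : Cmod (Copp z) < 1) by (rewrite Cmod_opp; auto).
  pose proof (fst_1p_pos (Copp z) Hz') as P2.
  unfold lens. rewrite !(Csub_1_opp z).
  set (w1 := Cadd C1 z) in *. set (w2 := Cadd C1 (Copp z)) in *.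
  rewrite (cpowR_polar w1), (cpowR_polar w2) by auto.
  destruct (Arg_polar w1 P1) as [E1 A1]. destruct (Arg_polar w2 P2) as [E2 A2].
  pose proof (Cmod_pos_fst w1 P1) as M1. pose proof (Cmod_pos_fst w2 P2) as M2.
  set (p := Arg w1) in *. set (q := Arg w2) in *.
  (* The real part of (1+z) times the conjugate of 1-z is 1 - |z|^2 > 0, so cos(p-q) > 0. As |p-q| <
     pi already, this leaves only |p-q| <= pi/2. *)
  assert (Hpq : - (PI / 2) <= p - q <= PI / 2).
  { assert (Hc : 0 < cos (p - q)).
    { assert (E : Cmod w1 * Cmod w2 * cos (p - q) = 1 - Cnorm2 z).
      { transitivity (fst w1 * fst w2 + snd w1 * snd w2).
        - rewrite E1, E2 at 2. rewrite E1, E2 at 3. unfold Cmul, RtoC, cis; cbn [fst snd].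
          rewrite cos_minus; ring.
        - unfold w1, w2, Cnorm2, Cadd, Copp, C1; simpl; ring. }
      assert (Cnorm2 z < 1 * 1) by (apply Cmod_lt_iff; lra).
      assert (0 < Cmod w1 * Cmod w2) by (apply Rmult_lt_0_compat; auto).
      apply Rnot_le_lt; intros Hn. nra. }
    split; apply Rnot_lt_le; intros Hlt.
    - assert (cos (- (p - q)) <= 0) by (apply cos_le_0; lra). rewrite cos_neg in H; lra.
    - assert (cos (p - q) <= 0) by (apply cos_le_0; lra). lra. }
  assert (Hc : kap <= cos (theta * p - theta * q)).
  { unfold kap; apply cos_lower; [split; nra|]. rewrite <- Rmult_minus_distr_l. split; nra. }
  set (X := Rpower (Cmod w1) theta) in *. set (Y := Rpower (Cmod w2) theta) in *.
  assert (HX : 0 < X) by apply Rpower_pos. assert (HY : 0 < Y) by apply Rpower_pos.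
  assert (U : forall u, Cmod u < 1 -> 0 < Cmod (Cadd C1 u) -> Rpower (Cmod (Cadd C1 u)) theta <= 2).
  { intros u Hu Hu'. pose proof (Cmod_triangle C1 u). rewrite Cmod_C1 in H.
    apply Rle_trans with (Rpower 2 theta); [apply Rle_Rpower_l; lra|].
    rewrite <- (Rpower_1 2) at 2 by lra. apply Rle_Rpower; lra. }
  pose proof (U z Hz M1) as UX. pose proof (U (Copp z) Hz' M2) as UY. fold w1 X in UX. fold w2 Y in UY.
  set (a := Cmul (RtoC X) (cis (theta * p))). set (b := Cmul (RtoC Y) (cis (theta * q))).
  set (c := cos (theta * p - theta * q)) in *.
  assert (Nab : Cnorm2 (Cadd a b) = X * X + Y * Y + 2 * (X * Y * c)).
  { replace (X * X) with (X * X * Cnorm2 (cis (theta * p))) by (rewrite Cnorm2_cis; ring).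
    replace (Y * Y) with (Y * Y * Cnorm2 (cis (theta * q))) by (rewrite Cnorm2_cis; ring).
    unfold c; rewrite cos_minus. unfold a, b, Cnorm2, Cadd, Cmul, RtoC, cis; cbn [fst snd]; ring. }
  assert (Nsub : Cnorm2 (Csub a b) = X * X + Y * Y - 2 * (X * Y * c)).
  { replace (X * X) with (X * X * Cnorm2 (cis (theta * p))) by (rewrite Cnorm2_cis; ring).
    replace (Y * Y) with (Y * Y * Cnorm2 (cis (theta * q))) by (rewrite Cnorm2_cis; ring).
    unfold c; rewrite cos_minus. unfold a, b, Cnorm2, Csub, Cadd, Copp, Cmul, RtoC, cis; cbn [fst snd]; ring. }
  assert (HXY : 0 < X * Y) by nra.
  assert (Hc1 : c <= 1) by apply COS_bound.
  assert (HXYc : X * Y * kap <= X * Y * c) by (apply Rmult_le_compat_l; lra).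
  assert (Hn : 0 < Cnorm2 (Cadd a b)) by (rewrite Nab; nra).
  (* Both |a| and |b| are at most 2. Against the numerator 4 Re(a conj b) the bound 16 yields the
     factor 4 of the second inequality. *)
  assert (Hn16 : Cnorm2 (Cadd a b) <= 16).
  { rewrite Nab. assert (X * Y * c <= X * Y) by nra. nra. }
  set (n := Cnorm2 (Cadd a b)) in *.
  assert (L1 : 1 - Cnorm2 (Cdiv (Csub a b) (Cadd a b)) = 4 * (X * Y * c) / n).
  { unfold Cdiv. rewrite Cnorm2_mul, Cnorm2_inv by auto. fold n. rewrite Nsub.
    replace (X * X + Y * Y - 2 * (X * Y * c)) with (n - 4 * (X * Y * c)) by (rewrite Nab; ring).
    field; lra. }
  assert (L2 : Cmod (Csub C1 (Cmul (Cdiv (Csub a b) (Cadd a b)) (Cdiv (Csub a b) (Cadd a b)))) = 4 * (X * Y) / n).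
  { unfold Cdiv. pose proof (Cinv_r (Cadd a b) Hn) as Ei. set (i := Cinv (Cadd a b)) in *.
    replace (Csub C1 (Cmul (Cmul (Csub a b) i) (Cmul (Csub a b) i)))
      with (Cmul (Cmul (RtoC 4) (Cmul a b)) (Cmul i i)).
    - rewrite !Cmod_mul. rewrite Cmod_sqr. unfold i; rewrite Cnorm2_inv by auto. fold n.
      unfold a, b. rewrite !Cmod_mul, !Cmod_cis, !Cmod_RtoC, !Rabs_pos_eq by lra. unfold Rdiv; ring.
    - transitivity (Csub (Cmul (Cmul (Cadd a b) i) (Cmul (Cadd a b) i)) (Cmul (Cmul (Csub a b) i) (Cmul (Csub a b) i))).
      + replace (RtoC 4) with (Cadd (Cadd C1 C1) (Cadd C1 C1)) by Cdestr. ring.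
      + rewrite Ei; ring. }
  rewrite L1, L2. unfold Rdiv.
  assert (Hin : / 16 <= / n) by (apply Rinv_le_contravar; lra).
  split.
  - rewrite <- !Rmult_assoc. apply Rmult_le_compat_r; [lra|]. nra.
  - replace (Rpower (Cmod (Csub C1 (Cmul z z))) theta) with (X * Y).
    + apply Rle_trans with (16 * (X * Y * c) * / 16); [lra|].
      replace (4 * (4 * (X * Y * c) * / n)) with (16 * (X * Y * c) * / n) by ring.
      apply Rmult_le_compat_l; nra.
    + unfold X, Y. rewrite Rpower_mult_distr, <- Cmod_mul by auto. f_equal. f_equal.
      unfold w1, w2; ring.
Qed.

Lemma Cmod_lens_lt z : Cmod z < 1 -> Cmod (lens theta z) < 1.
Proof.
  intros Hz. destruct (lens_bounds z Hz) as [_ H]. pose proof kap_bounds.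
  pose proof (Rpower_pos (Cmod (Csub C1 (Cmul z z))) theta).
  apply Cmod_lt_iff; [lra|]. nra.
Qed.

(** From 1 - |lens|^2 <= 2 (1 - |lens|). This gap, closing with exponent theta at 1 and -1, is the
    quantitative input for the averages over circles. *)
Lemma lens_gap z : Cmod z < 1 ->
  kap / 8 * Rpower (Cmod (Csub C1 (Cmul z z))) theta <= 1 - Cmod (lens theta z).
Proof.
  intros Hz. destruct (lens_bounds z Hz) as [_ H]. pose proof (Cmod_lens_lt z Hz).
  rewrite <- Cmod_sqr in H. pose proof (Cmod_nonneg (lens theta z)). nra.
Qed.

(** Smaller discs go into smaller discs, so series composed with the lens map converge uniformly
    there. *)
Lemma Cmod_lens_le r : 0 < r < 1 ->
  exists rho, 0 < rho < 1 /\ forall z, Cmod z <= r -> Cmod (lens theta z) <= rho.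
Proof.
  intros Hr. exists (1 - kap / 8 * Rpower (1 - r * r) theta).
  pose proof kap_bounds. pose proof (Rpower_pos (1 - r * r) theta).
  assert (Rpower (1 - r * r) theta <= 1).
  { apply Rle_trans with (Rpower 1 theta); [|rewrite rpower_1_base; lra].
    apply Rle_Rpower_l; [lra|]. split; nra. }
  split; [nra|]. intros z Hz. pose proof (lens_gap z ltac:(lra)) as G.
  assert (Rpower (1 - r * r) theta <= Rpower (Cmod (Csub C1 (Cmul z z))) theta).
  { apply Rle_Rpower_l; [lra|]. split; [nra|].
    pose proof (Cmod_triangle_rev C1 (Cmul z z)) as H2.
    rewrite Cmod_C1, Cmod_mul in H2. pose proof (Cmod_nonneg z). nra. }
  nra.
Qed.

(** With X = (1+x)^theta >= 1 and Y = (1-x)^theta one has r = (X-Y)/(X+Y) and 1 - r^2 = 4XY/(X+Y)^2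
    <= 4Y. The exponent theta of the gap is thus sharp at 1. *)
Lemma lens_real x : 0 < x < 1 -> exists r, lens theta (RtoC x) = RtoC r /\ 0 <= r < 1 /\
  1 - r * r <= 4 * Rpower (1 - x) theta.
Proof.
  intros Hx.
  assert (Hre : forall u, 0 < u -> cpowR (RtoC u) theta = RtoC (Rpower u theta)).
  { intros u Hu. rewrite cpowR_polar by auto. rewrite Cmod_RtoC, Rabs_pos_eq by lra.
    unfold Arg, RtoC; simpl. destruct (Rlt_dec 0 u); [|lra].
    unfold Rdiv; rewrite Rmult_0_l, atan_0, Rmult_0_r. unfold cis; rewrite cos_0, sin_0. Cdestr. }
  set (X := Rpower (1 + x) theta). set (Y := Rpower (1 - x) theta).
  assert (HY : 0 < Y) by apply Rpower_pos.
  assert (HX : 1 <= X).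
  { apply Rle_trans with (Rpower 1 theta); [rewrite rpower_1_base; lra|]. apply Rle_Rpower_l; lra. }
  assert (HYX : Y <= X) by (apply Rle_Rpower_l; lra).
  exists ((X - Y) / (X + Y)). split; [|split].
  - unfold lens. replace (Cadd C1 (RtoC x)) with (RtoC (1 + x)) by Cdestr.
    replace (Csub C1 (RtoC x)) with (RtoC (1 - x)) by Cdestr.
    rewrite !Hre by lra. fold X Y. unfold Cdiv, Cinv, Cmul, Csub, Cadd, Copp, RtoC, Cnorm2; simpl.
    apply C_eq; simpl; field; nra.
  - split; [apply Rdiv_le_0_compat; lra|].
    apply Rlt_div_l; lra.
  - replace (1 - (X - Y) / (X + Y) * ((X - Y) / (X + Y))) with (4 * Y * (X / ((X + Y) * (X + Y)))) by (field; lra).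
    rewrite <- (Rmult_1_r (4 * Y)) at 2. apply Rmult_le_compat_l; [lra|].
    apply Rle_div_l; nra.
Qed.
End Lens.

(** * Averages over circles *)

(* The map [x |-> y/(1+y)], [y = Y x^theta], is bounded by 1 and its increments dominate the terms of the sum. *)
Lemma potential_sum theta Y m : 0 < theta <= 1 -> 0 < Y ->
  let y := fun t => Y * Rpower (2 * INR t + 1) theta in
  theta * Rsum (map (fun t => / (2 * INR t + 1) * (y t / ((1 + y t) * (1 + y t)))) (seq 0 m)) <= 1.
Proof.
  intros Ht HY y.
  set (u := fun x => Y * Rpower x theta).
  set (Psi := fun x => u x / (1 + u x)).
  assert (Hu : forall x, 0 < u x) by (intros; unfold u; pose proof (Rpower_pos x theta); nra).
  assert (HPsi : forall x, Psi x <= 1).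
  { intros x; specialize (Hu x). unfold Psi. apply Rle_div_l; lra. }
  assert (Hd : forall x, 0 < x -> is_derive Psi x (theta * (u x / x) / ((1 + u x) * (1 + u x)))).
  { intros x Hx. specialize (Hu x). unfold Psi, u, Rpower in *. auto_derive.
    - repeat split; auto; lra.
    - field. lra. }
  assert (Hy : forall t, y t = u (2 * INR t + 1)) by reflexivity.
  destruct m as [|m]; [simpl; lra|].
  apply Rle_trans with (Psi (2 * INR m + 1)); [|apply HPsi].
  induction m as [|m IH].
  (* The first term has no increment to its left; it is absorbed by the value [Psi] takes at 1. *)
  - simpl Rsum. rewrite Hy. simpl INR. rewrite Rmult_0_r, !Rplus_0_l, Rplus_0_r.
    unfold Psi. specialize (Hu 1). set (v := u 1) in *.
    rewrite Rinv_1, Rmult_1_l. unfold Rdiv. rewrite Rinv_mult.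
    assert (0 < / (1 + v)) by (apply Rinv_pos; lra).
    assert (/ (1 + v) <= 1) by (rewrite <- Rinv_1; apply Rinv_le_contravar; lra).
    assert (0 < v * / (1 + v)) by nra.
    replace (theta * (v * (/ (1 + v) * / (1 + v)))) with ((v * / (1 + v)) * (theta * / (1 + v))) by ring.
    assert (theta * / (1 + v) <= 1) by nra. nra.
  - rewrite Rsum_seq_S, Rmult_plus_distr_l, (Hy (S m)).
    assert (Hb : 2 * INR (S m) + 1 = 2 * INR m + 1 + 2) by (rewrite S_INR; ring).
    rewrite Hb. set (a := 2 * INR m + 1) in *. set (b := a + 2).
    assert (Ha : 1 <= a) by (unfold a; pose proof (pos_INR m); lra).
    destruct (mvt_interval Psi (fun x => theta * (u x / x) / ((1 + u x) * (1 + u x))) a b) as (c & Hc & E).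
    { unfold b; lra. }
    { intros t Hta. apply Hd; lra. }
    assert (Hb2 : b - a = 2) by (unfold b; ring). rewrite Hb2 in E.
    (* Since theta <= 1, u(x)/x is nonincreasing, and so is 1/(1+u)^2. Hence the derivative of [Psi]
       at c <= b is at least its value at b, which is the new term. *)
    assert (Hq : 1 <= b / c).
    { apply Rle_div_r; lra. }
    assert (Eb : u b = u c * Rpower (b / c) theta).
    { unfold u. rewrite Rmult_assoc, Rpower_mult_distr by lra. do 2 f_equal. field; lra. }
    assert (Hq2 : 1 <= Rpower (b / c) theta <= b / c).
    { split.
      - rewrite <- (Rpower_O (b / c)) at 1 by lra. apply Rle_Rpower; lra.
      - rewrite <- (Rpower_1 (b / c)) at 2 by lra. apply Rle_Rpower; lra. }
    pose proof (Hu c) as Hc0. pose proof (Hu b) as Hb0.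
    assert (G1 : u c <= u b) by (rewrite Eb; nra).
    assert (G2 : / b * u b <= u c / c).
    { rewrite Eb. replace (u c / c) with (/ b * (u c * (b / c))) by (field; lra).
      apply Rmult_le_compat_l; [left; apply Rinv_pos; lra|]. apply Rmult_le_compat_l; lra. }
    assert (G3 : / ((1 + u b) * (1 + u b)) <= / ((1 + u c) * (1 + u c))) by (apply Rinv_le_contravar; nra).
    assert (0 < / ((1 + u b) * (1 + u b))) by (apply Rinv_pos; nra).
    assert (0 < / b * u b) by (apply Rmult_lt_0_compat; auto; apply Rinv_pos; lra).
    assert (G4 : / b * u b * / ((1 + u b) * (1 + u b)) <= u c / c * / ((1 + u c) * (1 + u c)))
      by (apply Rmult_le_compat; lra).
    unfold Rdiv in *.
    assert (0 < / b * u b * / ((1 + u b) * (1 + u b))) by nra.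
    assert (G5 : theta * (/ b * u b * / ((1 + u b) * (1 + u b))) <= theta * (u c * / c * / ((1 + u c) * (1 + u c))))
      by (apply Rmult_le_compat_l; lra).
    assert (0 < theta * (/ b * u b * / ((1 + u b) * (1 + u b)))) by (apply Rmult_lt_0_compat; lra).
    fold b. rewrite <- (Rmult_assoc (/ b)). lra.
Qed.

(** Division by this weight brings the double geometric series over the first two exponents down to
    the size of a single one, a gain of one factor 1 - L. Shorter lists get the default 1. *)
Definition wt (al : list nat) : R :=
  match al with i :: j :: _ => INR (S (Nat.max i j)) | _ => 1 end.

Lemma wt_pos al : 0 < wt al.
Proof. destruct al as [|i [|j t]]; cbn [wt]; try lra. apply lt_0_INR; lia. Qed.

Lemma wt_le al : wt al <= INR (S (list_sum al)).
Proof.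
  destruct al as [|i [|j t]]; cbn [wt]; [| |apply le_INR; simpl; lia];
    rewrite S_INR; match goal with |- context [INR ?k] => pose proof (pos_INR k) end; lra.
Qed.

(** The shell where max(i,j) = m has 2m+1 terms, each at most L^m/(m+1), hence contributes at most 2
    L^m. *)
Lemma square_sum_le L m : 0 <= L < 1 ->
  Rsum (map (fun i => Rsum (map (fun j => L ^ (i + j) / INR (S (Nat.max i j))) (seq 0 m))) (seq 0 m))
  <= 2 * Rsum (map (fun k => L ^ k) (seq 0 m)).
Proof.
  intros HL. induction m as [|m IH]; [simpl; lra|].
  rewrite (Rsum_ext _ (fun i => Rsum (map (fun j => L ^ (i + j) / INR (S (Nat.max i j))) (seq 0 m))
     + L ^ (i + m) / INR (S (Nat.max i m)))) by (intros; apply Rsum_seq_S).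
  rewrite Rsum_plus, (Rsum_seq_S (fun i => Rsum _)), (Rsum_seq_S (fun k => L ^ k)).
  set (v := L ^ m / INR (S m)).
  assert (Hv : forall i, (i <= m)%nat -> L ^ (i + m) / INR (S (Nat.max i m)) <= v /\
                                         L ^ (m + i) / INR (S (Nat.max m i)) <= v).
  { intros i Hi. rewrite Nat.max_r, Nat.max_l, (Nat.add_comm m i) by lia. unfold v.
    assert (L ^ (i + m) <= L ^ m) by (apply pow_le_anti; [lra|lia]).
    assert (0 < / INR (S m)) by (apply Rinv_pos, lt_0_INR; lia).
    unfold Rdiv; split; apply Rmult_le_compat_r; lra. }
  assert (A1 : Rsum (map (fun j => L ^ (m + j) / INR (S (Nat.max m j))) (seq 0 m)) <= INR m * v).
  { apply Rle_trans with (Rsum (map (fun _ => v) (seq 0 m))); [|rewrite Rsum_const, length_seq; lra].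
    apply Rsum_le.
    intros j Hj; apply in_seq in Hj; apply Hv; lia. }
  assert (A2 : Rsum (map (fun i => L ^ (i + m) / INR (S (Nat.max i m))) (seq 0 (S m))) <= INR (S m) * v).
  { apply Rle_trans with (Rsum (map (fun _ => v) (seq 0 (S m)))); [|rewrite Rsum_const, length_seq; lra].
    apply Rsum_le.
    intros j Hj; apply in_seq in Hj; apply Hv; lia. }
  assert (Hvm : INR (S m) * v = L ^ m) by (unfold v; field; apply not_0_INR; lia).
  assert (0 <= v).
  { unfold v. apply Rdiv_le_0_compat; [apply pow_le; lra|apply lt_0_INR; lia]. }
  rewrite S_INR in *. lra.
Qed.

Lemma wt_sum_le n m L : 0 <= L < 1 ->
  Rsum (map (fun al => / wt al * L ^ list_sum al) (box (S (S n)) m)) <= 2 * (/ (1 - L)) ^ (S n).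
Proof.
  intros HL. rewrite Rsum_box_S.
  set (G := Rsum (map (fun al => L ^ list_sum al) (box n m))).
  rewrite (Rsum_ext _ (fun i => G * Rsum (map (fun j => L ^ (i + j) / INR (S (Nat.max i j))) (seq 0 m)))).
  2:{ intros i _. rewrite (Rsum_box_S (fun t => / wt (i :: t) * L ^ list_sum (i :: t))).
      rewrite <- Rsum_scal. apply Rsum_ext; intros j _.
      unfold G. rewrite Rmult_comm, <- Rsum_scal. apply Rsum_ext; intros t _.
      cbn [wt]. change (list_sum (i :: j :: t)) with (i + (j + list_sum t))%nat.
      rewrite Nat.add_assoc, (pow_add L (i + j)). unfold Rdiv; ring. }
  rewrite Rsum_scal. pose proof (geom_box_le L n m HL) as HG. fold G in HG.
  pose proof (square_sum_le L m HL) as HD. pose proof (geom_sum_le L m HL) as Hs.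
  assert (0 <= G) by (apply Rsum_nonneg; intros; apply pow_le; lra).
  assert (0 < / (1 - L)) by (apply Rinv_pos; lra).
  apply Rle_trans with ((/ (1 - L)) ^ n * (2 * / (1 - L))); [|right; simpl; ring].
  apply Rmult_le_compat; auto; [|lra].
  apply Rsum_nonneg; intros; apply Rsum_nonneg; intros.
  apply Rdiv_le_0_compat; [apply pow_le; lra|apply lt_0_INR; lia].
Qed.

(* Cauchy-Schwarz with the weights [1/wt]. Equal weights would lose a logarithm when [theta = 1/N]. *)
Lemma diag_pointwise_le n m a w : Cmod w < 1 ->
  Cnorm2 (Csum (map (fun al => Cmul (a al) (Cpow w (list_sum al))) (box (S (S n)) m)))
  <= 2 * Rsum (map (fun al => Cnorm2 (a al) *
       (INR (S (list_sum al)) * Cmod w ^ list_sum al * (/ (1 - Cmod w)) ^ (S n))) (box (S (S n)) m)).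
Proof.
  intros Hw. pose proof (Cmod_nonneg w) as H0. set (L := Cmod w) in *.
  set (s := Csum _).
  assert (H1 : Cmod s <= Rsum (map (fun al => Cmod (a al) * L ^ list_sum al) (box (S (S n)) m))).
  { unfold s; eapply Rle_trans; [apply Cmod_Csum_le|]. apply Rsum_le; intros al _.
    rewrite Cmod_mul, Cmod_pow; fold L; lra. }
  pose proof (Rsum_cauchy_schwarz_weight (fun al => Cmod (a al)) (fun al => / wt al)
     (fun al => L ^ list_sum al) (box (S (S n)) m)) as H2.
  assert (H3 : Cnorm2 s <= Rsum (map (fun al => / wt al * L ^ list_sum al) (box (S (S n)) m)) *
     Rsum (map (fun al => Cmod (a al) * Cmod (a al) * L ^ list_sum al / / wt al) (box (S (S n)) m))).
  { rewrite <- Cmod_sqr. pose proof (Cmod_nonneg s).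
    eapply Rle_trans; [|apply H2]; [apply Rmult_le_compat; auto| |].
    - intros al _; apply Rinv_pos, wt_pos.
    - intros al _; apply pow_le; lra. }
  eapply Rle_trans; [exact H3|].
  rewrite (Rsum_ext (fun al => Cnorm2 (a al) * _)
     (fun al => (/ (1 - L)) ^ (S n) * (Cnorm2 (a al) * (INR (S (list_sum al)) * L ^ list_sum al))))
    by (intros; ring).
  rewrite Rsum_scal, <- Rmult_assoc.
  apply Rmult_le_compat; [| |apply wt_sum_le; lra|].
  - apply Rsum_nonneg; intros al _. apply Rmult_le_pos; [left; apply Rinv_pos, wt_pos|apply pow_le; lra].
  - apply Rsum_nonneg; intros al _. unfold Rdiv. rewrite Rinv_inv. pose proof (wt_pos al). pose proof (Cmod_nonneg (a al)).
    apply Rmult_le_pos; [apply Rmult_le_pos; [nra|apply pow_le; lra]|lra].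
  - apply Rsum_le; intros al _. rewrite Cmod_sqr. unfold Rdiv; rewrite Rinv_inv, Rmult_assoc.
    apply Rmult_le_compat_l; [apply Cnorm2_nonneg|]. rewrite Rmult_comm.
    apply Rmult_le_compat_r; [apply pow_le; lra|apply wt_le].
Qed.

(** The cube of 1 + y <= 3 exp(y/3). Two factors 1+y will make the kernel summable, the third pays
    for the power delta. *)
Lemma cube_exp_bound y : 0 <= y -> (1 + y) * (1 + y) * (1 + y) * exp (- y) <= 27.
Proof.
  intros Hy. pose proof (exp_ineq1_le (y / 3)) as H. set (e := exp (y / 3)) in *.
  assert (E : exp (- y) * (e * e * e) = 1).
  { unfold e. rewrite <- !exp_plus. rewrite <- exp_0. f_equal. field. }
  assert (H3 : 1 + y <= 3 * e) by lra. assert (0 < e) by apply exp_pos.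
  pose proof (exp_pos (- y)).
  assert ((1 + y) * (1 + y) <= (3 * e) * (3 * e)) by nra.
  assert ((1 + y) * (1 + y) * (1 + y) <= (3 * e) * (3 * e) * (3 * e)) by (apply Rmult_le_compat; nra).
  apply Rle_trans with ((3 * e) * (3 * e) * (3 * e) * exp (- y)); [apply Rmult_le_compat_r; lra|].
  replace (3 * e * (3 * e) * (3 * e) * exp (- y)) with (27 * (exp (- y) * (e * e * e))) by ring. lra.
Qed.

Lemma Rpower_le_1_plus y d : 0 < y -> 0 <= d <= 1 -> Rpower y d <= 1 + y.
Proof.
  intros Hy Hd. destruct (Rle_dec y 1).
  - apply Rle_trans with (Rpower 1 d); [apply Rle_Rpower_l; lra|rewrite rpower_1_base; lra].
  - apply Rle_trans with (Rpower y 1); [apply Rle_Rpower; lra|rewrite Rpower_1; lra].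
Qed.

Lemma Rpower_ge_base x e : 0 < x <= 1 -> e <= 1 -> x <= Rpower x e.
Proof.
  intros Hx He. rewrite <- (Rpower_1 x) at 1 by lra. unfold Rpower.
  apply exp_le. assert (ln x <= 0) by (rewrite <- ln_1; apply Rcomplements.ln_le; lra). nra.
Qed.

(** Put P = x^theta and eta = kap P <= 1 - L, so that y = (k+1) eta. Then L^k <= e exp(-y) and
    (1-L)^(-N) <= eta^(-N), leaving y exp(-y) P^(-N-1) up to powers of kap. The exponent condition
    gives P^(-N-1) <= P^delta / x, and P^delta, with P = y / ((k+1) kap), yields the decay in k at
    the cost of a factor 1+y. The remaining shape is the one that [potential_sum] sums. *)
Lemma kernel_bound N k theta delta kap x L : 0 < theta -> 0 <= delta <= 1 ->
  theta * INR (S N) + theta * delta <= 1 -> 0 < kap <= 1 -> 0 < x <= 1 -> 0 <= L ->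
  kap * Rpower x theta <= 1 - L ->
  let y := INR (S k) * kap * Rpower x theta in
  INR (S k) * L ^ k * (/ (1 - L)) ^ N
  <= 27 * exp 1 * (/ kap) ^ (S (S N)) * Rpower (/ INR (S k)) delta * (/ x * (y / ((1 + y) * (1 + y)))).
Proof.
  intros Ht Hd Hexp Hk Hx HL0 HL y.
  set (P := Rpower x theta) in *. assert (HP : 0 < P) by apply Rpower_pos.
  assert (HP1 : P <= 1).
  { apply Rle_trans with (Rpower 1 theta); [apply Rle_Rpower_l; lra|rewrite rpower_1_base; lra]. }
  set (K := INR (S k)) in *. assert (HK : 1 <= K) by (unfold K; rewrite S_INR; pose proof (pos_INR k); lra).
  set (eta := kap * P) in *. assert (Heta : 0 < eta <= 1) by (unfold eta; nra).
  assert (Hy : y = K * eta) by (unfold y, eta; ring).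
  assert (Hy0 : 0 < y) by (rewrite Hy; nra).
  assert (B1 : L ^ k <= exp 1 * exp (- y)).
  { apply Rle_trans with (exp (- eta) ^ k).
    - apply pow_incr. pose proof (exp_ineq1_le (- eta)). lra.
    - rewrite exp_pow, <- exp_plus. apply exp_le. rewrite Hy. unfold K; rewrite S_INR. lra. }
  assert (B2 : (/ (1 - L)) ^ N <= (/ eta) ^ N).
  { apply pow_incr; split; [left; apply Rinv_pos; lra|apply Rinv_le_contravar; lra]. }
  assert (B3 : / P ^ S N <= / x * Rpower P delta).
  { assert (E : P ^ S N = Rpower x (theta * INR (S N))).
    { rewrite <- Rpower_pow by auto. unfold P. rewrite Rpower_mult. auto. }
    assert (E2 : Rpower P delta = Rpower x (theta * delta)) by (unfold P; apply Rpower_mult).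
    rewrite E, E2. set (A := Rpower x (theta * INR (S N))). assert (0 < A) by apply Rpower_pos.
    apply Rmult_le_reg_l with (x * A); [nra|].
    replace (x * A * / A) with x by (field; lra).
    replace (x * A * (/ x * Rpower x (theta * delta))) with (A * Rpower x (theta * delta)) by (field; lra).
    unfold A; rewrite <- Rpower_plus. apply Rpower_ge_base; lra. }
  assert (B4 : Rpower P delta <= (1 + y) * Rpower (/ K) delta * / kap).
  { assert (EP : P = y * / K * / kap) by (rewrite Hy; unfold eta; field; lra).
    assert (0 < / K) by (apply Rinv_pos; lra). assert (0 < / kap) by (apply Rinv_pos; lra).
    assert (1 <= / kap) by (rewrite <- Rinv_1; apply Rinv_le_contravar; lra).
    rewrite EP. rewrite <- !Rpower_mult_distr by nra.
    pose proof (Rpower_le_1_plus y delta Hy0 Hd).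
    assert (Rpower (/ kap) delta <= / kap).
    { rewrite <- (Rpower_1 (/ kap)) at 2 by auto. apply Rle_Rpower; lra. }
    pose proof (Rpower_pos y delta); pose proof (Rpower_pos (/ K) delta); pose proof (Rpower_pos (/ kap) delta).
    apply Rmult_le_compat; [nra|lra| |auto]. apply Rmult_le_compat_r; lra. }
  assert (B5 : K * (/ eta) ^ N = y * ((/ kap) ^ S N * / P ^ S N)).
  { rewrite Hy. unfold eta. rewrite Rinv_mult, Rpow_mult_distr, <- !pow_inv. simpl. field. lra. }
  pose proof (cube_exp_bound y ltac:(lra)) as B6.
  assert (Hkp : 0 < (/ kap) ^ S N) by (apply pow_lt, Rinv_pos; lra).
  pose proof (exp_pos 1). pose proof (exp_pos (- y)).
  pose proof (Rpower_pos (/ K) delta) as HRK. pose proof (Rpower_pos P delta) as HRP.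
  assert (0 < / x) by (apply Rinv_pos; lra).
  assert (0 < / kap) by (apply Rinv_pos; lra).
  assert (0 <= (/ (1 - L)) ^ N) by (apply pow_le; left; apply Rinv_pos; lra).
  apply Rle_trans with (K * (exp 1 * exp (- y)) * (/ eta) ^ N).
  { apply Rmult_le_compat; auto; [|apply Rmult_le_compat_l; lra].
    apply Rmult_le_pos; [lra|apply pow_le; auto]. }
  replace (K * (exp 1 * exp (- y)) * (/ eta) ^ N) with (exp 1 * exp (- y) * (K * (/ eta) ^ N)) by ring.
  rewrite B5.
  apply Rle_trans with (exp 1 * exp (- y) * (y * ((/ kap) ^ S N * (/ x * ((1 + y) * Rpower (/ K) delta * / kap))))).
  { apply Rmult_le_compat_l; [nra|]. apply Rmult_le_compat_l; [lra|]. apply Rmult_le_compat_l; [lra|].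
    eapply Rle_trans; [exact B3|]. apply Rmult_le_compat_l; lra. }
  set (Q := exp 1 * ((/ kap) ^ S N * / kap) * Rpower (/ K) delta * / x * y / ((1 + y) * (1 + y))).
  assert (HQ : 0 < Q).
  { unfold Q. apply Rdiv_lt_0_compat; [|nra].
    generalize dependent ((/ kap) ^ S N); intros.
    repeat apply Rmult_lt_0_compat; auto; lra. }
  replace (exp 1 * exp (- y) * (y * ((/ kap) ^ S N * (/ x * ((1 + y) * Rpower (/ K) delta * / kap)))))
    with (Q * ((1 + y) * (1 + y) * (1 + y) * exp (- y))) by (unfold Q; field; lra).
  replace (27 * exp 1 * (/ kap) ^ S (S N) * Rpower (/ K) delta * (/ x * (y / ((1 + y) * (1 + y)))))
    with (Q * 27) by (unfold Q; simpl; field; lra).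
  apply Rmult_le_compat_l; lra.
Qed.

Lemma Rsum_seq_rev (f : nat -> R) m :
  Rsum (map (fun t => f (m - 1 - t)%nat) (seq 0 m)) = Rsum (map f (seq 0 m)).
Proof.
  induction m as [|m IH]; [auto|]. rewrite (Rsum_seq_S f), <- IH.
  change (seq 0 (S m)) with (0%nat :: seq 1 m). cbn [map Rsum fold_right].
  change (fold_right Rplus 0) with Rsum. rewrite Rsum_seq_shift, Rplus_comm. f_equal.
  - apply Rsum_ext; intros; f_equal; lia.
  - f_equal; lia.
Qed.

Lemma Rsum_seq_blocks (f g : nat -> R) n m :
  (forall q t, (t < m)%nat -> f (q * m + t)%nat <= g t) ->
  Rsum (map f (seq 0 (n * m))) <= INR n * Rsum (map g (seq 0 m)).
Proof.
  intros H. induction n as [|n IH]; [simpl; lra|].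
  rewrite Nat.mul_succ_l, seq_app, map_app, Rsum_app, S_INR, (Rsum_seq_shift f (0 + n * m)).
  assert (Rsum (map (fun i => f (0 + n * m + i)%nat) (seq 0 m)) <= Rsum (map g (seq 0 m))); [|lra].
  apply Rsum_le; intros t Ht; apply in_seq in Ht; apply H; lia.
Qed.

Lemma sin_PI_mult_ge x : 0 <= x <= / 2 -> x <= sin (PI * x).
Proof.
  intros Hx. pose proof PI_4. pose proof PI2_3_2. assert (3 < PI) by lra.
  set (a := PI * x). assert (Ha : 0 <= a <= PI / 2) by (unfold a; nra).
  destruct (pre_sin_bound a 0) as [Hl _]; [lra|lra|].
  simpl in Hl. unfold sin_approx, sum_f_R0, sin_term in Hl. simpl in Hl.
  assert (a - a * a * a / 6 <= sin a) by lra.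
  assert (a * a <= 4) by nra. assert (3 * x <= a) by (unfold a; nra). nra.
Qed.

Lemma abs_sin_shift q u : Rabs (sin (INR q * PI + u)) = Rabs (sin u).
Proof.
  induction q; [simpl; rewrite Rmult_0_l, Rplus_0_l; auto|].
  rewrite S_INR. replace ((INR q + 1) * PI + u) with (INR q * PI + u + PI) by ring.
  rewrite neg_sin, Rabs_Ropp; auto.
Qed.

(** For every r, |1 - r^2 exp(2ig)| is at least |sin 2g|, the distance from 1 to the line through 0
    and exp(2ig). On a grid of 4m points the doubled angle at index q m + t is q pi + pi x(t), so
    every block of m points sees the same distances. Either x(t) or its mirror image 1 - x(t) lies
    below 1/2, where sin(pi x) >= x. *)
Lemma grid_gap r m q t : (t < m)%nat -> 0 <= r ->
  let x := fun t => (2 * INR t + 1) / (2 * INR m) in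
  let d := Cmod (Csub C1 (Cmul (gpt r (4 * m) (q * m + t)) (gpt r (4 * m) (q * m + t)))) in
  x t <= d \/ x (m - 1 - t)%nat <= d.
Proof.
  intros Ht Hr x d.
  assert (Hm : 0 < INR m) by (apply lt_0_INR; lia).
  assert (Hxt : 0 < x t < 1).
  { pose proof (pos_INR t). assert (INR t + 1 <= INR m) by (rewrite <- S_INR; apply le_INR; lia).
    unfold x; split; [apply Rdiv_lt_0_compat; lra|].
    apply Rlt_div_l; lra. }
  assert (Hd : Rabs (sin (PI * x t)) <= d).
  { rewrite <- (abs_sin_shift q).
    replace (INR q * PI + PI * x t) with (2 * gang (4 * m) (q * m + t)).
    2:{ unfold gang, x. rewrite plus_INR, !mult_INR. simpl (INR 4). field; lra. }
    set (g := gang (4 * m) (q * m + t)).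
    assert (E : Cmul (gpt r (4 * m) (q * m + t)) (gpt r (4 * m) (q * m + t)) = Cmul (RtoC (r * r)) (cis (2 * g))).
    { replace (2 * g) with (g + g) by ring. rewrite <- cis_add. unfold gpt. fold g.
      replace (RtoC (r * r)) with (Cmul (RtoC r) (RtoC r)) by Cdestr. ring. }
    unfold d. rewrite E. apply Rsqr_incr_0_var; [|apply Cmod_nonneg].
    rewrite <- Rsqr_abs. unfold Rsqr. rewrite Cmod_sqr. unfold Cnorm2, Csub, Cadd, Copp, Cmul, RtoC, cis, C1; simpl.
    pose proof (sin2_cos2 (2 * g)) as S. unfold Rsqr in S.
    set (c := cos (2 * g)) in *. set (s := sin (2 * g)) in *.
    pose proof (Rle_0_sqr (r * r - c)). unfold Rsqr in *. nra. }
  assert (Hs : 0 <= sin (PI * x t)) by (pose proof PI_RGT_0; apply sin_ge_0; nra).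
  rewrite Rabs_pos_eq in Hd by auto.
  destruct (Rle_dec (x t) (/ 2)).
  - left. eapply Rle_trans; [apply sin_PI_mult_ge; lra|auto].
  - right. assert (E : x (m - 1 - t)%nat = 1 - x t).
    { unfold x. rewrite !minus_INR by lia. simpl (INR 1). field; lra. }
    rewrite E. eapply Rle_trans; [apply sin_PI_mult_ge; lra|].
    replace (PI * (1 - x t)) with (PI - PI * x t) by ring. rewrite sin_PI_x. auto.
Qed.

(** * Boundedness *)

(** The value delta = 0 gives the constant 1, so one estimate serves both boundedness and the
    neglect of high degrees. *)
Definition decay (delta : R) (k : nat) : R := Rpower (/ INR (S k)) delta.

Lemma decay_pos d k : 0 < decay d k.
Proof. apply Rpower_pos. Qed.

Lemma decay_anti d k k' : 0 <= d -> (k <= k')%nat -> decay d k' <= decay d k.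
Proof.
  intros Hd Hk. apply Rle_Rpower_l; auto.
  split; [apply Rinv_pos, lt_0_INR; lia|].
  apply Rinv_le_contravar; [apply lt_0_INR; lia|apply le_INR; lia].
Qed.

Lemma decay_le_1 d k : 0 <= d -> decay d k <= 1.
Proof.
  intros Hd. apply Rle_trans with (decay d 0); [apply decay_anti; auto; lia|].
  unfold decay; simpl. rewrite Rinv_1, rpower_1_base; lra.
Qed.

(** Each block of m points is bounded by the kernel bound at x(t) plus the one at its mirror image,
    and reversing the sum shows that the two contribute equally. The constant is uniform in the
    radius, the grid and the degree. *)
Lemma circle_average_kernel theta N delta : 0 < theta < 1 -> 0 <= delta <= 1 ->
  theta * INR (S N) + theta * delta <= 1 ->
  exists K, 0 < K /\ forall r m k, 0 < r < 1 -> (0 < m)%nat ->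
    avg (4 * m) (fun l => let L := Cmod (lens theta (gpt r (4 * m) l)) in
       INR (S k) * L ^ k * (/ (1 - L)) ^ N) <= K * decay delta k.
Proof.
  intros Ht Hd Hexp.
  set (kap := cos (theta * (PI / 2)) / 8).
  assert (Hk : 0 < kap <= 1) by (pose proof (kap_bounds theta Ht); unfold kap; lra).
  set (A := 27 * exp 1 * (/ kap) ^ (S (S N))).
  assert (HA : 0 < A).
  { unfold A. pose proof (exp_pos 1). apply Rmult_lt_0_compat; [lra|].
    apply pow_lt, Rinv_pos; lra. }
  exists (4 * A / theta). split; [apply Rdiv_lt_0_compat; lra|].
  intros r m k Hr Hm.
  assert (HMp : 0 < INR m) by (apply lt_0_INR; auto).
  set (x := fun t => (2 * INR t + 1) / (2 * INR m)).
  set (Y := INR (S k) * kap).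
  assert (HY : 0 < Y) by (unfold Y; apply Rmult_lt_0_compat; [apply lt_0_INR; lia|lra]).
  set (y := fun t => Y * Rpower (x t) theta).
  set (B := fun t => A * decay delta k * (/ x t * (y t / ((1 + y t) * (1 + y t))))).
  assert (Hx : forall t, (t < m)%nat -> 0 < x t <= 1).
  { intros t Htm. pose proof (pos_INR t). assert (INR t + 1 <= INR m) by (rewrite <- S_INR; apply le_INR; lia).
    unfold x; split; [apply Rdiv_lt_0_compat; lra|].
    apply Rle_div_l; lra. }
  assert (HB : forall t, (t < m)%nat -> 0 <= B t).
  { intros t Htm. specialize (Hx t Htm). pose proof (decay_pos delta k).
    assert (0 < y t) by (unfold y; pose proof (Rpower_pos (x t) theta); nra).
    unfold B. apply Rmult_le_pos; [nra|]. apply Rmult_le_pos; [left; apply Rinv_pos; lra|].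
    apply Rdiv_le_0_compat; nra. }
  set (f := fun l => let L := Cmod (lens theta (gpt r (4 * m) l)) in INR (S k) * L ^ k * (/ (1 - L)) ^ N).
  assert (Hf : forall q t, (t < m)%nat -> f (q * m + t)%nat <= B t + B (m - 1 - t)%nat).
  { intros q t Htm.
    assert (W : forall s, (s < m)%nat ->
      x s <= Cmod (Csub C1 (Cmul (gpt r (4 * m) (q * m + t)) (gpt r (4 * m) (q * m + t)))) ->
      f (q * m + t)%nat <= B s).
    { intros s Hs Hgap. unfold f, B, y, Y, A, decay.
      assert (Hz : Cmod (gpt r (4 * m) (q * m + t)) < 1) by (rewrite Cmod_gpt; lra).
      pose proof (lens_gap theta Ht _ Hz) as G. pose proof (Cmod_lens_lt theta Ht _ Hz).
      pose proof (Hx s Hs).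
      apply kernel_bound; auto; [lra|apply Cmod_nonneg|].
      eapply Rle_trans; [|exact G]. apply Rmult_le_compat_l; [fold kap; lra|].
      apply Rle_Rpower_l; lra. }
    pose proof (HB t Htm). pose proof (HB (m - 1 - t)%nat ltac:(lia)).
    destruct (grid_gap r m q t Htm ltac:(lra)) as [G|G]; [specialize (W t Htm G)|specialize (W (m - 1 - t)%nat ltac:(lia) G)]; lra. }
  pose proof (Rsum_seq_blocks f _ 4 m Hf) as H.
  rewrite Rsum_plus, Rsum_seq_rev in H. simpl (INR 4) in H.
  unfold avg. fold f. rewrite mult_INR. simpl (INR 4).
  assert (E : Rsum (map B (seq 0 m)) = 2 * INR m * (A * decay delta k) *
     Rsum (map (fun t => / (2 * INR t + 1) * (y t / ((1 + y t) * (1 + y t)))) (seq 0 m))).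
  { rewrite <- Rsum_scal. apply Rsum_ext; intros t Htm; apply in_seq in Htm. unfold B, x.
    rewrite Rinv_div. pose proof (pos_INR t). unfold Rdiv; ring. }
  (* The scaling x(t) = (2t+1)/(2m) goes into the constant [Y], on which the bound for the sum does
     not depend. *)
  pose proof (potential_sum theta (Y * Rpower (/ (2 * INR m)) theta) m ltac:(lra)) as P.
  assert (HY2 : 0 < Y * Rpower (/ (2 * INR m)) theta) by (pose proof (Rpower_pos (/ (2 * INR m)) theta); nra).
  specialize (P HY2). cbv zeta in P.
  rewrite (Rsum_ext _ (fun t => / (2 * INR t + 1) * (y t / ((1 + y t) * (1 + y t))))) in P.
  2:{ intros t _. assert (E2 : Y * Rpower (/ (2 * INR m)) theta * Rpower (2 * INR t + 1) theta = y t).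
      { unfold y, x. rewrite Rmult_assoc, Rpower_mult_distr.
        - do 2 f_equal. unfold Rdiv; ring.
        - apply Rinv_pos; lra.
        - pose proof (pos_INR t); lra. }
      rewrite E2; auto. }
  set (S := Rsum (map (fun t => / (2 * INR t + 1) * (y t / ((1 + y t) * (1 + y t)))) (seq 0 m))) in *.
  rewrite E in H. pose proof (decay_pos delta k).
  assert (HS : S <= / theta).
  { apply Rmult_le_reg_l with theta; [lra|]. rewrite Rinv_r by lra. auto. }
  apply Rmult_le_reg_l with (4 * INR m); [lra|].
  replace (4 * INR m * (/ ((1 + 1 + 1 + 1) * INR m) * Rsum (map f (seq 0 (4 * m)))))
    with (Rsum (map f (seq 0 (4 * m)))) by (field; lra).
  eapply Rle_trans; [exact H|].
  assert (0 < INR m * (A * decay delta k)) by (apply Rmult_lt_0_compat; nra).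
  replace (4 * INR m * (4 * A / theta * decay delta k)) with (16 * (INR m * (A * decay delta k)) * / theta) by (field; lra).
  replace ((1 + 1 + 1 + 1) * (2 * INR m * (A * decay delta k) * S + 2 * INR m * (A * decay delta k) * S))
    with (16 * (INR m * (A * decay delta k)) * S) by ring.
  apply Rmult_le_compat_l; lra.
Qed.

Definition diag_sum (N : nat) (a : family) (M : nat) (w : C) : C :=
  Csum (map (fun al => Cmul (a al) (Cpow w (list_sum al))) (box N M)).

Lemma circle_average_diag_sum theta n delta : 0 < theta < 1 -> 0 <= delta <= 1 ->
  theta * INR (S (S n)) + theta * delta <= 1 ->
  exists K, 0 < K /\ forall a M r m, 0 < r < 1 -> (0 < m)%nat ->
    avg (4 * m) (fun l => Cnorm2 (diag_sum (S (S n)) a M (lens theta (gpt r (4 * m) l))))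
    <= K * Rsum (map (fun al => Cnorm2 (a al) * decay delta (list_sum al)) (box (S (S n)) M)).
Proof.
  intros Ht Hd Hexp. destruct (circle_average_kernel theta (S n) delta Ht Hd Hexp) as (K & HK & H).
  exists (2 * K); split; [lra|]. intros a M r m Hr Hm.
  eapply Rle_trans.
  { apply avg_le; intros l _. apply diag_pointwise_le. apply Cmod_lens_lt; auto. rewrite Cmod_gpt; lra. }
  rewrite avg_scal, avg_Rsum, Rmult_assoc. apply Rmult_le_compat_l; [lra|].
  rewrite <- Rsum_scal. apply Rsum_le; intros al _.
  rewrite avg_scal. replace (K * (Cnorm2 (a al) * decay delta (list_sum al)))
    with (Cnorm2 (a al) * (K * decay delta (list_sum al))) by ring.
  apply Rmult_le_compat_l; [apply Cnorm2_nonneg|]. apply H; auto.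
Qed.

Lemma mono_from_const i w al : mono_from i (fun _ => w) al = Cpow w (list_sum al).
Proof.
  revert i; induction al as [|k t IH]; intros; [auto|].
  change (list_sum (k :: t)) with (k + list_sum t)%nat. cbn [mono_from]. rewrite IH, Cpow_add; auto.
Qed.

Lemma series_at_diag N a w v : series_at N a (fun _ => w) v <-> Ccv (fun M => diag_sum N a M w) v.
Proof.
  unfold series_at, diag_sum. split; apply Ccv_ext; exists 0%nat; intros m _;
    apply Csum_ext; intros al _; unfold mono; rewrite mono_from_const; auto.
Qed.

Lemma diag_function theta N a : 0 < theta < 1 -> asum N a ->
  exists h : C -> C, forall z, Cmod z < 1 -> series_at N a (fun _ => lens theta z) (h z).
Proof.
  intros Ht Ha.
  assert (H : forall z, exists v, Cmod z < 1 -> series_at N a (fun _ => lens theta z) v).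
  { intros z. destruct (Rlt_dec (Cmod z) 1) as [Hz|Hz]; [|exists C0; tauto].
    destruct (asum_series N a (fun _ => lens theta z)) as [v Hv]; auto; [|exists v; auto].
    intros i _. apply Cmod_lens_lt; auto. }
  destruct (fun_choice _ H) as [h Hh]; exists h; auto.
Qed.

(** On |z| <= r the lens map stays in a disc of radius rho < 1, where one majorant series controls
    all tails. *)
Lemma diag_function_uniform theta N a h r eps : 0 < theta < 1 -> asum N a ->
  (forall z, Cmod z < 1 -> series_at N a (fun _ => lens theta z) (h z)) ->
  0 < r < 1 -> 0 < eps ->
  exists M0, forall M z, (M0 <= M)%nat -> Cmod z <= r ->
    Cmod (Csub (h z) (diag_sum N a M (lens theta z))) <= eps.
Proof.
  intros Ht Ha Hh Hr He. destruct (Cmod_lens_le theta Ht r Hr) as (rho & Hrho & Hl).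
  destruct (asum_lim N a rho Ha Hrho) as [L HL]. destruct (HL eps He) as [M0 HM].
  exists M0; intros M z Hm Hz. specialize (HM M Hm). unfold R_dist in HM.
  eapply Rle_trans; [|left; exact HM]. rewrite Rabs_minus_sym.
  eapply Rle_trans; [|apply Rle_abs].
  replace (diag_sum N a M (lens theta z))
    with (Csum (map (fun al => Cmul (a al) (mono (fun _ => lens theta z) al)) (box N M)))
    by (apply Csum_ext; intros; unfold mono; rewrite mono_from_const; auto).
  apply series_tail; auto; [lra|]. apply Hh; lra.
Qed.

Lemma inA_diag_sum theta N a M r : 0 < theta < 1 -> 0 < r < 1 ->
  inA r (fun z => diag_sum N a M (lens theta z)).
Proof.
  intros Ht Hr. unfold diag_sum.
  apply (inA_Csum r (fun al z => Cmul (a al) (Cpow (lens theta z) (list_sum al)))).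
  intros al _. apply inA_scal; [lra|]. apply inA_pow; [lra|]. apply inA_lens; auto.
Qed.

(** Circle averages are known for truncations only; the uniform error disappears as eps tends to 0.
    A second use of |u+v|^2 <= 2|u|^2 + 2|v|^2 brings the factor to 4. *)
Lemma sqsum_of_approx N b (h : C -> C) S : (1 <= N)%nat -> asum N b ->
  (forall p, inD N p -> series_at N b p (h (p 0%nat))) ->
  (forall r eps, 0 < r < 1 -> 0 < eps -> exists g : C -> C,
     (forall z, Cmod z <= r -> Cmod (Csub (h z) (g z)) <= eps) /\
     (forall m, (0 < m)%nat -> avg (4 * m) (fun l => Cnorm2 (g (gpt r (4 * m) l))) <= S)) ->
  forall m, Rsum (map (fun al => Cnorm2 (b al)) (box N m)) <= 4 * S.
Proof.
  intros HN Hb Hh H m. replace (4 * S) with (2 * (2 * S)) by ring.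
  apply (sqsum_of_averages N b (fun p => h (p 0%nat))); auto.
  intros r k Hr Hk. destruct N as [|n]; [lia|].
  rewrite (gavg_first r n (4 * k) (fun z => Cnorm2 (h z))) by lia.
  apply Rle_eps_all; intros eps He.
  destruct (H r (Rmin 1 (eps / 2)) Hr) as (g & Hg & HS); [apply Rmin_glb_lt; lra|].
  specialize (HS k Hk).
  apply Rle_trans with (avg (4 * k) (fun l => 2 * Cnorm2 (g (gpt r (4 * k) l)) + eps)).
  - apply avg_le; intros l _. set (z := gpt r (4 * k) l).
    replace (h z) with (Cadd (g z) (Csub (h z) (g z))) by ring.
    eapply Rle_trans; [apply Cnorm2_add_le|]. apply Rplus_le_compat_l.
    assert (Cmod (Csub (h z) (g z)) <= Rmin 1 (eps / 2)) by (apply Hg; unfold z; rewrite Cmod_gpt; lra).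
    pose proof (Rmin_l 1 (eps / 2)); pose proof (Rmin_r 1 (eps / 2)).
    rewrite <- Cmod_sqr. pose proof (Cmod_nonneg (Csub (h z) (g z))). nra.
  - rewrite avg_plus, avg_scal, avg_const by lia. lra.
Qed.

Lemma comp_rel_function theta N a b h :
  comp_rel N (Phi_lens theta) a b -> (1 <= N)%nat ->
  (forall z, Cmod z < 1 -> series_at N a (fun _ => lens theta z) (h z)) ->
  forall p, inD N p -> series_at N b p (h (p 0%nat)).
Proof.
  intros H HN Hh p Hp. destruct (H p Hp) as (v & Hv1 & Hv2).
  rewrite (Ccv_unique _ _ _ (Hh (p 0%nat) (Hp 0%nat HN)) Hv2). exact Hv1.
Qed.

Lemma composition_norm theta n delta : 0 < theta < 1 -> 0 <= delta <= 1 ->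
  theta * INR (S (S n)) + theta * delta <= 1 ->
  exists K, 0 < K /\ forall a b W, asum (S (S n)) a -> asum (S (S n)) b ->
    comp_rel (S (S n)) (Phi_lens theta) a b ->
    (forall m, Rsum (map (fun al => Cnorm2 (a al) * decay delta (list_sum al)) (box (S (S n)) m)) <= W) ->
    forall m, Rsum (map (fun al => Cnorm2 (b al)) (box (S (S n)) m)) <= K * W.
Proof.
  intros Ht Hd Hexp. destruct (circle_average_diag_sum theta n delta Ht Hd Hexp) as (K & HK & H).
  exists (4 * K); split; [lra|]. intros a b W Ha Hb Hab HW m. rewrite Rmult_assoc.
  destruct (diag_function theta _ a Ht Ha) as (h & Hh).
  apply (sqsum_of_approx _ b h); [lia|auto| |].
  - eapply comp_rel_function; eauto; lia.
  - intros r eps Hr He. destruct (diag_function_uniform theta _ a h r eps Ht Ha Hh Hr He) as [M HM].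
    exists (fun z => diag_sum (S (S n)) a M (lens theta z)). split; [intros; apply HM; auto|].
    intros k Hk. eapply Rle_trans; [apply H; auto|]. apply Rmult_le_compat_l; [lra|auto].
Qed.

(** The diagonal function is a locally uniform limit of polynomials in the lens map, hence has a
    power series in the first variable. The norm estimate with delta = 0 then upgrades this series
    to a square-summable one. *)
Lemma composition_exists theta n a : 0 < theta < 1 -> theta * INR (S (S n)) <= 1 -> l2 (S (S n)) a ->
  exists b, l2 (S (S n)) b /\ comp_rel (S (S n)) (Phi_lens theta) a b.
Proof.
  intros Ht Hexp Ha. pose proof (l2_asum _ a Ha) as Has.
  destruct (diag_function theta _ a Ht Has) as (h & Hh).
  destruct (embed_series (S (S n)) h) as (b & Hb & Hs); [lia| |].
  { intros r Hr. apply inA_limit; intros eps He.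
    destruct (diag_function_uniform theta _ a h r eps Ht Has Hh Hr He) as [M HM].
    exists (fun z => diag_sum (S (S n)) a M (lens theta z)). split; [apply inA_diag_sum; auto|].
    intros; apply HM; auto. }
  assert (Hc : comp_rel (S (S n)) (Phi_lens theta) a b).
  { intros p Hp. exists (h (p 0%nat)); split; auto. apply Hh, Hp; lia. }
  exists b; split; auto.
  destruct (composition_norm theta n 0 Ht ltac:(lra) ltac:(lra)) as (K & HK & H).
  destruct (l2_bound _ a Ha) as (B & _ & HB).
  apply (l2_of_bound _ b (K * B)), (H a); auto.
  intros m. eapply Rle_trans; [|apply (HB m)]. apply Rsum_le; intros al _.
  pose proof (decay_le_1 0 (list_sum al) ltac:(lra)). pose proof (decay_pos 0 (list_sum al)).
  pose proof (Cnorm2_nonneg (a al)). nra.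
Qed.

Lemma composition_bounded theta n : 0 < theta < 1 -> theta * INR (S (S n)) <= 1 ->
  CPhi_bounded (S (S n)) (Phi_lens theta).
Proof.
  intros Ht Hexp. split; [intros a Ha; apply composition_exists; auto|].
  destruct (composition_norm theta n 0 Ht ltac:(lra) ltac:(lra)) as (K & HK & H).
  (* The bound is asked for in the form M^2, and K <= (K+1)^2 avoids a square root. *)
  exists (K + 1); split; [lra|]. intros a b Ha Hb Hab s t Hs Htt.
  pose proof (sqsum_nonneg _ _ _ Htt).
  apply Rle_trans with (K * t); [|nra].
  apply (sqsum_le (S (S n)) b s); auto. apply (H a b t); auto using l2_asum.
  intros m. eapply Rle_trans; [|apply (sqsum_ge _ _ _ m Htt)]. apply Rsum_le; intros al _.
  pose proof (decay_le_1 0 (list_sum al) ltac:(lra)). pose proof (decay_pos 0 (list_sum al)).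
  pose proof (Cnorm2_nonneg (a al)). nra.
Qed.

(** * Lower bounds from Szego kernels *)

Lemma RtoC_sub x y : RtoC (x - y) = Csub (RtoC x) (RtoC y).
Proof. Cdestr. Qed.

(** The symbol sends this point to the diagonal, yet evaluation here is as cheap as in one variable:
    its squared norm is of order 1/(1-x) in every dimension. *)
Definition axis_point (x : R) : point := fun i => match i with O => RtoC x | S _ => C0 end.

Lemma axis_point_inD N x : 0 < x < 1 -> inD N (axis_point x).
Proof.
  intros Hx [|i] _; simpl; [rewrite Cmod_RtoC, Rabs_pos_eq; lra|rewrite Cmod_C0; lra].
Qed.

Lemma mono_zero_sum n m i p : (forall j, (i <= j)%nat -> p j = C0) ->
  Rsum (map (fun al => Cnorm2 (mono_from i p al)) (box n m)) <= 1.
Proof.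
  revert i; induction n as [|n IH]; intros i Hp.
  - simpl. unfold Cnorm2, C1; simpl; lra.
  - rewrite Rsum_box_S.
    eapply Rle_trans; [apply (Rsum_le _ (fun j => Cnorm2 (Cpow C0 j)))|].
    + intros j _. cbn [mono_from]. rewrite Hp by auto.
      rewrite (Rsum_ext _ (fun t => Cnorm2 (Cpow C0 j) * Cnorm2 (mono_from (S i) p t)))
        by (intros; apply Cnorm2_mul).
      rewrite Rsum_scal. pose proof (Cnorm2_nonneg (Cpow C0 j)).
      assert (Rsum (map (fun t => Cnorm2 (mono_from (S i) p t)) (box n m)) <= 1)
        by (apply IH; intros; apply Hp; lia). nra.
    + eapply Rle_trans; [apply (Rsum_seq_le_support _ _ 1)|].
      * intros; apply Cnorm2_nonneg.
      * intros [|j] Hj; [lia|]. cbn [Cpow]. rewrite Cnorm2_mul, Cnorm2_C0; ring.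
      * simpl. unfold Cnorm2, C1; simpl; lra.
Qed.

Lemma mono_axis_sum n m x : 0 < x < 1 ->
  Rsum (map (fun al => Cnorm2 (mono (axis_point x) al)) (box (S n) m)) <= / (1 - x).
Proof.
  intros Hx. rewrite Rsum_box_S.
  eapply Rle_trans; [apply (Rsum_le _ (fun j => x ^ j))|apply geom_sum_le; lra].
  intros j _. unfold mono; cbn [mono_from axis_point].
  rewrite (Rsum_ext _ (fun t => Cnorm2 (Cpow (RtoC x) j) * Cnorm2 (mono_from 1 (axis_point x) t)))
    by (intros; apply Cnorm2_mul).
  rewrite Rsum_scal, Cpow_RtoC, Cnorm2_RtoC.
  assert (Rsum (map (fun t => Cnorm2 (mono_from 1 (axis_point x) t)) (box n m)) <= 1).
  { apply mono_zero_sum; intros [|j'] Hj'; [lia|auto]. }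
  pose proof (pow_le x j ltac:(lra)). assert (x ^ j <= 1) by (change 1 with (x ^ 0); apply pow_le_anti; [lra|lia]).
  assert (0 <= x ^ j * x ^ j <= x ^ j) by nra. nra.
Qed.

Lemma partial_eval_le n m x b s : 0 < x < 1 -> sqsum (S n) b s ->
  Cnorm2 (Csum (map (fun al => Cmul (b al) (mono (axis_point x) al)) (box (S n) m))) <= s / (1 - x).
Proof.
  intros Hx Hs. eapply Rle_trans; [apply Cnorm2_Csum_mul_le|].
  apply Rmult_le_compat; [| |eapply sqsum_ge; eauto|apply mono_axis_sum; auto];
    apply Rsum_nonneg; intros; apply Cnorm2_nonneg.
Qed.

Lemma Cnorm2_limit_le u v B : Ccv u v -> (exists M, forall m, (M <= m)%nat -> Cnorm2 (u m) <= B) -> Cnorm2 v <= B.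
Proof.
  intros H [M HM].
  assert (HB : 0 <= B) by (eapply Rle_trans; [apply Cnorm2_nonneg|apply (HM M); auto]).
  rewrite <- (sqrt_sqrt B), <- Cmod_le_iff by auto using sqrt_pos.
  apply (Ccv_mod_le u); auto. exists M; intros m Hm.
  apply Cmod_le_iff; [apply sqrt_pos|]. rewrite sqrt_sqrt; auto.
Qed.

(* The test functions are the Szego kernels at the points [(r, ..., r)] of the diagonal,
   paired with evaluation at [(x, 0, ..., 0)] where [lens x = r]. *)
Definition szego (r : R) : family := fun al => RtoC (r ^ list_sum al).

Lemma Rsum_geom_box_eq w n m :
  Rsum (map (fun al => w ^ list_sum al) (box n m)) = Rsum (map (fun j => w ^ j) (seq 0 m)) ^ n.
Proof.
  induction n; [simpl; ring|]. rewrite Rsum_box_S.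
  rewrite (Rsum_ext _ (fun j => Rsum (map (fun al => w ^ list_sum al) (box n m)) * w ^ j)).
  2:{ intros j _. rewrite Rmult_comm, <- Rsum_scal. apply Rsum_ext; intros.
      change (list_sum (j :: x)) with (j + list_sum x)%nat. apply pow_add. }
  rewrite Rsum_scal, IHn. change (map (pow w)) with (map (fun j => w ^ j)). cbn [pow]; ring.
Qed.

Lemma szego_norm2 r N m : Rsum (map (fun al => Cnorm2 (szego r al)) (box N m))
  = Rsum (map (fun al => (r * r) ^ list_sum al) (box N m)).
Proof.
  apply Rsum_ext; intros; unfold szego. rewrite Cnorm2_RtoC, Rpow_mult_distr; auto.
Qed.

Lemma szego_sqsum N r : 0 <= r < 1 ->
  exists t, sqsum N (szego r) t /\ (/ (2 * (1 - r * r))) ^ N <= t.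
Proof.
  intros Hr.
  destruct (l2_of_bound N (szego r) ((/ (1 - r * r)) ^ N)) as [t Ht].
  { intros m; rewrite szego_norm2. apply geom_box_le; nra. }
  exists t; split; auto.
  (* With r^(2m) <= 1/2 each of the N geometric factors already has at least half its limit, hence
     the 2 in the bound. *)
  destruct (pow_small (r * r) (/ 2)) as [m Hm]; [nra|lra|].
  eapply Rle_trans; [|apply (sqsum_ge _ _ _ m Ht)]. rewrite szego_norm2, Rsum_geom_box_eq.
  assert (E : (1 - r * r) * Rsum (map (fun j => (r * r) ^ j) (seq 0 m)) = 1 - (r * r) ^ m).
  { clear; induction m; [simpl; ring|]. rewrite Rsum_seq_S, Rmult_plus_distr_l, IHm; simpl; ring. }
  assert (H1 : 0 < 1 - r * r) by nra.
  apply pow_incr; split; [left; apply Rinv_pos; lra|].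
  apply Rmult_le_reg_l with (2 * (1 - r * r)); [lra|]. rewrite Rinv_r by lra. lra.
Qed.

(** Reproducing property: evaluation at (r,...,r) pairs with the kernel of that same point, and the
    two partial sums agree term by term. *)
Lemma szego_at_diag N r t : sqsum N (szego r) t -> series_at N (szego r) (fun _ => RtoC r) (RtoC t).
Proof.
  intros Ht. apply series_at_diag. apply Ccv_eps; intros eps He.
  destruct (Ht eps He) as [M HM]. exists M; intros m Hm. specialize (HM m Hm). unfold R_dist in HM.
  unfold diag_sum. rewrite (Csum_ext _ (fun al => RtoC (Cnorm2 (szego r al)))).
  - rewrite Csum_RtoC, <- RtoC_sub, Cmod_RtoC; lra.
  - intros al _. unfold szego. rewrite Cpow_RtoC, Cnorm2_RtoC. Cdestr.
Qed.

(** Here 8 = 2 * 4, with 2 from the truncated geometric sums and 4 from 1 - r^2 <= 4 (1-x)^theta. *)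
Lemma szego_lens theta n x : 0 < theta < 1 -> 0 < x < 1 ->
  exists r t, lens theta (RtoC x) = RtoC r /\ 0 <= r < 1 /\ sqsum n (szego r) t /\ 0 < t /\
    (/ 8) ^ n * Rpower (1 - x) (- (theta * INR n)) <= t.
Proof.
  intros Ht Hx. destruct (lens_real theta Ht x Hx) as (r & E & Hr & Hb).
  destruct (szego_sqsum n r Hr) as (t & Hs & Hl). exists r, t.
  assert (H1 : 0 < 1 - r * r) by nra.
  assert (0 < (/ (2 * (1 - r * r))) ^ n) by (apply pow_lt, Rinv_pos; lra).
  repeat split; auto; try lra.
  eapply Rle_trans; [|exact Hl].
  pose proof (Rpower_pos (1 - x) theta).
  assert (E2 : Rpower (1 - x) (- (theta * INR n)) = (/ Rpower (1 - x) theta) ^ n).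
  { rewrite Rpower_Ropp, <- Rpower_mult, Rpower_pow, pow_inv by auto. auto. }
  rewrite E2, <- Rpow_mult_distr, <- Rinv_mult. apply pow_incr; split.
  - left; apply Rinv_pos; lra.
  - apply Rinv_le_contravar; lra.
Qed.

(** For the kernel of squared norm t, the image takes the value t at the axis point, so t^2 <= M^2 t
    / (1-x), that is t (1-x) <= M^2. But t is at least of order (1-x)^(-theta N) with theta N >
    1. *)
Lemma composition_unbounded theta n : 0 < theta < 1 -> 1 < theta * INR (S n) ->
  ~ CPhi_bounded (S n) (Phi_lens theta).
Proof.
  intros Ht Hexp [Hex (M & HM0 & HM)].
  (* Solving y^(-e) = A for y = 1 - x makes the lower bound 8^(-N) A, which exceeds M^2; A >= 2
     guarantees y < 1. *)
  set (A := 8 ^ S n * (M * M) + 2). set (e := theta * INR (S n) - 1).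
  assert (HA : 2 <= A) by (unfold A; pose proof (pow_le 8 (S n) ltac:(lra)); nra).
  set (y := Rpower A (- / e)).
  assert (He : 0 < e) by (unfold e; lra). assert (0 < / e) by (apply Rinv_pos; auto).
  assert (Hy : 0 < y < 1).
  { split; [apply Rpower_pos|]. unfold y. rewrite <- (Rpower_O A) by lra. apply Rpower_lt; lra. }
  assert (Ey : Rpower y (- e) = A).
  { unfold y. rewrite Rpower_mult. replace (- / e * - e) with 1 by (field; lra). apply Rpower_1; lra. }
  set (x := 1 - y).
  destruct (szego_lens theta (S n) x Ht ltac:(unfold x; lra)) as (r & t & El & Hr & Hs & Ht0 & Hlow).
  replace (1 - x) with y in Hlow by (unfold x; ring).
  assert (Hl2 : l2 (S n) (szego r)) by (exists t; auto).
  destruct (Hex (szego r) Hl2) as (b & [s Hb] & Hc).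
  assert (Hst : s <= M * M * t) by (apply (HM (szego r) b); auto; exists s; auto).
  destruct (Hc (axis_point x)) as (v & Hv1 & Hv2); [apply axis_point_inD; unfold x; lra|].
  assert (Hv : v = RtoC t).
  { apply (Ccv_unique _ _ _ Hv2). unfold Phi_lens; cbn [axis_point]. rewrite El. apply szego_at_diag; auto. }
  assert (Hvs : Cnorm2 v <= s / (1 - x)).
  { apply (Cnorm2_limit_le _ _ _ Hv1). exists 0%nat; intros m _. apply partial_eval_le; auto. unfold x; lra. }
  rewrite Hv, Cnorm2_RtoC in Hvs. replace (1 - x) with y in Hvs by (unfold x; ring).
  assert (Hty : t * y <= M * M).
  { apply Rmult_le_reg_l with t; auto.
    apply Rmult_le_compat_r with (r := y) in Hvs; [|lra].
    replace (s / y * y) with s in Hvs by (field; lra). lra. }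
  assert (E8 : (/ 8) ^ S n * Rpower y (- (theta * INR (S n))) * y = (/ 8) ^ S n * A).
  { rewrite <- Ey. rewrite Rmult_assoc. rewrite <- (Rpower_1 y) at 2 by lra. rewrite <- Rpower_plus.
    do 2 f_equal. unfold e; ring. }
  assert (P8 : (/ 8) ^ S n * 8 ^ S n = 1).
  { rewrite <- Rpow_mult_distr, Rinv_l, pow1; lra. }
  assert (0 < (/ 8) ^ S n) by (apply pow_lt; lra).
  assert ((/ 8) ^ S n * A <= M * M).
  { rewrite <- E8. eapply Rle_trans; [apply Rmult_le_compat_r; [lra|exact Hlow]|lra]. }
  unfold A in H1. rewrite Rmult_plus_distr_l, <- Rmult_assoc, P8 in H1. lra.
Qed.

(** Evaluation at 1 - y on the axis has squared norm of order 1/y. On a finite part of [c] it stays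
    bounded and the rest of [c] has small norm, so a fixed function takes values of square
    o(1/y). *)
Lemma eval_little_o n c eps : l2 (S n) c -> 0 < eps ->
  exists y0, 0 < y0 < 1 /\ forall y, 0 < y <= y0 -> exists M, forall m, (M <= m)%nat ->
    Cnorm2 (Csum (map (fun al => Cmul (c al) (mono (axis_point (1 - y)) al)) (box (S n) m))) <= eps / y.
Proof.
  intros [s Hs] He. destruct (Hs (eps / 4)) as [M HM]; [lra|].
  specialize (HM M ltac:(lia)). unfold R_dist in HM. rewrite Rabs_minus_sym in HM.
  set (sM := Rsum (map (fun al => Cnorm2 (c al)) (box (S n) M))) in *.
  assert (HsM : s - sM <= eps / 4) by (pose proof (Rle_abs (s - sM)); lra).
  set (B := Rsum (map (fun al => Cnorm2 (c al)) (box (S n) M)) * INR (length (box (S n) M)) + 1).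
  assert (HsM0 : 0 <= sM) by (apply Rsum_nonneg; intros; apply Cnorm2_nonneg).
  assert (HB : 1 <= B) by (unfold B; fold sM; pose proof (pos_INR (length (box (S n) M))); nra).
  exists (Rmin (/ 2) (eps / (4 * B))). split.
  { split; [apply Rmin_glb_lt; [lra|apply Rdiv_lt_0_compat; lra]|].
    eapply Rle_lt_trans; [apply Rmin_l|lra]. }
  intros y [Hy0 Hy]. pose proof (Rmin_l (/ 2) (eps / (4 * B))); pose proof (Rmin_r (/ 2) (eps / (4 * B))).
  exists M; intros m Hm.
  set (F := fun al => Cmul (c al) (mono (axis_point (1 - y)) al)).
  assert (Hmono : forall al, Cnorm2 (mono (axis_point (1 - y)) al) <= 1).
  { intros al. apply Rle_trans with (1 * 1); [|lra]. apply Cmod_le_iff; [lra|].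
    apply Rle_trans with (1 ^ list_sum al); [|rewrite pow1; lra]. apply mono_from_le; [lra|].
    intros [|j] _; simpl; [rewrite Cmod_RtoC, Rabs_pos_eq; lra|rewrite Cmod_C0; lra]. }
  destruct (incl_complement (box (S n) M) (box (S n) m)) as [k Hk]; auto using NoDup_box, incl_box.
  rewrite (Csum_perm _ _ (Permutation_map F Hk)), map_app, Csum_app.
  eapply Rle_trans; [apply Cnorm2_add_le|].
  assert (H1 : Cnorm2 (Csum (map F (box (S n) M))) <= B).
  { eapply Rle_trans; [apply Cnorm2_Csum_mul_le|]. fold sM.
    assert (Rsum (map (fun al => Cnorm2 (mono (axis_point (1 - y)) al)) (box (S n) M)) <= INR (length (box (S n) M))).
    { rewrite <- (Rmult_1_r (INR _)), <- Rsum_const. apply Rsum_le; intros; apply Hmono. }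
    unfold B; fold sM. nra. }
  assert (H2 : Cnorm2 (Csum (map F k)) <= eps / 4 / y).
  { eapply Rle_trans; [apply Cnorm2_Csum_mul_le|].
    apply Rmult_le_compat; try (apply Rsum_nonneg; intros; apply Cnorm2_nonneg).
    - pose proof (sqsum_ge _ _ _ m Hs) as G.
      rewrite (Rsum_perm _ _ (Permutation_map (fun al => Cnorm2 (c al)) Hk)), map_app, Rsum_app in G.
      fold sM in G. lra.
    - pose proof (mono_axis_sum n m (1 - y) ltac:(lra)) as G.
      rewrite (Rsum_perm _ _ (Permutation_map (fun al => Cnorm2 (mono (axis_point (1 - y)) al)) Hk)), map_app, Rsum_app in G.
      replace (1 - (1 - y)) with y in G by ring.
      pose proof (Rsum_nonneg (fun al => Cnorm2 (mono (axis_point (1 - y)) al)) (box (S n) M) (fun _ _ => Cnorm2_nonneg _)). lra. }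
  assert (H3 : B <= eps / 4 / y).
  { apply Rmult_le_reg_r with y; auto. unfold Rdiv at 1. rewrite (Rmult_assoc (eps / 4)), Rinv_l by lra.
    apply Rle_trans with (B * (eps / (4 * B))); [apply Rmult_le_compat_l; lra|right; field; lra]. }
  unfold Rdiv in *. lra.
Qed.

Lemma series_scal N a p v k : series_at N a p v -> series_at N (fun al => Cmul k (a al)) p (Cmul k v).
Proof.
  intros H. eapply Ccv_ext; [|apply (Ccv_scal k _ _ H)].
  exists 0%nat; intros m _. rewrite <- Csum_scal. apply Csum_ext; intros; ring.
Qed.

(** Images of normalised Szego kernels take values of square at least 8^(-N)/y at the axis points 1
    - y, y = 1/(k+2). A norm limit of a subsequence would have values o(1/y) there, and the norm
    error adds only a small multiple of 1/y. *)
Lemma composition_not_compact theta n : 0 < theta < 1 -> theta * INR (S n) = 1 ->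
  ~ CPhi_compact (S n) (Phi_lens theta).
Proof.
  intros Ht Hexp [[Hex _] Hcomp].
  set (xs := fun k => 1 - / INR (k + 2)).
  assert (Hxs : forall k, 0 < / INR (k + 2) < 1).
  { intros k. rewrite plus_INR. simpl (INR 2). pose proof (pos_INR k).
    split; [apply Rinv_pos; lra|]. rewrite <- Rinv_1. apply Rinv_lt_contravar; lra. }
  assert (Hk : forall k, exists ab : family * family, exists v,
     l2 (S n) (fst ab) /\ (forall s, sqsum (S n) (fst ab) s -> s <= 1) /\ l2 (S n) (snd ab) /\
     comp_rel (S n) (Phi_lens theta) (fst ab) (snd ab) /\
     series_at (S n) (snd ab) (axis_point (xs k)) v /\
     (/ 8) ^ S n / (/ INR (k + 2)) <= Cnorm2 v).
  { intros k. specialize (Hxs k).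
    destruct (szego_lens theta (S n) (xs k) Ht ltac:(unfold xs; lra)) as (r & t & El & Hr & Hs & Ht0 & Hlow).
    set (a := fun al => Cmul (RtoC (/ sqrt t)) (szego r al)).
    assert (Hst : 0 < sqrt t) by (apply sqrt_lt_R0; auto).
    assert (Ha : forall m, Rsum (map (fun al => Cnorm2 (a al)) (box (S n) m)) <= 1).
    { intros m. unfold a. rewrite (Rsum_ext _ (fun al => / t * Cnorm2 (szego r al))).
      - rewrite Rsum_scal. pose proof (sqsum_ge _ _ _ m Hs) as G.
        assert (0 < / t) by (apply Rinv_pos; auto).
        apply Rle_trans with (/ t * t); [apply Rmult_le_compat_l; lra|rewrite Rinv_l; lra].
      - intros al _. rewrite Cnorm2_mul, Cnorm2_RtoC, <- Rinv_mult, sqrt_sqrt by lra. auto. }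
    assert (Hal : l2 (S n) a) by (apply (l2_of_bound _ _ 1); auto).
    destruct (Hex a Hal) as (b & Hb & Hc).
    destruct (Hc (axis_point (xs k))) as (v & Hv1 & Hv2); [apply axis_point_inD; unfold xs; lra|].
    exists (a, b), v; cbn [fst snd]. repeat split; auto.
    - intros s Hss. apply (sqsum_le _ _ _ 1 Hss); auto.
    - assert (Hv : v = Cmul (RtoC (/ sqrt t)) (RtoC t)).
      { apply (Ccv_unique _ _ _ Hv2). unfold Phi_lens; cbn [axis_point]. rewrite El.
        apply series_scal, szego_at_diag; auto. }
      rewrite Hv, Cnorm2_mul, !Cnorm2_RtoC.
      replace (/ sqrt t * / sqrt t * (t * t)) with t.
      + eapply Rle_trans; [|exact Hlow]. rewrite Hexp. unfold xs.
        replace (1 - (1 - / INR (k + 2))) with (/ INR (k + 2)) by ring.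
        rewrite Rpower_Ropp, Rpower_1 by lra. unfold Rdiv; lra.
      + rewrite <- Rinv_mult, sqrt_sqrt by lra. field; lra. }
  destruct (fun_choice _ Hk) as [ab Hab]; clear Hk.
  destruct (Hcomp (fun k => fst (ab k)) (fun k => snd (ab k))) as (phi & Hphi & c & Hc & Hlim).
  { intros k; destruct (Hab k) as (v & H1 & H2 & H3 & H4 & _); auto. }
  set (q := (/ 8) ^ S n) in *. assert (Hq : 0 < q) by (apply pow_lt; lra).
  (* Two contributions of q/8, each doubled by the splitting of the square, make q/2, below the
     required q. *)
  destruct (eval_little_o n c (q / 8) Hc ltac:(lra)) as (y0 & Hy0 & Hcy).
  destruct (Hlim (q / 8) ltac:(lra)) as [K HK].
  destruct (inv_INR_small y0 ltac:(lra)) as [k1 Hk1].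
  set (k := (K + k1)%nat). specialize (HK k ltac:(unfold k; lia)).
  assert (Hpk : (k <= phi k)%nat) by (clear -Hphi; induction k; [lia|specialize (Hphi k); lia]).
  set (y := / INR (phi k + 2)) in *.
  assert (Hy : 0 < y <= y0).
  { split; [apply Hxs|]. specialize (Hk1 (S (phi k)) ltac:(unfold k in *; lia)).
    unfold y. rewrite Nat.add_comm. exact Hk1. }
  destruct (Hcy y Hy) as [M HM].
  destruct (Hab (phi k)) as (v & _ & _ & Hb & _ & Hv & Hlow).
  fold y in Hlow. assert (Ex : xs (phi k) = 1 - y) by reflexivity. rewrite Ex in Hv.
  destruct (l2_sub _ _ _ Hb Hc) as [s Hs]. specialize (HK s Hs).
  assert (Hup : Cnorm2 v <= 2 * (q / 8 / y) + 2 * (q / 8 / y)).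
  { apply (Cnorm2_limit_le _ _ _ Hv). exists M; intros m Hm. specialize (HM m Hm).
    set (bb := snd (ab (phi k))) in *.
    rewrite (Csum_ext _ (fun al => Cadd (Cmul (fsub bb c al) (mono (axis_point (1 - y)) al))
       (Cmul (c al) (mono (axis_point (1 - y)) al)))) by (intros; unfold fsub; ring).
    rewrite Csum_add. eapply Rle_trans; [apply Cnorm2_add_le|].
    apply Rplus_le_compat; apply Rmult_le_compat_l; try lra.
    eapply Rle_trans; [apply (partial_eval_le n m (1 - y) (fsub bb c) s); auto; lra|].
    replace (1 - (1 - y)) with y by ring. apply Rmult_le_compat_r; [left; apply Rinv_pos; lra|lra]. }
  assert (0 < q / y) by (apply Rdiv_lt_0_compat; lra).
  unfold Rdiv in *. lra.
Qed.

(** * Compactness *)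

Lemma incr_ge (phi : nat -> nat) : (forall k, (phi k < phi (S k))%nat) -> forall k, (k <= phi k)%nat.
Proof. intros H k; induction k; [lia|specialize (H k); lia]. Qed.

Lemma incr_comp (phi psi : nat -> nat) : (forall k, (phi k < phi (S k))%nat) ->
  (forall k, (psi k < psi (S k))%nat) -> forall k, (phi (psi k) < phi (psi (S k)))%nat.
Proof.
  intros Hp Hs k. specialize (Hs k). induction Hs; [apply Hp|specialize (Hp m); lia].
Qed.

Lemma real_subsequence (u : nat -> R) : (forall n, Rabs (u n) <= 1) ->
  exists phi, (forall k, (phi k < phi (S k))%nat) /\ exists l, Un_cv (fun k => u (phi k)) l.
Proof.
  intros Hu.
  destruct (Bolzano_Weierstrass u (fun x => -1 <= x <= 1) (compact_P3 (-1) 1)) as [l Hl].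
  { intros n; apply Rabs_le_between, Hu. }
  assert (Hs : forall k p, exists q, (p < q)%nat /\ Rabs (u q - l) < / INR (S k)).
  { intros k p. assert (Hp : 0 < / INR (S k)) by (apply Rinv_pos, lt_0_INR; lia).
    destruct (Hl (disc l (mkposreal _ Hp)) (S p)) as (q & Hq & HV).
    { exists (mkposreal _ Hp). intros x Hx; exact Hx. }
    exists q; split; [lia|exact HV]. }
  destruct (fun_choice (fun kp q => (snd kp < q)%nat /\ Rabs (u q - l) < / INR (S (fst kp)))
    (fun kp => Hs (fst kp) (snd kp))) as [f0 Hf0].
  set (f := fun k p => f0 (k, p)).
  assert (Hf : forall k p, (p < f k p)%nat /\ Rabs (u (f k p) - l) < / INR (S k)) by (intros k p; apply (Hf0 (k, p))).
  set (phi := fix phi k := match k with O => f O O | S j => f (S j) (phi j) end).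
  exists phi; split; [intros k; apply Hf|]. exists l. intros eps He.
  destruct (inv_INR_small (eps / 2)) as [K HK]; [lra|]. exists K; intros k Hk. unfold R_dist.
  assert (H : Rabs (u (phi k) - l) < / INR (S k)) by (destruct k; apply Hf).
  specialize (HK k Hk); lra.
Qed.

Lemma Ccv_subsequence u l (tau : nat -> nat) : Ccv u l ->
  (exists M, forall k, (M <= k)%nat -> (k <= tau k)%nat) -> Ccv (fun k => u (tau k)) l.
Proof.
  rewrite !Ccv_eps. intros H [M0 Ht] eps He. destruct (H eps He) as [M HM].
  exists (M + M0)%nat; intros k Hk. apply HM. specialize (Ht k ltac:(lia)). lia.
Qed.

Lemma complex_subsequence (u : nat -> C) : (forall n, Cmod (u n) <= 1) ->
  exists phi, (forall k, (phi k < phi (S k))%nat) /\ exists l, Ccv (fun k => u (phi k)) l.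
Proof.
  intros Hu.
  destruct (real_subsequence (fun k => fst (u k))) as (phi & Hphi & x & Hx).
  { intros n; eapply Rle_trans; [apply Cmod_fst|auto]. }
  destruct (real_subsequence (fun k => snd (u (phi k)))) as (psi & Hpsi & y & Hy).
  { intros n; eapply Rle_trans; [apply Cmod_snd|auto]. }
  exists (fun k => phi (psi k)); split; [apply incr_comp; auto|]. exists (x, y).
  apply Ccv_eps; intros eps He.
  destruct (Hx (eps / 2) ltac:(lra)) as [M HM], (Hy (eps / 2) ltac:(lra)) as [M' HM'].
  exists (M + M')%nat; intros k Hk. pose proof (incr_ge psi Hpsi k).
  specialize (HM (psi k) ltac:(lia)); specialize (HM' k ltac:(lia)). unfold R_dist in *.
  eapply Rle_trans; [apply Cmod_le_abs|]. simpl. unfold Rminus in *; lra.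
Qed.

Lemma list_subsequence {T} (u : nat -> T -> C) (l : list T) :
  (forall n x, In x l -> Cmod (u n x) <= 1) ->
  exists phi, (forall k, (phi k < phi (S k))%nat) /\
    forall x, In x l -> exists v, Ccv (fun k => u (phi k) x) v.
Proof.
  induction l as [|x l IH]; intros Hu.
  - exists (fun k => k); split; [lia|intros x []].
  - destruct IH as (phi & Hphi & H); [intros; apply Hu; simpl; auto|].
    destruct (complex_subsequence (fun k => u (phi k) x)) as (psi & Hpsi & v & Hv).
    { intros; apply Hu; simpl; auto. }
    exists (fun k => phi (psi k)); split; [apply incr_comp; auto|].
    intros y [<-|Hy]; [eauto|]. destruct (H y Hy) as [w Hw]. exists w.
    apply (Ccv_subsequence (fun k => u (phi k) y) w psi); auto.
    exists 0%nat; intros; apply incr_ge; auto.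
Qed.

Lemma diagonal_subsequence {T} (u : nat -> T -> C) (Ls : nat -> list T) :
  (forall n m x, In x (Ls m) -> Cmod (u n x) <= 1) ->
  exists phi, (forall k, (phi k < phi (S k))%nat) /\
    forall m x, In x (Ls m) -> exists v, Ccv (fun k => u (phi k) x) v.
Proof.
  intros Hu.
  assert (Hs : forall (m : nat) (psi : nat -> nat), exists s : nat -> nat,
     (forall k, (s k < s (S k))%nat) /\ forall x, In x (Ls m) -> exists v, Ccv (fun k => u (psi (s k)) x) v).
  { intros m psi. apply (list_subsequence (fun k => u (psi k))). intros; eapply Hu; eauto. }
  destruct (fun_choice _ (fun mp => Hs (fst mp) (snd mp))) as [s0 Hs0].
  set (s := fun m psi => s0 (m, psi)).
  assert (Hsp : forall m psi, (forall k, (s m psi k < s m psi (S k))%nat) /\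
     forall x, In x (Ls m) -> exists v, Ccv (fun k => u (psi (s m psi k)) x) v)
    by (intros m psi; apply (Hs0 (m, psi))).
  set (Psi := fix Psi m := match m with O => fun k : nat => k | S j => fun k => Psi j (s j (Psi j) k) end).
  assert (Hinc : forall m k, (Psi m k < Psi m (S k))%nat).
  { induction m; intros k; [simpl; lia|]. simpl. apply (incr_comp (Psi m)); auto. apply Hsp. }
  assert (Hfac : forall m d, exists rho : nat -> nat, (forall k, (rho k < rho (S k))%nat) /\
     forall k, Psi (m + d)%nat k = Psi m (rho k)).
  { intros m d; induction d as [|d (rho & Hr & E)].
    - exists (fun k => k); split; [lia|]. rewrite Nat.add_0_r; auto.
    - exists (fun k => rho (s (m + d)%nat (Psi (m + d)%nat) k)); split.
      + apply incr_comp; auto. apply Hsp.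
      + intros k. rewrite Nat.add_succ_r. simpl. apply E. }
  (* [Psi (S m)] is the first refinement along which [Ls m] converges; from k >= m on the diagonal
     runs inside it. *)
  exists (fun k => Psi (S k) k); split.
  - intros k. change (Psi (S (S k)) (S k)) with (Psi (S k) (s (S k) (Psi (S k)) (S k))).
    destruct (Hsp (S k) (Psi (S k))) as [Hi _]. pose proof (incr_ge _ Hi (S k)).
    assert (Hmono : forall a b, (a < b)%nat -> (Psi (S k) a < Psi (S k) b)%nat).
    { intros a b Hab; induction Hab; [apply Hinc|specialize (Hinc (S k) m); lia]. }
    apply Hmono; lia.
  - intros m x Hx. destruct (Hsp m (Psi m)) as [_ Hc]. destruct (Hc x Hx) as [v Hv]. exists v.
    assert (Ht : forall k, exists q, (m <= k)%nat -> (k <= q)%nat /\ Psi (S k) k = Psi (S m) q).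
    { intros k. destruct (Compare_dec.le_lt_dec m k); [|exists 0%nat; lia].
      destruct (Hfac (S m) (k - m)%nat) as (rho & Hr & E). exists (rho k); intros _. split.
      - apply incr_ge; auto.
      - rewrite <- E. f_equal. lia. }
    destruct (fun_choice _ Ht) as [tau Htau].
    apply (Ccv_ext (fun k => u (Psi (S m) (tau k)) x)).
    + exists m; intros k Hk. destruct (Htau k Hk) as [_ ->]; auto.
    + apply (Ccv_subsequence (fun k => u (Psi (S m) k) x)); auto.
      exists m; intros k Hk; apply Htau; auto.
Qed.

Lemma Rsum_filter {T} (f : T -> R) (p : T -> bool) l :
  Rsum (map (fun x => if p x then f x else 0) l) = Rsum (map f (filter p l)).
Proof. induction l; simpl; [auto|]. destruct (p a); simpl; rewrite IHl; ring. Qed.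

Lemma Rsum_box_low (f : list nat -> R) N K m : (forall al, 0 <= f al) ->
  Rsum (map (fun al => if Nat.ltb (list_sum al) K then f al else 0) (box N m))
  <= Rsum (map f (box N K)).
Proof.
  intros Hf. rewrite Rsum_filter. apply Rsum_incl; auto using NoDup_filter, NoDup_box.
  intros al Hal; apply filter_In in Hal as [H1 H2]. apply Nat.ltb_lt in H2.
  apply In_box in H1 as [H1 _]. apply In_box_of_deg; auto.
Qed.

Lemma decay_small d eps : 0 < d -> 0 < eps -> exists K, decay d K <= eps.
Proof.
  intros Hd He. set (x := Rpower eps (/ d)). assert (Hx : 0 < x) by apply Rpower_pos.
  destruct (inv_INR_small x Hx) as [K HK]. exists K.
  apply Rle_trans with (Rpower x d).
  - apply Rle_Rpower_l; [lra|]. split; [apply Rinv_pos, lt_0_INR; lia|apply HK; lia].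
  - unfold x. rewrite Rpower_mult, Rinv_l, Rpower_1 by lra. lra.
Qed.

Lemma comp_rel_sub N Phi a a' b b' : comp_rel N Phi a b -> comp_rel N Phi a' b' ->
  comp_rel N Phi (fsub a a') (fsub b b').
Proof.
  intros H H' p Hp. destruct (H p Hp) as (v & H1 & H2), (H' p Hp) as (v' & H1' & H2').
  exists (Csub v v'); split; apply series_sub; auto.
Qed.

Lemma finite_uniform {T} (u : nat -> T -> C) v (l : list T) eps :
  (forall x, In x l -> Ccv (fun k => u k x) (v x)) -> 0 < eps ->
  exists K, forall k, (K <= k)%nat -> Rsum (map (fun x => Cnorm2 (Csub (u k x) (v x))) l) <= eps.
Proof.
  revert eps; induction l as [|x l IH]; intros eps H He; [exists 0%nat; intros; simpl; lra|].
  destruct (IH (eps / 2)) as [K HK]; [intros; apply H; simpl; auto|lra|].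
  pose proof (H x (or_introl eq_refl)) as Hx. rewrite Ccv_eps in Hx.
  destruct (Hx (sqrt (eps / 2))) as [K' HK']; [apply sqrt_lt_R0; lra|].
  exists (K + K')%nat; intros k Hk. specialize (HK k ltac:(lia)); specialize (HK' k ltac:(lia)).
  apply Cmod_le_iff in HK'; [|apply sqrt_pos]. rewrite sqrt_sqrt in HK' by lra. simpl; lra.
Qed.

(** Along a subsequence all coefficients converge, and the candidate limit is the image of the limit
    family. Low degrees are finitely many coefficients, and high degrees are damped by the weight in
    the norm estimate. *)
Lemma composition_compact theta n delta : 0 < theta < 1 -> 0 < delta <= 1 ->
  theta * INR (S (S n)) + theta * delta <= 1 -> CPhi_compact (S (S n)) (Phi_lens theta).
Proof.
  intros Ht Hd Hexp. assert (Hexp' : theta * INR (S (S n)) <= 1) by nra.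
  split; [apply composition_bounded; auto|].
  set (N := S (S n)) in *. intros a b Hab.
  assert (Ha1 : forall k m, Rsum (map (fun al => Cnorm2 (a k al)) (box N m)) <= 1).
  { intros k m. destruct (Hab k) as ([s Hs] & H1 & _). eapply Rle_trans; [eapply sqsum_ge; eauto|auto]. }
  assert (Hpt : forall k m al, In al (box N m) -> Cmod (a k al) <= 1).
  { intros k m al Hal. apply Cmod_le_iff; [lra|]. rewrite Rmult_1_l.
    eapply Rle_trans; [|apply (Ha1 k m)].
    apply Rle_trans with (Rsum (map (fun al => Cnorm2 (a k al)) [al])); [simpl; lra|].
    apply Rsum_incl; [repeat constructor; auto|apply NoDup_box| |intros; apply Cnorm2_nonneg].
    intros y [<-|[]]; auto. }
  destruct (diagonal_subsequence a (box N) Hpt) as (phi & Hphi & Hlim).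
  exists phi; split; auto.
  (* Lists of the wrong length lie in no box and receive the default [C0]. *)
  assert (Hv : forall al, exists v, forall m, In al (box N m) -> Ccv (fun k => a (phi k) al) v).
  { intros al. destruct (Nat.eq_dec (length al) N) as [E|E].
    - destruct (Hlim (S (list_sum al)) al) as [v Hv]; [apply In_box_of_deg; auto; lia|eauto].
    - exists C0; intros m Hm; apply In_box in Hm; tauto. }
  destruct (fun_choice _ Hv) as [a0 Hv0].
  assert (Ha0 : forall m al, In al (box N m) -> Ccv (fun k => a (phi k) al) (a0 al)) by (intros m al; apply Hv0).
  assert (Hb0 : forall m, Rsum (map (fun al => Cnorm2 (a0 al)) (box N m)) <= 4).
  { intros m. destruct (finite_uniform (fun k => a (phi k)) a0 (box N m) 1 (Ha0 m) ltac:(lra)) as [K HK].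
    specialize (HK K (le_n K)). specialize (Ha1 (phi K) m).
    apply Rle_trans with (Rsum (map (fun al => 2 * Cnorm2 (a (phi K) al) + 2 * Cnorm2 (Csub (a (phi K) al) (a0 al))) (box N m))).
    - apply Rsum_le; intros al _.
      replace (a0 al) with (Csub (a (phi K) al) (Csub (a (phi K) al) (a0 al))) at 1 by ring.
      apply Cnorm2_sub_le.
    - rewrite Rsum_plus, !Rsum_scal. lra. }
  assert (Hl0 : l2 N a0) by (apply (l2_of_bound _ _ 4); auto).
  destruct (composition_exists theta n a0 Ht Hexp' Hl0) as (c & Hc & Hrel). fold N in Hc, Hrel.
  exists c; split; auto. intros eps He.
  destruct (composition_norm theta n delta Ht ltac:(lra) Hexp) as (Q & HQ & Hnorm). fold N in Hnorm.
  (* Low and high degrees contribute [e] each. The difference has squared norm at most 2 * 1 + 2 * 4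
     = 10, hence the accuracy e / 10 for the weight. *)
  set (e := eps / (2 * Q)). assert (Hee : 0 < e) by (unfold e; apply Rdiv_lt_0_compat; lra).
  destruct (decay_small delta (e / 10)) as [K0 HK0]; [lra|lra|].
  destruct (finite_uniform (fun k => a (phi k)) a0 (box N K0) e (Ha0 K0) Hee) as [K HK].
  exists K; intros k Hk s Hs. destruct (Hab (phi k)) as (A1 & _ & A2 & A3).
  set (d := fsub (a (phi k)) a0).
  assert (Hd10 : forall m, Rsum (map (fun al => Cnorm2 (d al)) (box N m)) <= 10).
  { intros m. eapply Rle_trans; [apply Rsum_le; intros al _; apply Cnorm2_sub_le|].
    rewrite Rsum_plus, !Rsum_scal. specialize (Ha1 (phi k) m); specialize (Hb0 m). lra. }
  apply (sqsum_le _ _ _ eps Hs). replace eps with (Q * (2 * e)) by (unfold e; field; lra).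
  apply (Hnorm d); [apply l2_asum, l2_sub; auto|apply l2_asum, l2_sub; auto|apply comp_rel_sub; auto|].
  intros m.
  apply Rle_trans with (Rsum (map (fun al => (if Nat.ltb (list_sum al) K0 then Cnorm2 (d al) else 0)
     + e / 10 * Cnorm2 (d al)) (box N m))).
  - apply Rsum_le; intros al _. pose proof (Cnorm2_nonneg (d al)).
    pose proof (decay_pos delta (list_sum al)).
    destruct (Nat.ltb_spec (list_sum al) K0).
    + pose proof (decay_le_1 delta (list_sum al) ltac:(lra)). nra.
    + pose proof (decay_anti delta K0 (list_sum al) ltac:(lra) ltac:(lia)). nra.
  - rewrite Rsum_plus, Rsum_scal.
    pose proof (Rsum_box_low (fun al => Cnorm2 (d al)) N K0 m (fun al => Cnorm2_nonneg _)) as L.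
    specialize (HK k Hk). specialize (Hd10 m).
    assert (E : Rsum (map (fun al => Cnorm2 (d al)) (box N K0)) <= e) by exact HK.
    assert (e / 10 * Rsum (map (fun al => Cnorm2 (d al)) (box N m)) <= e / 10 * 10)
      by (apply Rmult_le_compat_l; lra).
    lra.
Qed.

(** * Approximation numbers *)

Fixpoint bin (n k : nat) : R :=
  match k, n with
  | O, _ => 1
  | S _, O => 0
  | S k', S n' => bin n' k + bin n' k'
  end.

Lemma bin_nonneg n k : 0 <= bin n k.
Proof. revert k; induction n; intros [|k]; simpl; try lra. pose proof (IHn (S k)); pose proof (IHn k); lra. Qed.

Definition taylor (m j : nat) (w : C) : C :=
  Csum (map (fun s => Cmul (RtoC (bin j s)) (Cpow w s)) (seq 0 m)).

Lemma taylor_rec m j w : taylor (S m) (S j) w = Cadd (taylor (S m) j w) (Cmul w (taylor m j w)).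
Proof.
  unfold taylor. induction m as [|m IH].
  - simpl. destruct j; simpl; ring.
  - rewrite Csum_seq_S, IH, (Csum_seq_S _ (S m)), (Csum_seq_S _ m).
    change (bin (S j) (S m)) with (bin j (S m) + bin j m).
    replace (RtoC (bin j (S m) + bin j m)) with (Cadd (RtoC (bin j (S m))) (RtoC (bin j m))) by Cdestr.
    simpl Cpow. ring.
Qed.

(** Induction on j by Pascal's rule: multiplication by 1 + w does not enlarge the previous
    remainder, so the bound is just the modulus of the first omitted term. *)
Lemma taylor_remainder m j w : Cmod (Cadd C1 w) <= 1 ->
  Cmod (Csub (Cpow (Cadd C1 w) j) (taylor m j w)) <= bin j m * Cmod w ^ m.
Proof.
  intros Hw. revert m; induction j as [|j IH]; intros m.
  - destruct m as [|m].
    + unfold taylor; simpl. replace (Csub C1 C0) with C1 by ring. rewrite Cmod_C1; lra.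
    + assert (E : taylor (S m) 0 w = C1).
      { unfold taylor. rewrite (Csum_single _ _ 0%nat).
        - simpl. change (RtoC 1) with C1; ring.
        - apply seq_NoDup.
        - apply in_seq; lia.
        - intros [|s] _ Hs; [congruence|]. simpl. change (RtoC 0) with C0; ring. }
      rewrite E. simpl. replace (Csub C1 C1) with C0 by ring. rewrite Cmod_C0; lra.
  - destruct m as [|m].
    + change (taylor 0 (S j) w) with C0. cbn [bin pow]. rewrite Rmult_1_l.
      replace (Csub (Cpow (Cadd C1 w) (S j)) C0) with (Cpow (Cadd C1 w) (S j)) by ring.
      rewrite Cmod_pow. apply Rle_trans with (1 ^ S j); [|rewrite pow1; lra]. apply pow_incr. split; [apply Cmod_nonneg|auto].
    + rewrite taylor_rec.
      assert (Et : taylor (S m) j w = Cadd (taylor m j w) (Cmul (RtoC (bin j m)) (Cpow w m)))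
        by apply Csum_seq_S.
      replace (Csub (Cpow (Cadd C1 w) (S j)) (Cadd (taylor (S m) j w) (Cmul w (taylor m j w))))
        with (Cadd (Cmul (Cadd C1 w) (Csub (Cpow (Cadd C1 w) j) (taylor (S m) j w)))
                   (Cmul (RtoC (bin j m)) (Cpow w (S m)))).
      2:{ rewrite Et. simpl Cpow. ring. }
      eapply Rle_trans; [apply Cmod_triangle|]. rewrite !Cmod_mul, Cmod_pow, Cmod_RtoC.
      rewrite (Rabs_pos_eq (bin j m)) by apply bin_nonneg.
      change (bin (S j) (S m)) with (bin j (S m) + bin j m).
      specialize (IH (S m)). pose proof (Cmod_nonneg (Csub (Cpow (Cadd C1 w) j) (taylor (S m) j w))).
      pose proof (Cmod_nonneg (Cadd C1 w)). nra.
Qed.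

(** Pascal's rule produces j^(m+1) + (m+1) j^m, the two leading terms of (j+1)^(m+1). *)
Lemma bin_fact_le j m : bin j m * INR (Factorial.fact m) <= INR j ^ m.
Proof.
  assert (Bern : forall j m, INR j ^ S m + INR (S m) * INR j ^ m <= INR (S j) ^ S m).
  { intros k i. rewrite (S_INR k). pose proof (pos_INR k). induction i as [|i IH]; [simpl; lra|].
    rewrite (S_INR (S i)). pose proof (pow_le (INR k) i H). pose proof (pos_INR (S i)).
    simpl pow in *. assert (0 <= INR (S i) * INR k ^ i) by nra. nra. }
  revert m; induction j as [|j IH]; intros [|m]; try (simpl; lra).
  change (bin (S j) (S m)) with (bin j (S m) + bin j m).
  eapply Rle_trans; [|apply (Bern j m)].
  pose proof (IH (S m)) as I1. pose proof (IH m) as I2.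
  change (Factorial.fact (S m)) with (S m * Factorial.fact m)%nat in *. rewrite mult_INR in *. pose proof (pos_INR (S m)). nra.
Qed.

Lemma pow_fact_le_exp x m : 0 <= x -> x ^ m <= INR (Factorial.fact m) * exp x.
Proof.
  intros Hx. pose proof (ElemFct.exp_ge_taylor x m Hx) as H.
  assert (P : 0 < INR (Factorial.fact m)) by (apply INR_fact_lt_0).
  assert (T : x ^ m / INR (Factorial.fact m) <= sum_f_R0 (fun k => x ^ k / INR (Factorial.fact k)) m).
  { destruct m; [simpl; lra|]. rewrite tech5.
    assert (0 <= sum_f_R0 (fun k => x ^ k / INR (Factorial.fact k)) m); [|lra].
    apply cond_pos_sum. intros k; apply Rdiv_le_0_compat; [apply pow_le; auto|apply INR_fact_lt_0]. }
  apply Rmult_le_reg_r with (/ INR (Factorial.fact m)); [apply Rinv_pos; auto|].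
  replace (INR (Factorial.fact m) * exp x * / INR (Factorial.fact m)) with (exp x) by (field; lra).
  unfold Rdiv in T. lra.
Qed.

(* Blocks of exponents of relative length [1/Q]. *)
Fixpoint grid (Q i : nat) : nat :=
  match i with O => O | S i' => grid Q i' + grid Q i' / Q + 1 end.

Lemma grid_block Q I q : (0 < Q)%nat -> (q < grid Q I)%nat ->
  exists i j, (i < I)%nat /\ q = (grid Q i + j)%nat /\ (j * Q <= grid Q i)%nat.
Proof.
  intros HQ. induction I as [|I IH]; simpl; intros H; [lia|].
  destruct (Compare_dec.le_lt_dec (grid Q I) q).
  - exists I, (q - grid Q I)%nat. repeat split; [lia|lia|].
    pose proof (Nat.Div0.mul_div_le (grid Q I) Q).
    assert (q - grid Q I <= grid Q I / Q)%nat by lia. nia.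
  - destruct (IH l) as (i & j & ? & ? & ?). exists i, j; auto.
Qed.

(** Geometric growth of the block ends: I blocks reach degrees exponential in I, which makes the
    neglected high degrees exponentially small. *)
Lemma grid_lower Q I : (0 < Q)%nat -> (1 + / INR Q) ^ I <= INR (S (grid Q I)).
Proof.
  intros HQ. assert (HQ' : 0 < INR Q) by (apply lt_0_INR; auto).
  assert (0 < / INR Q) by (apply Rinv_pos; auto).
  induction I as [|I IH]; [simpl; lra|].
  cbn [pow]. set (g := grid Q I) in *.
  assert (E : INR (S (grid Q (S I))) = INR (S g) + INR (S (g / Q))).
  { rewrite <- plus_INR. f_equal. cbn [grid]. fold g. lia. }
  rewrite E.
  assert (D : INR (S g) <= INR Q * INR (S (g / Q))).
  { rewrite <- mult_INR. apply le_INR. pose proof (Nat.mul_succ_div_gt g Q ltac:(lia)). lia. }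
  assert (/ INR Q * INR (S g) <= INR (S (g / Q))).
  { apply Rmult_le_reg_l with (INR Q); auto. rewrite <- Rmult_assoc, Rinv_r by lra. lra. }
  nra.
Qed.

(** Limits the number of multi-indices below the cut-off, which multiplies the Taylor error. *)
Lemma grid_upper Q I : (0 < Q)%nat -> (S (grid Q I) <= 2 ^ I)%nat.
Proof.
  intros HQ. induction I as [|I IH]; [simpl; lia|]. cbn [grid]. simpl Nat.pow.
  pose proof (Nat.Div0.div_le_upper_bound (grid Q I) Q (grid Q I) ltac:(nia)). lia.
Qed.

(* Since [|mu| <= 1 - kap |1 - mu|], the Taylor remainder is at most [exp(-X) X^m / m! 2^-m] with [X = kap g |1 - mu|]. *)
Lemma block_approx la kap g j e m : 0 < kap <= 1 ->
  kap * Cmod (Csub C1 (Cmul la la)) <= 1 - Cnorm2 la ->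
  2 * INR j <= kap * INR g ->
  Cmod (Csub (Cpow la (2 * (g + j) + e))
     (Cmul (Cpow la (2 * g + e)) (taylor m j (Csub (Cmul la la) C1)))) <= (/ 2) ^ m.
Proof.
  intros Hk Hla Hj. set (mu := Cmul la la) in *. set (y := Cmod (Csub C1 mu)) in *.
  assert (Hmu : Cmod mu = Cnorm2 la) by (unfold mu; rewrite Cmod_mul, Cmod_sqr; auto).
  assert (Hy : 0 <= y) by apply Cmod_nonneg.
  assert (Hla1 : Cmod la <= 1).
  { apply Cmod_le_iff; [lra|]. nra. }
  assert (E : Cadd C1 (Csub mu C1) = mu) by ring.
  (* The lens bound controls 1 - la^2, which is small near both singular points, so the expansion is
     in the square; [e] takes care of parity. *)
  assert (Hp : forall i, Cpow la (2 * i) = Cpow mu i).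
  { intros i. rewrite Cpow_mult. f_equal. unfold mu; simpl; ring. }
  replace (Csub (Cpow la (2 * (g + j) + e)) (Cmul (Cpow la (2 * g + e)) (taylor m j (Csub mu C1))))
    with (Cmul (Cpow la e) (Cmul (Cpow mu g) (Csub (Cpow (Cadd C1 (Csub mu C1)) j) (taylor m j (Csub mu C1))))).
  2:{ rewrite E. rewrite !Cpow_add, !Hp, Cpow_add. ring. }
  rewrite !Cmod_mul, !Cmod_pow.
  pose proof (taylor_remainder m j (Csub mu C1)) as T. rewrite E in T at 1.
  specialize (T ltac:(rewrite Hmu; pose proof (Cmod_nonneg (Csub C1 mu)); nra)).
  rewrite (Cmod_sub_sym mu C1) in T. fold y in T.
  set (rem := Cmod (Csub (Cpow (Cadd C1 (Csub mu C1)) j) (taylor m j (Csub mu C1)))) in *.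
  assert (0 <= rem) by apply Cmod_nonneg.
  set (X := kap * INR g * y). pose proof (pos_INR g) as Hg. pose proof (pos_INR j) as Hj0.
  assert (HX : 0 <= X) by (unfold X; apply Rmult_le_pos; auto; nra).
  assert (B1 : Cmod mu ^ g <= exp (- X)).
  { replace (exp (- X)) with (exp (- (kap * y)) ^ g) by (rewrite exp_pow; f_equal; unfold X; ring).
    apply pow_incr. split; [apply Cmod_nonneg|]. pose proof (exp_ineq1_le (- (kap * y))). lra. }
  assert (B2 : Cmod la ^ e <= 1).
  { apply Rle_trans with (1 ^ e); [|rewrite pow1; lra]. apply pow_incr; split; auto using Cmod_nonneg. }
  assert (F : 0 < INR (Factorial.fact m)) by apply INR_fact_lt_0.
  (* From 2 j <= kap g one gets j y <= X/2: the shortness of the block relative to its start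
     produces the factor 2^-m. *)
  assert (B3 : bin j m * y ^ m * INR (Factorial.fact m) <= (/ 2) ^ m * X ^ m).
  { rewrite <- Rpow_mult_distr. pose proof (bin_fact_le j m). pose proof (pow_le y m Hy).
    apply Rle_trans with (INR j ^ m * y ^ m); [nra|].
    rewrite <- Rpow_mult_distr. apply pow_incr. split; [nra|]. unfold X. nra. }
  pose proof (pow_fact_le_exp X m HX) as B4.
  assert (B5 : bin j m * y ^ m <= (/ 2) ^ m * exp X).
  { apply Rmult_le_reg_r with (INR (Factorial.fact m)); auto.
    pose proof (pow_lt (/ 2) m ltac:(lra)). nra. }
  assert (0 <= Cmod mu ^ g) by (apply pow_le, Cmod_nonneg).
  assert (0 <= Cmod la ^ e) by (apply pow_le, Cmod_nonneg).
  assert (B6 : Cmod mu ^ g * rem <= exp (- X) * ((/ 2) ^ m * exp X))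
    by (apply Rmult_le_compat; auto; lra).
  replace (exp (- X) * ((/ 2) ^ m * exp X)) with ((/ 2) ^ m) in B6.
  - assert (0 <= Cmod mu ^ g * rem) by nra. nra.
  - replace (exp (- X) * ((/ 2) ^ m * exp X)) with ((/ 2) ^ m * (exp (- X) * exp X)) by ring.
    rewrite <- exp_plus, Rplus_opp_l, exp_0; ring.
Qed.

Lemma Csum_list_prod {S T} (f : S * T -> C) l k :
  Csum (map f (list_prod l k)) = Csum (map (fun x => Csum (map (fun y => f (x, y)) k)) l).
Proof.
  induction l; simpl; [auto|]. rewrite map_app, Csum_app, map_map, IHl. auto.
Qed.

Lemma lincomb_map {T} (f : T -> C) (V : T -> family) l al :
  lincomb (map f l) (map V l) al = Csum (map (fun x => Cmul (f x) (V x al)) l).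
Proof.
  unfold lincomb. induction l as [|x l IH]; simpl; [auto|]. rewrite IH; auto.
Qed.

Lemma l2_Csum {T} N (c : T -> C) (V : T -> family) l : (forall x, In x l -> l2 N (V x)) ->
  l2 N (fun al => Csum (map (fun x => Cmul (c x) (V x al)) l)).
Proof.
  induction l as [|x l IH]; intros H.
  - apply (l2_of_bound N _ 0). intros m. simpl. rewrite Rsum_const, Cnorm2_C0; lra.
  - destruct (l2_bound N _ (IH (fun y Hy => H y (or_intror Hy)))) as (B & _ & HB).
    destruct (l2_bound N _ (H x (or_introl eq_refl))) as (B' & _ & HB').
    apply (l2_of_bound N _ (2 * Cnorm2 (c x) * B' + 2 * B)). intros m.
    eapply Rle_trans; [apply Rsum_le; intros al _; apply Cnorm2_add_le|].
    rewrite Rsum_plus, !Rsum_scal.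
    rewrite (Rsum_ext (fun al => Cnorm2 (Cmul (c x) (V x al))) (fun al => Cnorm2 (c x) * Cnorm2 (V x al)))
      by (intros; apply Cnorm2_mul).
    rewrite Rsum_scal. specialize (HB m); specialize (HB' m); cbv beta in HB.
    pose proof (Rmult_le_compat_l _ _ _ (Cnorm2_nonneg (c x)) HB').
    apply Rplus_le_compat; [lra|]. apply Rmult_le_compat_l; [lra|exact HB].
Qed.

Lemma series_Csum {T} N (c : T -> C) (V : T -> family) (w : T -> C) l p :
  (forall x, In x l -> series_at N (V x) p (w x)) ->
  series_at N (fun al => Csum (map (fun x => Cmul (c x) (V x al)) l)) p
    (Csum (map (fun x => Cmul (c x) (w x)) l)).
Proof.
  intros H.
  eapply Ccv_ext; [|apply (Ccv_Csum (fun x m => Cmul (c x) (Csum (map (fun al => Cmul (V x al) (mono p al)) (box N m)))))].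
  - exists 0%nat; intros m _.
    rewrite (Csum_ext _ (fun x => Csum (map (fun al => Cmul (Cmul (c x) (V x al)) (mono p al)) (box N m)))).
    + rewrite Csum_swap. apply Csum_ext; intros al _.
      replace (Cmul (Csum (map (fun x => Cmul (c x) (V x al)) l)) (mono p al))
        with (Cmul (mono p al) (Csum (map (fun x => Cmul (c x) (V x al)) l))) by ring.
      rewrite <- Csum_scal. apply Csum_ext; intros; ring.
    + intros x _. rewrite <- Csum_scal. apply Csum_ext; intros; ring.
  - intros x Hx. apply Ccv_scal, H; auto.
Qed.

(** Supplies the vectors spanning the range of the approximant: for bounded functions the circle
    averages are trivially bounded. *)
Lemma embed_bounded N f S : (1 <= N)%nat -> (forall r, 0 < r < 1 -> inA r f) ->
  (forall z, Cmod z < 1 -> Cnorm2 (f z) <= S) ->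
  exists v, l2 N v /\ forall p, inD N p -> series_at N v p (f (p 0%nat)).
Proof.
  intros HN Hf HS. destruct (embed_series N f HN Hf) as (v & Hv & Hs). exists v; split; auto.
  apply (l2_of_bound N v (4 * S)). apply (sqsum_of_approx N v f S); auto.
  intros r eps Hr He. exists f; split.
  - intros z _. replace (Csub (f z) (f z)) with C0 by ring. rewrite Cmod_C0; lra.
  - intros m Hm. rewrite <- (avg_const (4 * m) S) by lia. apply avg_le; intros l _.
    apply HS. rewrite Cmod_gpt; lra.
Qed.

Lemma Csum_filter {T} (f : T -> C) (p : T -> bool) l : (forall x, p x = false -> f x = C0) ->
  Csum (map f l) = Csum (map f (filter p l)).
Proof.
  intros H; induction l as [|x l IH]; simpl; [auto|]. destruct (p x) eqn:E; simpl; rewrite IH; auto.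
  rewrite (H x E); ring.
Qed.

Lemma Csum_box_low (F : list nat -> C) N K M : (forall al, (K <= list_sum al)%nat -> F al = C0) ->
  (K <= M)%nat -> Csum (map F (box N M)) = Csum (map F (box N K)).
Proof.
  intros HF HM. set (p := fun al => Nat.ltb (list_sum al) K).
  assert (Hp : forall al, p al = false -> F al = C0) by (intros al H; apply HF, Nat.ltb_ge, H).
  rewrite (Csum_filter F p (box N M)), (Csum_filter F p (box N K)) by auto.
  apply Csum_perm, Permutation_map, NoDup_Permutation; auto using NoDup_filter, NoDup_box.
  intros al; rewrite !filter_In. unfold p; rewrite Nat.ltb_lt. split; intros [H1 H2]; split; auto.
  - apply In_box in H1 as [H1 _]. apply In_box_of_deg; auto.
  - apply (incl_box N K M HM); auto.
Qed.

Lemma Rpower_pow_swap x d k : 0 < x -> Rpower (x ^ k) d = Rpower x d ^ k.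
Proof.
  intros Hx. rewrite <- !Rpower_pow by (auto; apply Rpower_pos).
  rewrite !Rpower_mult. f_equal; ring.
Qed.

Lemma Q_pos theta Q : 0 < theta < 1 -> 2 / cos (theta * (PI / 2)) < INR Q -> (0 < Q)%nat.
Proof.
  intros Ht HQ. pose proof (kap_bounds theta Ht). destruct Q as [|Q']; [|lia]. simpl in HQ.
  assert (0 < 2 / cos (theta * (PI / 2))) by (apply Rdiv_lt_0_compat; lra). lra.
Qed.

(** * The finite-rank approximant and its error *)

Section FiniteRank.
Context (theta delta : R) (n : nat).
Context (Ht : 0 < theta < 1) (Hd : 0 < delta <= 1).
Let N := S (S n).
Let kap := cos (theta * (PI / 2)).
(** Blocks of relative length 1/Q are then short enough that 2 j <= kap g for each offset j in the
    block starting at g. *)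
Context (Q : nat) (HQ : 2 / kap < INR Q).
Context (I : nat).
(** The factor N lets 4^(-m) outweigh the count K^N <= (2 * 2^I)^N and still leave 2^(-I). *)
Let m := (N * I)%nat.
Let K := (2 * grid Q I)%nat.
(** The first index encodes a block (its half) and a parity (its remainder modulo 2), the second a
    power of lens^2 - 1. *)
Let F (x : nat * nat) (z : C) : C :=
  Cmul (Cpow (lens theta z) (2 * grid Q (fst x / 2) + fst x mod 2))
       (Cpow (Csub (Cmul (lens theta z) (lens theta z)) C1) (snd x)).

Lemma block_index k : exists tj : nat * nat, (k < K)%nat ->
  (fst tj < 2 * I)%nat /\ k = (2 * (grid Q (fst tj / 2) + snd tj) + fst tj mod 2)%nat /\
  (snd tj * Q <= grid Q (fst tj / 2))%nat.
Proof.
  destruct (Compare_dec.le_lt_dec K k); [exists (0, 0)%nat; lia|].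
  destruct (grid_block Q I (k / 2) (Q_pos theta Q Ht HQ)) as (i & j & H1 & H2 & H3).
  { unfold K in l. apply Nat.Div0.div_lt_upper_bound; lia. }
  exists (2 * i + k mod 2, j)%nat; intros _; cbn [fst snd].
  pose proof (Nat.mod_upper_bound k 2 ltac:(lia)).
  assert (E1 : ((2 * i + k mod 2) / 2 = i)%nat).
  { rewrite Nat.mul_comm, Nat.div_add_l by lia. rewrite (Nat.div_small (k mod 2)) by lia. lia. }
  assert (E2 : ((2 * i + k mod 2) mod 2 = k mod 2)%nat).
  { rewrite Nat.add_comm, Nat.mul_comm, Nat.Div0.mod_add. apply Nat.mod_small; lia. }
  rewrite E1, E2. repeat split; auto; [lia|].
  pose proof (Nat.div_mod_eq k 2). lia.
Qed.

Let B (k : nat) : nat * nat := proj1_sig (constructive_indefinite_description _ (block_index k)).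
Let idx : list (nat * nat) := list_prod (seq 0 (2 * I)) (seq 0 m).
(** Coordinates of the approximant of lens^k: binomial coefficients of the offset of k in its block,
    and nothing for k >= K, so that high degrees are dropped. *)
Let coef (k : nat) (x : nat * nat) : C :=
  if andb (Nat.ltb k K) (Nat.eqb (fst x) (fst (B k))) then RtoC (bin (snd (B k)) (snd x)) else C0.
Let Ak (k : nat) (z : C) : C := Csum (map (fun x => Cmul (coef k x) (F x z)) idx).

Lemma Ak_high k z : (K <= k)%nat -> Ak k z = C0.
Proof.
  intros Hk. apply Csum_zero; intros x _. unfold coef.
  destruct (Nat.ltb_spec k K); [lia|]. cbn [andb]. ring.
Qed.

Lemma Ak_low k z : (k < K)%nat -> Cmod z < 1 -> Cmod (Csub (Cpow (lens theta z) k) (Ak k z)) <= (/ 2) ^ m.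
Proof.
  intros Hk Hz.
  assert (HB : (fst (B k) < 2 * I)%nat /\ k = (2 * (grid Q (fst (B k) / 2) + snd (B k)) + fst (B k) mod 2)%nat /\
    (snd (B k) * Q <= grid Q (fst (B k) / 2))%nat).
  { unfold B; destruct constructive_indefinite_description; auto. }
  destruct HB as (H1 & H2 & H3).
  assert (E : Ak k z = Cmul (Cpow (lens theta z) (2 * grid Q (fst (B k) / 2) + fst (B k) mod 2))
     (taylor m (snd (B k)) (Csub (Cmul (lens theta z) (lens theta z)) C1))).
  { unfold Ak, idx. rewrite Csum_list_prod.
    rewrite (Csum_single _ _ (fst (B k))); [|apply seq_NoDup|apply in_seq; lia|].
    - unfold taylor. rewrite <- Csum_scal. apply Csum_ext; intros s _. unfold coef, F; cbn [fst snd].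
      rewrite Nat.eqb_refl. destruct (Nat.ltb_spec k K); [|lia]. cbn [andb]. ring.
    - intros t _ Hne. apply Csum_zero; intros s _. unfold coef; cbn [fst snd].
      apply Nat.eqb_neq in Hne. rewrite Hne, Bool.andb_false_r. ring. }
  rewrite E. rewrite H2 at 1.
  destruct (lens_bounds theta Ht z Hz) as [L _]. fold kap in L.
  pose proof (kap_bounds theta Ht) as Hkap. fold kap in Hkap.
  apply (block_approx (lens theta z) kap); auto.
  apply le_INR in H3. rewrite mult_INR in H3. pose proof (pos_INR (snd (B k))).
  assert (2 <= kap * INR Q).
  { replace 2 with (kap * (2 / kap)) by (field; lra). apply Rmult_le_compat_l; lra. }
  apply Rle_trans with (kap * (INR (snd (B k)) * INR Q)); [nra|]. apply Rmult_le_compat_l; lra.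
Qed.

Lemma F_family x : exists v, l2 N v /\ forall p, inD N p -> series_at N v p (F x (p 0%nat)).
Proof.
  apply (embed_bounded N (F x) ((2 ^ snd x) * (2 ^ snd x))); [unfold N; lia| |].
  - intros r Hr. pose proof (inA_lens theta Ht r Hr) as HL.
    apply (inA_mul r (fun z => Cpow (lens theta z) (2 * grid Q (fst x / 2) + fst x mod 2))); [lra|apply inA_pow; auto; lra|].
    apply inA_pow; [lra|]. apply inA_sub; [lra|apply inA_mul; auto; lra|apply inA_const].
  - intros z Hz. apply Cmod_le_iff; [apply pow_le; lra|]. unfold F.
    pose proof (Cmod_lens_lt theta Ht z Hz) as Hl. pose proof (Cmod_nonneg (lens theta z)).
    rewrite Cmod_mul, !Cmod_pow. rewrite <- (Rmult_1_l (2 ^ snd x)).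
    apply Rmult_le_compat; try (apply pow_le, Cmod_nonneg).
    + apply Rle_trans with (1 ^ (2 * grid Q (fst x / 2) + fst x mod 2)); [apply pow_incr; lra|rewrite pow1; lra].
    + apply pow_incr; split; [apply Cmod_nonneg|].
      eapply Rle_trans; [apply Cmod_sub_triangle|]. rewrite Cmod_mul, Cmod_C1. nra.
Qed.

Let V (x : nat * nat) : family := proj1_sig (constructive_indefinite_description _ (F_family x)).
Let cs (a : family) (x : nat * nat) : C :=
  Csum (map (fun al => Cmul (a al) (coef (list_sum al) x)) (box N K)).
Let Rop (a : family) : family := lincomb (map (cs a) idx) (map V idx).
Let Rfun (a : family) (z : C) : C := Csum (map (fun x => Cmul (cs a x) (F x z)) idx).

Lemma V_spec x : l2 N (V x) /\ forall p, inD N p -> series_at N (V x) p (F x (p 0%nat)).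
Proof. unfold V; destruct constructive_indefinite_description; auto. Qed.

Lemma Rop_eq a al : Rop a al = Csum (map (fun x => Cmul (cs a x) (V x al)) idx).
Proof. apply lincomb_map. Qed.

(** Interchange of finite sums. The truncation M is free beyond K, so it can be matched with that of
    the diagonal series. *)
Lemma Rfun_eq a z M : (K <= M)%nat ->
  Rfun a z = Csum (map (fun al => Cmul (a al) (Ak (list_sum al) z)) (box N M)).
Proof.
  intros HM. rewrite (Csum_box_low _ N K M); auto.
  - unfold Rfun, cs.
    rewrite (Csum_ext _ (fun x => Csum (map (fun al => Cmul (Cmul (a al) (coef (list_sum al) x)) (F x z)) (box N K)))).
    + rewrite Csum_swap. apply Csum_ext; intros al _. unfold Ak. rewrite <- Csum_scal.
      apply Csum_ext; intros; ring.
    + intros x _. set (s := Csum _). replace (Cmul s (F x z)) with (Cmul (F x z) s) by ring.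
      unfold s; rewrite <- Csum_scal. apply Csum_ext; intros; ring.
  - intros al Hal. rewrite Ak_high by auto. ring.
Qed.

Lemma l2_ext a a' : (forall al, a al = a' al) -> l2 N a -> l2 N a'.
Proof.
  intros E [s Hs]. destruct (l2_bound N a (ex_intro _ s Hs)) as (D & _ & HD).
  apply (l2_of_bound N a' D). intros k. rewrite <- (Rsum_ext (fun al => Cnorm2 (a al))); auto.
  intros; rewrite E; auto.
Qed.

Lemma Rop_l2 a : l2 N (Rop a).
Proof.
  apply l2_ext with (a := fun al => Csum (map (fun x => Cmul (cs a x) (V x al)) idx)).
  - intros; symmetry; apply Rop_eq.
  - apply l2_Csum; intros; apply V_spec.
Qed.

Lemma Rop_series a p : inD N p -> series_at N (Rop a) p (Rfun a (p 0%nat)).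
Proof.
  intros Hp. eapply Ccv_ext; [|apply (series_Csum N (cs a) V (fun x => F x (p 0%nat)) idx p)].
  - exists 0%nat; intros k _. apply Csum_ext; intros; rewrite Rop_eq; auto.
  - intros x _; apply V_spec; auto.
Qed.

Lemma Rop_linear a a' c al :
  Rop (fun be => Cadd (a be) (Cmul c (a' be))) al = Cadd (Rop a al) (Cmul c (Rop a' al)).
Proof.
  rewrite !Rop_eq, <- Csum_scal, <- Csum_add. apply Csum_ext; intros x _.
  assert (E : cs (fun be => Cadd (a be) (Cmul c (a' be))) x = Cadd (cs a x) (Cmul c (cs a' x))).
  { unfold cs. rewrite <- Csum_scal, <- Csum_add. apply Csum_ext; intros; ring. }
  rewrite E; ring.
Qed.

(** The error splits into the high-degree part [ahi], controlled on average by the weighted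
    estimate, and the Taylor errors [e] of low degrees, controlled pointwise by Cauchy-Schwarz over
    at most K^N indices. The factor 8 is 4 from the passage to coefficients times 2 from the
    splitting. *)
Lemma Rop_error Kc : (forall a M r k, 0 < r < 1 -> (0 < k)%nat ->
    avg (4 * k) (fun l => Cnorm2 (diag_sum N a M (lens theta (gpt r (4 * k) l))))
    <= Kc * Rsum (map (fun al => Cnorm2 (a al) * decay delta (list_sum al)) (box N M))) ->
  0 < Kc -> forall a b, l2 N a -> l2 N b -> comp_rel N (Phi_lens theta) a b ->
  forall s t, sqsum N (fsub b (Rop a)) s -> sqsum N a t ->
  s <= (8 * Kc * decay delta K + 8 * (INR K ^ N * (/ 4) ^ m)) * t.
Proof.
  intros HC HC0 a b Ha Hb Hab s t Hs Htt.
  destruct (diag_function theta N a Ht (l2_asum N a Ha)) as (h & Hh).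
  pose proof (comp_rel_function theta N a b h Hab ltac:(unfold N; lia) Hh) as Hbh.
  replace ((8 * Kc * decay delta K + 8 * (INR K ^ N * (/ 4) ^ m)) * t)
    with (4 * (2 * (Kc * (decay delta K * t)) + 2 * (t * (INR K ^ N * (/ 4) ^ m)))) by ring.
  apply (sqsum_le _ _ _ _ Hs).
  apply (sqsum_of_approx N _ (fun z => Csub (h z) (Rfun a z))); [unfold N; lia| | |].
  - apply l2_asum, l2_sub; auto using Rop_l2.
  - intros p Hp. apply series_sub; auto. apply Rop_series; auto.
  - intros r eps Hr He.
    destruct (diag_function_uniform theta N a h r eps Ht (l2_asum N a Ha) Hh Hr He) as [M0 HM].
    set (M := (M0 + K)%nat).
    exists (fun z => Csub (diag_sum N a M (lens theta z)) (Rfun a z)). split.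
    + intros z Hz. replace (Csub (Csub (h z) (Rfun a z)) (Csub (diag_sum N a M (lens theta z)) (Rfun a z)))
        with (Csub (h z) (diag_sum N a M (lens theta z))) by ring.
      apply HM; auto. unfold M; lia.
    + intros k Hk.
      set (ahi := fun al => if Nat.ltb (list_sum al) K then C0 else a al).
      set (e := fun z al => if Nat.ltb (list_sum al) K
                then Csub (Cpow (lens theta z) (list_sum al)) (Ak (list_sum al) z) else C0).
      apply Rle_trans with (avg (4 * k) (fun l => 2 * Cnorm2 (diag_sum N ahi M (lens theta (gpt r (4 * k) l)))
         + 2 * (t * (INR K ^ N * (/ 4) ^ m)))).
      * apply avg_le; intros l _. set (z := gpt r (4 * k) l).
        assert (Hz : Cmod z < 1) by (unfold z; rewrite Cmod_gpt; lra).
        replace (Csub (diag_sum N a M (lens theta z)) (Rfun a z))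
          with (Cadd (diag_sum N ahi M (lens theta z)) (Csum (map (fun al => Cmul (a al) (e z al)) (box N M)))).
        2:{ rewrite (Rfun_eq a z M) by (unfold M; lia). unfold diag_sum.
            rewrite <- Csum_sub, <- Csum_add. apply Csum_ext; intros al _. unfold ahi, e.
            destruct (Nat.ltb_spec (list_sum al) K); [ring|]. rewrite Ak_high by auto. ring. }
        eapply Rle_trans; [apply Cnorm2_add_le|]. apply Rplus_le_compat_l, Rmult_le_compat_l; [lra|].
        eapply Rle_trans; [apply Cnorm2_Csum_mul_le|].
        apply Rmult_le_compat; try (apply Rsum_nonneg; intros; apply Cnorm2_nonneg).
        -- eapply sqsum_ge; eauto.
        -- apply Rle_trans with (Rsum (map (fun al => if Nat.ltb (list_sum al) K then (/ 4) ^ m else 0) (box N M))).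
           ++ apply Rsum_le; intros al _. unfold e. destruct (Nat.ltb_spec (list_sum al) K).
              ** replace (/ 4) with (/ 2 * / 2) by field. rewrite Rpow_mult_distr.
                 apply Cmod_le_iff; [apply pow_le; lra|]. apply Ak_low; auto.
              ** rewrite Cnorm2_C0; lra.
           ++ eapply Rle_trans; [apply (Rsum_box_low (fun _ => (/ 4) ^ m)); intros; apply pow_le; lra|].
              rewrite Rsum_const, length_box, pow_INR. lra.
      * rewrite avg_plus, avg_scal, avg_const by lia. apply Rplus_le_compat_r, Rmult_le_compat_l; [lra|].
        eapply Rle_trans; [apply HC; auto|]. apply Rmult_le_compat_l; [lra|].
        pose proof (sqsum_ge _ _ _ M Htt) as G.
        apply Rle_trans with (decay delta K * Rsum (map (fun al => Cnorm2 (a al)) (box N M))).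
        -- rewrite <- Rsum_scal. apply Rsum_le; intros al _. unfold ahi.
           pose proof (decay_pos delta K). pose proof (Cnorm2_nonneg (a al)).
           destruct (Nat.ltb_spec (list_sum al) K).
           ++ rewrite Cnorm2_C0; nra.
           ++ rewrite Rmult_comm. apply Rmult_le_compat_r; auto. apply decay_anti; auto; lra.
        -- apply Rmult_le_compat_l; auto. left; apply decay_pos.
Qed.

(** The high degrees decay like (1 + 1/Q)^(-delta I). The low ones give (2 * 2^I)^N 4^(-N I) = (2 *
    2^(-I))^N <= 2^N 2^(-I). The larger of the two rates is kept. *)
Lemma error_rate Kc : 0 < Kc ->
  8 * Kc * decay delta K + 8 * (INR K ^ N * (/ 4) ^ m)
  <= (8 * Kc + 8 * 2 ^ N) * Rmax (Rpower (/ (1 + / INR Q)) delta) (/ 2) ^ I.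
Proof.
  intros HC0. pose proof (Q_pos theta Q Ht HQ) as HQp. assert (HQ0 : 0 < INR Q) by (apply lt_0_INR; auto).
  assert (0 < / INR Q) by (apply Rinv_pos; auto).
  set (rho := Rpower (/ (1 + / INR Q)) delta). set (q := Rmax rho (/ 2)).
  assert (Hrho : 0 < rho) by apply Rpower_pos.
  assert (E1 : decay delta K <= q ^ I).
  { apply Rle_trans with (rho ^ I); [|apply pow_incr; split; [lra|apply Rmax_l]].
    unfold rho. rewrite <- Rpower_pow_swap by (apply Rinv_pos; lra).
    eapply Rle_trans; [apply (decay_anti delta (grid Q I)); [lra|unfold K; lia]|].
    unfold decay. apply Rle_Rpower_l; [lra|]. split; [apply Rinv_pos, lt_0_INR; lia|].
    rewrite pow_inv. apply Rinv_le_contravar; [apply pow_lt; lra|apply grid_lower; auto]. }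
  assert (E2 : INR K ^ N * (/ 4) ^ m <= 2 ^ N * q ^ I).
  { unfold m. rewrite Nat.mul_comm, pow_mult, <- Rpow_mult_distr.
    assert (HK : INR K <= 2 * 2 ^ I).
    { unfold K. rewrite mult_INR. simpl (INR 2). pose proof (grid_upper Q I HQp) as U.
      apply le_INR in U. rewrite pow_INR, S_INR in U. simpl (INR 2) in U. replace (1 + 1) with 2 in * by ring. lra. }
    apply Rle_trans with ((2 * (/ 2) ^ I) ^ N).
    - apply pow_incr. split; [apply Rmult_le_pos; [apply pos_INR|apply pow_le; lra]|].
      replace ((/ 2) ^ I) with (2 ^ I * (/ 4) ^ I) by (rewrite <- Rpow_mult_distr; f_equal; field).
      rewrite <- Rmult_assoc. apply Rmult_le_compat_r; [apply pow_le; lra|auto].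
    - rewrite Rpow_mult_distr. apply Rmult_le_compat_l; [apply pow_le; lra|].
      apply Rle_trans with ((/ 2) ^ I); [|apply pow_incr; split; [lra|apply Rmax_r]].
      rewrite <- (pow_1 ((/ 2) ^ I)) at 2. apply pow_le_anti; [|unfold N; lia].
      split; [apply pow_le; lra|]. apply Rle_trans with (1 ^ I); [apply pow_incr; lra|rewrite pow1; lra]. }
  pose proof (pow_lt 2 N ltac:(lra)).
  assert (8 * Kc * decay delta K <= 8 * Kc * q ^ I) by (apply Rmult_le_compat_l; lra). lra.
Qed.

Lemma finite_rank_operator Kc : (forall a M r k, 0 < r < 1 -> (0 < k)%nat ->
    avg (4 * k) (fun l => Cnorm2 (diag_sum N a M (lens theta (gpt r (4 * k) l))))
    <= Kc * Rsum (map (fun al => Cnorm2 (a al) * decay delta (list_sum al)) (box N M))) ->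
  0 < Kc ->
  exists (Rop : family -> family) (vs : list family),
    length vs = (2 * I * (N * I))%nat /\ (forall v, In v vs -> l2 N v) /\
    (forall a a' c al, Rop (fun be => Cadd (a be) (Cmul c (a' be))) al = Cadd (Rop a al) (Cmul c (Rop a' al))) /\
    (forall a, exists cs, length cs = length vs /\ forall al, Rop a al = lincomb cs vs al) /\
    (forall a b, l2 N a -> l2 N b -> comp_rel N (Phi_lens theta) a b ->
       forall s t, sqsum N (fsub b (Rop a)) s -> sqsum N a t ->
       s <= (8 * Kc + 8 * 2 ^ N) * Rmax (Rpower (/ (1 + / INR Q)) delta) (/ 2) ^ I * t).
Proof.
  intros HC HC0. exists Rop, (map V idx). split; [|split; [|split; [|split]]].
  - unfold idx. rewrite length_map, length_prod, !length_seq. auto.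
  - intros v Hv; apply in_map_iff in Hv as (x & <- & _). apply V_spec.
  - exact Rop_linear.
  - intros a. exists (map (cs a) idx). rewrite !length_map. auto.
  - intros a b Ha Hb Hab s t Hs Htt. pose proof (sqsum_nonneg _ _ _ Htt).
    eapply Rle_trans; [apply (Rop_error Kc HC HC0 a b Ha Hb Hab s t Hs Htt)|].
    apply Rmult_le_compat_r; auto. apply error_rate; auto.
Qed.
End FiniteRank.

(* The rank [2 N I^2] is below [k] while the error is of order [q^I] with [I] of order [sqrt k]. *)
Lemma approx_numbers_decay theta n delta : 0 < theta < 1 -> 0 < delta <= 1 ->
  theta * INR (S (S n)) + theta * delta <= 1 ->
  exists d, 0 < d /\ exists K, 0 < K /\ forall k : nat, (1 <= k)%nat ->
    approx_num_le (S (S n)) (Phi_lens theta) k (K * exp (- d * sqrt (INR k))).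
Proof.
  intros Ht Hd Hexp. set (N := S (S n)) in *.
  destruct (circle_average_diag_sum theta n delta Ht ltac:(lra) Hexp) as (Kc & HC0 & HC). fold N in HC.
  destruct (INR_unbounded (2 / cos (theta * (PI / 2)))) as [Q HQ].
  pose proof (Q_pos theta Q Ht HQ) as HQp.
  set (q := Rmax (Rpower (/ (1 + / INR Q)) delta) (/ 2)).
  set (A := 8 * Kc + 8 * 2 ^ N).
  assert (HA : 0 < A) by (unfold A; pose proof (pow_lt 2 N ltac:(lra)); lra).
  assert (Hq : / 2 <= q < 1).
  { split; [apply Rmax_r|]. apply Rmax_lub_lt; [|lra].
    assert (0 < / INR Q) by (apply Rinv_pos, lt_0_INR; auto).
    apply Rlt_le_trans with (exp 0); [|rewrite exp_0; lra].
    apply exp_increasing. rewrite ln_Rinv by lra.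
    assert (ln 1 < ln (1 + / INR Q)) by (apply ln_increasing; lra). rewrite ln_1 in *. nra. }
  set (gam := - ln q).
  assert (Hgam : 0 < gam).
  { unfold gam. assert (ln q < ln 1) by (apply ln_increasing; lra). rewrite ln_1 in H; lra. }
  assert (Hqe : q = exp (- gam)) by (unfold gam; rewrite Ropp_involutive, exp_ln; lra).
  set (D := sqrt (2 * INR N)).
  assert (HN0 : 0 < INR N) by (apply lt_0_INR; unfold N; lia).
  assert (HD : 0 < D) by (apply sqrt_lt_R0; lra).
  (* The squared error is at most A exp(-gam I) times the squared norm, hence the 2; sqrt k <= D
     (I+1) converts I into sqrt k, and exp(gam) in the constant absorbs the + 1. *)
  exists (gam / (2 * D)). split; [apply Rdiv_lt_0_compat; lra|].
  exists (sqrt (A * exp gam)). pose proof (exp_pos gam) as Heg.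
  split; [apply sqrt_lt_R0; nra|].
  intros k Hk eps Heps.
  (* The largest I with 2 N I^2 <= k - 1, since the rank has to be strictly below k. *)
  set (I := Nat.sqrt ((k - 1) / (2 * N))).
  destruct (finite_rank_operator theta delta n Ht Hd Q HQ I Kc HC HC0)
    as (Rop & vs & Hlen & Hvs & Hlin & Hrg & Herr). fold N in Hlen, Hvs, Herr. fold q A in Herr.
  pose proof (Nat.sqrt_spec ((k - 1) / (2 * N)) ltac:(lia)) as [S1 S2]. fold I in S1, S2.
  exists Rop, vs. split; [|split; [|split; [|split]]]; auto.
  - rewrite Hlen. pose proof (Nat.Div0.mul_div_le (k - 1) (2 * N)). nia.
  - intros a b Ha Hb Hab s t Hs Htt. pose proof (sqsum_nonneg _ _ _ Htt) as Ht0.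
    eapply Rle_trans; [apply (Herr a b Ha Hb Hab s t Hs Htt)|].
    apply Rmult_le_compat_r; auto.
    set (E := sqrt (A * exp gam) * exp (- (gam / (2 * D)) * sqrt (INR k))).
    assert (HE : 0 < E) by (unfold E; apply Rmult_lt_0_compat; [apply sqrt_lt_R0; nra|apply exp_pos]).
    apply Rle_trans with (E * E); [|nra].
    assert (EE : E * E = A * (exp gam * exp (- (gam / D) * sqrt (INR k)))).
    { unfold E. replace (sqrt (A * exp gam) * exp (- (gam / (2 * D)) * sqrt (INR k)) *
        (sqrt (A * exp gam) * exp (- (gam / (2 * D)) * sqrt (INR k))))
        with ((sqrt (A * exp gam) * sqrt (A * exp gam)) *
          (exp (- (gam / (2 * D)) * sqrt (INR k)) * exp (- (gam / (2 * D)) * sqrt (INR k)))) by ring.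
      rewrite sqrt_sqrt by nra. rewrite <- (exp_plus (- (gam / (2 * D)) * sqrt (INR k))).
      rewrite Rmult_assoc. do 3 f_equal. field; lra. }
    rewrite EE. apply Rmult_le_compat_l; [lra|].
    rewrite Hqe, exp_pow, <- exp_plus. apply exp_le.
    assert (Hsk : sqrt (INR k) <= D * (INR I + 1)).
    { assert (HkN : (k <= 2 * N * (S I * S I))%nat).
      { pose proof (Nat.mul_succ_div_gt (k - 1) (2 * N) ltac:(unfold N; lia)). nia. }
      apply le_INR in HkN. rewrite !mult_INR, (S_INR I) in HkN. simpl (INR 2) in HkN.
      pose proof (pos_INR I).
      rewrite <- (sqrt_square (INR I + 1)) by lra. unfold D. rewrite <- sqrt_mult by nra.
      apply sqrt_le_1_alt. lra. }
    replace (- (gam / D) * sqrt (INR k)) with (- (gam * (sqrt (INR k) / D))) by (field; lra).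
    assert (sqrt (INR k) / D <= INR I + 1).
    { apply Rle_div_l; lra. }
    nra.
Qed.

Theorem theorem2p4 (N : nat) (theta : R) :
  (2 <= N)%nat -> 0 < theta < 1 ->
  (theta > 1 / INR N -> ~ CPhi_bounded N (Phi_lens theta)) /\
  (theta = 1 / INR N ->
     CPhi_bounded N (Phi_lens theta) /\ ~ CPhi_compact N (Phi_lens theta)) /\
  (theta < 1 / INR N ->
     CPhi_compact N (Phi_lens theta) /\
     exists d, 0 < d /\ exists K, 0 < K /\
       forall n : nat, (1 <= n)%nat ->
         approx_num_le N (Phi_lens theta) n (K * exp (- d * sqrt (INR n)))).
Proof.
  intros HN Ht. destruct N as [|[|n]]; [lia|lia|].
  assert (HN0 : 0 < INR (S (S n))) by (apply lt_0_INR; lia).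
  assert (E : 1 / INR (S (S n)) * INR (S (S n)) = 1) by (field; lra).
  split; [|split]; intros H.
  - apply composition_unbounded; auto. nra.
  - assert (theta * INR (S (S n)) = 1) by (rewrite H; auto).
    split; [apply composition_bounded; auto; lra|apply composition_not_compact; auto].
  - assert (H1 : theta * INR (S (S n)) < 1) by nra.
    set (delta := Rmin 1 ((1 - theta * INR (S (S n))) / theta)).
    assert (Hd : 0 < delta <= 1).
    { split; [apply Rmin_glb_lt; [lra|apply Rdiv_lt_0_compat; lra]|apply Rmin_l]. }
    assert (Hexp : theta * INR (S (S n)) + theta * delta <= 1).
    { pose proof (Rmin_r 1 ((1 - theta * INR (S (S n))) / theta)) as H2. fold delta in H2.
      apply Rmult_le_compat_l with (r := theta) in H2; [|lra].
      replace (theta * ((1 - theta * INR (S (S n))) / theta)) with (1 - theta * INR (S (S n))) in H2 by (field; lra).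
      lra. }
    split; [apply (composition_compact theta n delta); auto|].
    apply (approx_numbers_decay theta n delta); auto.
Qed.
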